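(* Let $\mathfrak g,\tilde{\mathfrak g}$ be simple finite dimensional Lie algebras over $\mathbb F\in\{\mathbb R,\mathbb C\}$ and $\sigma\in\mathrm{Aut}\,\mathfrak g$, $\tilde\sigma\in\mathrm{Aut}\,\tilde{\mathfrak g}$ of finite order. (i) Every isomorphism $\varphi:L_{\mathrm{alg}}(\mathfrak g,\sigma)\to L_{\mathrm{alg}}(\tilde{\mathfrak g},\tilde\sigma)$ is induced by some isomorphism $\hat\varphi:\hat L_{\mathrm{alg}}(\mathfrak g,\sigma)\to\hat L_{\mathrm{alg}}(\tilde{\mathfrak g},\tilde\sigma)$. (ii) The natural map $\mathrm{Aut}\,\hat L'_{\mathrm{alg}}(\mathfrak g,\sigma)\to\mathrm{Aut}\,L_{\mathrm{alg}}(\mathfrak g,\sigma)$ is a group isomorphism. (iii) The kernel of the restriction map $\mathrm{Aut}\,\hat L_{\mathrm{alg}}(\mathfrak g,\sigma)\to\mathrm{Aut}\,\hat L'_{\mathrm{alg}}(\mathfrak g,\sigma)$ is $\{\hat\varphi:\exists\nu\in\mathbb F,\ \hat\varphi c=c,\ \hat\varphi d=d+\nu c,\ \hat\varphi u=u\ \forall u\in L_{\mathrm{alg}}(\mathfrak g,\sigma)\}$, which is isomorphic to $(\mathbb F,+)$. (iv) $\mathrm{Aut}\,\hat L_{\mathrm{alg}}(\mathfrak g,\sigma)\cong\mathrm{Aut}_{(,)}\hat L_{\mathrm{alg}}(\mathfrak g,\sigma)\times\mathbb F$, where $\mathrm{Aut}_{(,)}$ denotes the subgroup of automorphisms preserving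 the natural bilinear form.
   Context: For $\sigma^l=\mathrm{id}$, $L_{\mathrm{alg}}(\mathfrak g,\sigma)=\{u:\mathbb R\to\mathfrak g\mid u(t+2\pi)=\sigma u(t),\ u(t)=\sum_{|n|\le N}u_ne^{int/l},\ u_n\in\mathfrak g_{\mathbb C}\}$ ($\mathfrak g_{\mathbb C}$ the complexification if $\mathbb F=\mathbb R$, $\mathfrak g$ if $\mathbb F=\mathbb C$) with pointwise bracket $[u,v]_0$. With $(u,v)=\frac1{2\pi}\int_0^{2\pi}(u(t),v(t))_0dt$, $(\cdot,\cdot)_0$ the Killing form, $\hat L_{\mathrm{alg}}(\mathfrak g,\sigma)=L_{\mathrm{alg}}(\mathfrak g,\sigma)\oplus\mathbb Fc\oplus\mathbb Fd$ with $c$ central, $[d,u]=-[u,d]=u'$, $[u,v]=[u,v]_0+(u',v)c$; its natural bilinear form extends $(\cdot,\cdot)$ by $c,d\perp L_{\mathrm{alg}}$, $(c,c)=(d,d)=0$, $(c,d)=1$. $\hat L'_{\mathrm{alg}}(\mathfrak g,\sigma)=L_{\mathrm{alg}}(\mathfrak g,\sigma)\oplus\mathbb Fc$ is the derived algebra, with center $\mathbb Fc$. An isomorphism $\hat\varphi$ of the affine algebras restricts to one of the derived algebras, which induces one $\varphi$ of the loop algebras by passing to the quotient by $\mathbb Fc$; $\hat\varphi$ is said to induce $\varphi$. *)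

(* Defs.v *)
From HB Require Import structures.
From mathcomp Require Import all_boot all_order all_algebra.
From Stdlib Require Import ClassicalEpsilon.
Set Implicit Arguments. Unset Strict Implicit. Unset Printing Implicit Defensive.
Import Order.TTheory GRing.Theory Num.Theory.
Local Open Scope ring_scope.

Section Defs.
(* C plays the role of the complex numbers; its real elements are "R". *)
Variable C : numClosedFieldType.
(* isR = true : base field F = R ; isR = false : base field F = C. *)
Variable isR : bool.

Definition inF (a : C) : bool := isR ==> (a \is Num.real).

(* ---------- abstract Lie algebras: carrier + membership + operations ------ *)
Record LieAlg := MkLie {
  car : Type; mem : car -> Prop;
  ladd : car -> car -> car; lscl : C -> car -> car; lbrk : car -> car -> car }.

(* F-linear Lie algebra isomorphism A -> B (bijective between members). *)
Definition is_iso (A B : LieAlg) (f : car A -> car B) : Prop :=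
  (forall x, mem x -> mem (f x)) /\
  (forall x y, mem x -> mem y -> f (ladd x y) = ladd (f x) (f y)) /\
  (forall a x, inF a -> mem x -> f (lscl a x) = lscl a (f x)) /\
  (forall x y, mem x -> mem y -> f (lbrk x y) = lbrk (f x) (f y)) /\
  (forall x y, mem x -> mem y -> f x = f y -> x = y) /\
  (forall y, mem y -> exists2 x, mem x & f x = y).

Definition is_aut (A : LieAlg) (f : car A -> car A) := @is_iso A A f.

(* equality of maps as elements of Aut A *)
Definition eqOn (A : LieAlg) (f g : car A -> car A) :=
  forall x, mem x -> f x = g x.

(* ---------- finite dimensional Lie algebras via structure constants ------- *)
(* g = F^n (rows with F-coordinates) inside g_C = C^n, bracket given by
   structure constants lsc (which are required to lie in F). *)
Record lie_data := LieData { ldim : nat; lsc : 'I_ldim -> 'I_ldim -> 'I_ldim -> C }.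

Definition inFv n (x : 'rV[C]_n) : Prop := forall i, inF (x 0 i).

Definition gbr (g : lie_data) (x y : 'rV[C]_(ldim g)) : 'rV[C]_(ldim g) :=
  \row_k \sum_i \sum_j x 0 i * y 0 j * @lsc g i j k.

Definition is_lie (g : lie_data) : Prop :=
  (forall i j k, inF (@lsc g i j k)) /\
  (forall x, inFv x -> @gbr g x x = 0) /\
  (forall x y z, inFv x -> inFv y -> inFv z ->
     @gbr g x (@gbr g y z) + @gbr g y (@gbr g z x) + @gbr g z (@gbr g x y) = 0).

Definition is_ideal (g : lie_data) (I : 'rV[C]_(ldim g) -> Prop) : Prop :=
  (forall x, I x -> inFv x) /\ I 0 /\
  (forall a x y, inF a -> I x -> I y -> I (a *: x + y)) /\
  (forall x y, inFv x -> I y -> I (@gbr g x y)).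

(* simple: non-abelian, and only the trivial ideals *)
Definition is_simple (g : lie_data) : Prop :=
  is_lie g /\
  (exists x y, [/\ inFv x, inFv y & @gbr g x y <> 0]) /\
  (forall I, @is_ideal g I ->
     (forall x, I x -> x = 0) \/ (forall x, inFv x -> I x)).

(* automorphism of g, acting on rows: x |-> x *m s *)
Definition is_gaut (g : lie_data) (s : 'M[C]_(ldim g)) : Prop :=
  (forall i j, inF (s i j)) /\ s \in unitmx /\
  (forall x y, inFv x -> inFv y -> @gbr g (x *m s) (y *m s) = @gbr g x y *m s).

(* Killing form (computed on g_C; restricts to that of g) *)
Definition adm (g : lie_data) (x : 'rV[C]_(ldim g)) : 'M[C]_(ldim g) :=
  \matrix_(j, k) (@gbr g x (delta_mx 0 j)) 0 k.
Definition kil (g : lie_data) (x y : 'rV[C]_(ldim g)) : C :=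
  \tr (@adm g y *m @adm g x).

(* ---------- loop algebra: Fourier coefficients ---------------------------- *)
(* u(t) = sum_k u_k e^{ikt/l}; an element is encoded by k |-> u_k in g_C. *)
Definition loopT (g : lie_data) := int -> 'rV[C]_(ldim g).

(* e^{2 pi i / l} *)
Definition eps (l : nat) : C := (l.-root (-1)) ^+ 2.

Definition finsupp (g : lie_data) (u : loopT g) : Prop :=
  exists N : nat, forall k : int, (N < `|k|)%N -> u k = 0.

Definition bnd (g : lie_data) (u : loopT g) : nat :=
  epsilon (inhabits 0%N) (fun N : nat => forall k : int, (N < `|k|)%N -> u k = 0).

(* sum over k in [-bnd u, bnd u] *)
Definition isum (g : lie_data) (u : loopT g) (V : zmodType) (F : int -> V) : V :=
  \sum_(j < (bnd u).*2.+1) F (j%:Z - (bnd u)%:Z).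

Definition inL (g : lie_data) (s : 'M[C]_(ldim g)) (l : nat) (u : loopT g) : Prop :=
  finsupp u /\
  (forall k : int, u k *m s = eps l ^ k *: u k) /\     (* u(t+2pi) = s u(t) *)
  (isR -> forall k : int, u (- k) = \row_i (u k 0 i)^*). (* u real-valued  *)

Definition lpadd (g : lie_data) (u v : loopT g) : loopT g := fun k => u k + v k.
Definition lpscl (g : lie_data) (a : C) (u : loopT g) : loopT g := fun k => a *: u k.
(* pointwise bracket [u,v]_0 *)
Definition lpbr (g : lie_data) (u v : loopT g) : loopT g :=
  fun k => isum u (fun j => @gbr g (u j) (v (k - j))).
(* derivative d/dt *)
Definition derL (g : lie_data) (l : nat) (u : loopT g) : loopT g :=
  fun k => ('i * k%:~R / l%:R) *: u k.
(* (u,v) = 1/2pi int_0^{2pi} (u(t),v(t))_0 dt *)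
Definition formL (g : lie_data) (u v : loopT g) : C :=
  isum u (fun j => @kil g (u j) (v (- j))).

Definition Loop (g : lie_data) (s : 'M[C]_(ldim g)) (l : nat) : LieAlg :=
  @MkLie (loopT g) (inL s l) (@lpadd g) (@lpscl g) (@lpbr g).

(* ---------- affine algebra  L + Fc + Fd :  (u, gamma, delta) = u + gamma c + delta d *)
Definition affT (g : lie_data) := (loopT g * C * C)%type.

Definition aloop (g : lie_data) (x : affT g) : loopT g := x.1.1.
Definition acoef (g : lie_data) (x : affT g) : C := x.1.2.
Definition dcoef (g : lie_data) (x : affT g) : C := x.2.

Definition inAff (g : lie_data) s l (x : affT g) : Prop :=
  inL s l (aloop x) /\ inF (acoef x) /\ inF (dcoef x).
Definition inDer (g : lie_data) s l (x : affT g) : Prop :=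
  inAff s l x /\ dcoef x = 0.

Definition affadd (g : lie_data) (x y : affT g) : affT g :=
  (lpadd (aloop x) (aloop y), acoef x + acoef y, dcoef x + dcoef y).
Definition affscl (g : lie_data) (a : C) (x : affT g) : affT g :=
  (lpscl a (aloop x), a * acoef x, a * dcoef x).
(* [u + a c + b d, v + a' c + b' d] = [u,v]_0 + b v' - b' u' + (u',v) c *)
Definition affbr (g : lie_data) (l : nat) (x y : affT g) : affT g :=
  (lpadd (lpbr (aloop x) (aloop y))
        (lpadd (lpscl (dcoef x) (derL l (aloop y))) (lpscl (- dcoef y) (derL l (aloop x)))),
   formL (derL l (aloop x)) (aloop y), 0).
(* natural bilinear form *)
Definition formA (g : lie_data) (x y : affT g) : C :=
  formL (aloop x) (aloop y) + acoef x * dcoef y + dcoef x * acoef y.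

Definition Aff (g : lie_data) s l : LieAlg :=
  @MkLie (affT g) (inAff s l) (@affadd g) (@affscl g) (@affbr g l).
Definition Der (g : lie_data) s l : LieAlg :=
  @MkLie (affT g) (inDer s l) (@affadd g) (@affscl g) (@affbr g l).

Definition cA (g : lie_data) : affT g := (fun _ => 0, 1, 0).
Definition dA (g : lie_data) : affT g := (fun _ => 0, 0, 1).
Definition uA (g : lie_data) (u : loopT g) : affT g := (u, 0, 0).

(* the automorphism of the loop algebra induced (via the derived algebra and
   the quotient by Fc) by a map of the affine algebras *)
Definition induced (g h : lie_data) (f : affT g -> affT h) : loopT g -> loopT h :=
  fun u => aloop (f (uA u)).

(* automorphisms preserving the natural bilinear form *)
Definition is_aut_form (g : lie_data) s l (f : affT g -> affT g) : Prop :=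
  @is_aut (Aff s l) f /\
  forall x y, inAff s l x -> inAff s l y -> formA (f x) (f y) = formA x y.

End Defs.

(* Main.v *)
Require Import Defs.
From HB Require Import structures.
From mathcomp Require Import all_boot all_order all_algebra.
From mathcomp Require Import cyclic separable cyclotomic ring zify.
From mathcomp Require Import boolp functions.
Import Order.TTheory GRing.Theory Num.Theory.
Local Open Scope ring_scope.

(** Everything is complexified: a loop is a finitely supported sequence of Fourier
    coefficients, and the loops with values in a real form are the fixed points of a
    conjugation. An isomorphism phi carries multiplication by e^{it} to an operator X of
    the target commuting with all inner derivations, so X is a Laurent polynomial whose
    coefficients lie in the centroid of the complexified Lie algebra. As X is invertible
    and the real Lie algebra is simple, X is homogeneous, of some degree d <> 0. Hence
    phi^-1 o (d/dt) o phi is, up to a multiple of d/dt, a derivation commuting with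
    multiplication by e^{it}; such derivations are inner because the Killing form is
    nondegenerate, so that phi^-1 o (d/dt) o phi = a d/dt + ad w. Computing the trace of
    ad u ad v over the ring generated by X in two different frames shows that phi scales
    the invariant form by a constant k with (a k)^2 = 1. The constants a, k and the loop w
    give an explicit formula for a lift of phi. For an automorphism k = 1 and a = +-1, and
    the translations d |-> d + nu c are central; nu is recovered from the defect
    (F d, F d) / 2, which splits the automorphism group as a product. *)

(** The complexification of a simple real algebra can split into two conjugate ideals, and its
    centroid is then larger than the scalars: a priori X could have different degrees on the two
    factors. Conjugation exchanges the factors and turns X into its inverse, so the elements on
    which only degree d of X (and degree -d of its inverse) survives form a conjugation-stable
    ideal. Simplicity is used throughout in this form, which treats both base fields at once. The
    degree d is negative when the isomorphism reverses the parameter of the loops. It is not 0,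
    since an eigenvector of X would then pull back to a finitely supported loop on which e^{it} acts
    as a scalar. If lh is the period chosen for the target, then a = d/lh and k = lh/|d|: the target
    has lh degrees per period of its own e^{it}, but |d| degrees per period of X, and k is the ratio
    of the two ways of counting traces. Hence (a k)^2 = 1. The same count for the identity operator
    gives k dim g = dim h, which is why k = 1 for automorphisms. Nondegeneracy of the Killing form
    is obtained from Cartan's criterion and Engel's theorem, both proved here for the
    conjugation-stable notion of simplicity. *)

Set Implicit Arguments.
Unset Strict Implicit.
Unset Printing Implicit Defensive.

(** * Roots of unity *)

Section RootsOfUnity.
Variable C : numClosedFieldType.

Lemma prim_root_exists n : (0 < n)%N -> exists z : C, n.-primitive_root z.
Proof.
move=> n0; have [r] := closed_field_poly_normal ('X^n - 1 : {poly C}).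
rewrite lead_coefDl ?lead_coefXn ?size_polyN ?size_poly1 ?size_polyXn // scale1r => r_roots.
suff /hasP[z _ pz] : has n.-primitive_root r by exists z.
apply: has_prim_root => //.
- by apply/allP => z; rewrite -root_prod_XsubC -r_roots.
- by rewrite -separable_prod_XsubC -r_roots separable_Xn_sub_1 // pnatr_eq0 -lt0n.
- by rewrite -ltnS -(size_prod_XsubC r id) -r_roots size_XnsubC.
Qed.

Lemma Re_M (x y : C) : 'Re (x * y) = 'Re x * 'Re y - 'Im x * 'Im y.
Proof.
by rewrite {1}[x]Crect {1}[y]Crect mulC_rect Re_rect // ?rpredB ?rpredD ?rpredM
  ?Creal_Re ?Creal_Im.
Qed.

Lemma Re_max_exists (s : seq C) : s != [::] ->
  exists2 x, x \in s & forall y, y \in s -> 'Re y <= 'Re x.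
Proof.
elim: s => // x s IH _; have [->|/IH[y ys ymax]] := eqVneq s [::].
  by exists x; rewrite ?mem_head // => y; rewrite inE => /eqP ->.
have /orP[le|le] := real_leVge (Creal_Re x) (Creal_Re y).
  exists y; first by rewrite inE ys orbT.
  by move=> t; rewrite inE => /predU1P[->|/ymax].
exists x; first by rewrite mem_head.
move=> t; rewrite inE => /predU1P[->//|/ymax tm]; exact: le_trans tm le.
Qed.

Lemma unity_norm n (x : C) : (n > 0)%N -> x ^+ n = 1 -> `|x| = 1.
Proof.
move=> n0 xn; apply/eqP; rewrite -(@pexpr_eq1 _ _ n) ?normr_ge0 //.
by rewrite -normrX xn normr1.
Qed.

Lemma unit_circle (x : C) : `|x| = 1 -> 'Re x ^+ 2 + 'Im x ^+ 2 = 1.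
Proof. by move=> x1; rewrite -normC2_Re_Im x1 expr1n. Qed.

Lemma unit_Re_lt1 (x : C) : `|x| = 1 -> x != 1 -> 'Re x < 1.
Proof.
move=> x1 xn1; have le1 : `|'Re x| <= 1 by rewrite -x1 leif_normC_Re_Creal.
rewrite lt_neqAle (le_trans (real_ler_norm (Creal_Re x)) le1) andbT.
apply: contraNneq xn1 => Rx1; have := unit_circle x1.
rewrite Rx1 expr1n => /eqP; rewrite -subr_eq0 addrAC subrr add0r sqrf_eq0 => /eqP Ix0.
by rewrite [x]Crect Rx1 Ix0 mulr0 addr0.
Qed.

(* If [w] is closest to 1 in its coset of the group generated by [y], then comparing
   [w] with [w * y] and [w / y] gives 1 + c <= 2 a^2 for a = Re w, c = Re y. *)
Lemma rotation_closer (w y : C) : `|w| = 1 -> `|y| = 1 -> y != 1 -> w != 1 ->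
  'Re (w * y) <= 'Re w -> 'Re (w * y^* ) <= 'Re w -> 'Re y < 'Re w.
Proof.
move=> w1 y1 yn1 wn1; rewrite !Re_M Re_conj Im_conj.
have := unit_circle w1; have := unit_circle y1.
have := unit_Re_lt1 w1 wn1; have := unit_Re_lt1 y1 yn1.
have := Creal_Re w; have := Creal_Re y.
move: ('Re w) ('Im w) ('Re y) ('Im y) => a b c d Rc Ra c1 a1 cd ab h1 h2.
have t1 : 0 <= a * (1 - c) + b * d.
  have -> : a * (1 - c) + b * d = a - (a * c - b * d) by ring.
  by rewrite subr_ge0.
have t2 : 0 <= a * (1 - c) - b * d.
  have -> : a * (1 - c) - b * d = a - (a * c - b * - d) by ring.
  by rewrite subr_ge0.
have c1' : 0 < 1 - c by rewrite subr_gt0.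
have a0 : 0 <= a.
  have : 0 <= (a * (1 - c) + b * d) + (a * (1 - c) - b * d) by rewrite addr_ge0.
  have -> : (a * (1 - c) + b * d) + (a * (1 - c) - b * d) = 2 * (1 - c) * a by ring.
  by rewrite pmulr_rge0 // mulr_gt0.
have key : 0 <= (1 - c) * (a ^+ 2 *+ 2 - (1 + c)).
  have := mulr_ge0 t1 t2; suff -> : (a * (1 - c) + b * d) * (a * (1 - c) - b * d) =
    (1 - c) * (a ^+ 2 *+ 2 - (1 + c)) by [].
  have -> : (a * (1 - c) + b * d) * (a * (1 - c) - b * d) =
    a ^+ 2 * (1 - c) ^+ 2 - b ^+ 2 * d ^+ 2 by ring.
  have -> : b ^+ 2 = 1 - a ^+ 2 by rewrite -ab; ring.
  have -> : d ^+ 2 = 1 - c ^+ 2 by rewrite -cd; ring.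
  by ring.
rewrite pmulr_rge0 // subr_ge0 in key.
have [//|ac] := real_ltP Rc Ra.
have := le_trans key (_ : a ^+ 2 *+ 2 <= a *+ 2).
rewrite lerMn2r /= expr2 ler_piMr ?(ltW a1) // => /(_ isT).
move=> h; have : a *+ 2 < 1 + c by rewrite mulr2n ltr_leD.
by move=> /(le_lt_trans h); rewrite ltxx.
Qed.

(** The nontrivial root closest to 1 generates: in a coset of the powers of [y], a point closest to
    1 but different from 1 would be strictly closer to 1 than [y] by [rotation_closer]. Every coset
    thus contains 1. No exponential function is involved. *)
Lemma unity_root_generator n : (1 < n)%N -> exists y : C,
  [/\ n.-primitive_root y, y != 1 &
      forall w : C, w ^+ n = 1 -> w != 1 -> 'Re w <= 'Re y].
Proof.
move=> n1; have n0 := ltnW n1; have [z prz] := prim_root_exists n0.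
pose mu := [seq z ^+ val k | k : 'I_n].
have muP w : reflect (w ^+ n = 1) (w \in mu).
  apply: (iffP mapP) => [[k _ ->]|wn].
    by rewrite exprAC (prim_expr_order prz) expr1n.
  by have [k ->] := prim_rootP prz wn; exists k; rewrite ?mem_enum.
have zn1 : z != 1 by rewrite (eq_prim_root_expr prz 1 0) -?(expr1 z) eqn_mod_dvd // subn0 dvdn1 gtn_eqF.
have [|y] := @Re_max_exists [seq w <- mu | w != 1].
  apply: contraTneq (_ : z \in mu) => [m|]; last by apply/muP/prim_expr_order.
  by have := in_nil z; rewrite -m mem_filter zn1 /= => ->.
rewrite mem_filter => /andP[yn1 /muP yn] ymax.
exists y; split=> // [|w wn wn1]; last first.
  by apply: ymax; rewrite mem_filter wn1; apply/muP.
have y1 := unity_norm n0 yn.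
have y0 : y != 0 by rewrite -normr_gt0 y1.
have yV : y^* = y^-1 by rewrite invC_norm y1 expr1n invr1 mul1r.
have yV1 : y^-1 = y ^+ n.-1.
  by rewrite -[y^-1]mulr1 -yn -{1}(prednK n0) exprS mulKf.
have gen w : w \in mu -> exists k, w = y ^+ k.
  move=> wmu.
  have cosP k : w * y ^+ k \in [seq w * y ^+ val k | k : 'I_n].
    apply/mapP; exists (Ordinal (ltn_pmod k n0)); rewrite ?mem_enum //=.
    by rewrite expr_mod.
  have [|x0] := @Re_max_exists [seq w * y ^+ val k | k : 'I_n].
    by apply: contraTneq (cosP 0%N) => ->.
  case/mapP => j _ -> xmax; pose x := w * y ^+ val j.
  have xn : x ^+ n = 1.
    by rewrite exprMn exprAC yn expr1n mulr1; apply/muP.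
  have x1 := unity_norm n0 xn.
  have [xx|xn1] := eqVneq x 1.
    exists (n - j)%N; apply: (mulIf (expf_neq0 j y0)).
    by rewrite -exprD subnK ?yn // ltnW.
  have : 'Re y < 'Re x.
    apply: rotation_closer => //; apply: xmax.
      by rewrite /x -mulrA -exprSr.
    rewrite yV /x; case: (val j) => [|k].
      by rewrite mulr1 yV1.
    by rewrite exprSr mulrA mulfK.
  have le : 'Re x <= 'Re y by apply: ymax; rewrite mem_filter xn1; apply/muP.
  by move=> /lt_le_trans/(_ le); rewrite ltxx.
have [|k Dz] := gen z; first exact/muP/prim_expr_order.
have [m prm mn] := prim_order_exists n0 yn.
suff <- : m = n by [].
apply/eqP; rewrite eqn_dvd mn (prim_order_dvd prz).
by rewrite Dz exprAC (prim_expr_order prm) expr1n eqxx.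
Qed.

(** [n.-root] picks a root of largest real part, with nonnegative imaginary part. The root of -1
    therefore has the same real part as the generator [y] of the 2n-th roots, so it is [y] or its
    inverse, and its square has order n. *)
Lemma eps_prim l : (0 < l)%N -> l.-primitive_root (eps C l).
Proof.
case: l => // -[|l] _; first
  by rewrite /eps root1C sqrrN expr1n; apply/andP; split=> //;
     apply/forallP => i; rewrite ord1 unity_rootE expr1n !eqxx.
set n := l.+2; set N := (2 * n)%N.
have [|y [pry yn1 ymax]] := @unity_root_generator N; first by [].
have N0 : (0 < N)%N by [].
pose x := n.-root (-1 : C).
have xn : x ^+ n = -1 by rewrite rootCK.
have xN : x ^+ N = 1 by rewrite /N mulnC exprM xn sqrrN expr1n.
have xn1 : x != 1.
  by apply/eqP => x1; move/eqP: xn; rewrite x1 expr1n -subr_eq0 opprK (pnatr_eq0 _ 2).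
have yn : y ^+ n = -1.
  have : (y ^+ n) ^+ 2 == 1 by rewrite -exprM mulnC (prim_expr_order pry).
  rewrite sqrf_eq1 => /predU1P[/eqP|/eqP//].
  rewrite -(prim_order_dvd pry) => /(dvdn_leq (isT : (0 < n)%N)).
  by rewrite /N mul2n -addnn -[X in (_ <= X)%N]addn0 leq_add2l.
have le1 : 'Re y <= 'Re x.
  have [Iy|Iy] := real_leP (real0 _) (Creal_Im y); first exact: rootC_Re_max.
  rewrite -Re_conj; apply: rootC_Re_max => //.
    by rewrite -rmorphXn yn rmorphN rmorph1.
  by rewrite Im_conj oppr_ge0 ltW.
have eqRe : 'Re x = 'Re y by apply/eqP; rewrite eq_le le1 ymax.
have yN := prim_expr_order pry.
have [x1 y1] := (unity_norm N0 xN, unity_norm N0 yN).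
have yV : y^* = y^-1 by rewrite invC_norm y1 expr1n invr1 mul1r.
have prx : N.-primitive_root x.
  have /eqP := unit_circle x1; rewrite -(unit_circle y1) eqRe.
  rewrite (can_eq (addKr _)) eqf_sqr => /orP[]/eqP eI.
    by rewrite [x]Crect eqRe eI -Crect.
  rewrite [x]Crect eqRe eI mulrN -[_ - _]/(_ + - _).
  have -> : 'Re y - 'i * 'Im y = y ^+ N.-1.
    rewrite -[LHS]conjC_rect ?Creal_Re ?Creal_Im // -Crect yV.
    by rewrite -[y^-1]mulr1 -yN -{1}(prednK N0) exprS mulKf // -normr_gt0 y1.
  by rewrite prim_root_exp_coprime // coprimePn.
have := exp_prim_root prx 2; rewrite /eps -/x.
by rewrite /N (gcdn_idPl _) ?dvdn_mulr // mulKn.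
Qed.

End RootsOfUnity.

(** * Linear algebra *)

Section LinearAlgebra.
Variable C : numClosedFieldType.

Lemma trig_mul n (A B : 'M[C]_n) : is_trig_mx A -> is_trig_mx B ->
  is_trig_mx (A *m B) /\ forall i, (A *m B) i i = A i i * B i i.
Proof.
move=> /is_trig_mxP tA /is_trig_mxP tB; split=> [|i].
  apply/is_trig_mxP => i j ij; rewrite mxE big1 // => k _.
  have [ik|ki] := ltnP i k; first by rewrite tA ?mul0r.
  by rewrite (tB k) ?mulr0 // (leq_ltn_trans ki).
rewrite mxE (bigD1 i) //= big1 ?addr0 // => k /negPf ki.
have [ik|ik] := ltnP i k; first by rewrite tA ?mul0r.
by rewrite (tB k) ?mulr0 // ltn_neqAle ik val_eqE ki.
Qed.

Lemma trig_horner n (A : 'M[C]_n.+1) (q : {poly C}) : is_trig_mx A ->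
  is_trig_mx (horner_mx A q) /\ forall i, horner_mx A q i i = q.[A i i].
Proof.
move=> tA; elim/poly_ind: q => [|q c [tq dq]].
  by rewrite rmorph0; split=> [|i]; [exact: mx0_is_trig|rewrite mxE horner0].
rewrite rmorphD rmorphM /= horner_mx_X horner_mx_C.
have [tm dm] := trig_mul tq tA; split=> [|i].
  apply/is_trig_mxP => i j ij; rewrite mxE (is_trig_mxP tm) // mxE.
  by rewrite -val_eqE ltn_eqF // addr0.
by rewrite mxE [X in X + _]dm dq !hornerE mxE eqxx.
Qed.

Lemma coprimep_XsubC_exp (a b : C) i j : a != b ->
  coprimep (('X - a%:P) ^+ i) (('X - b%:P) ^+ j).
Proof.
by move=> ab; apply/coprimep_expl/coprimep_expr; rewrite coprimep_XsubC root_XsubC eq_sym.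
Qed.

Lemma coprimep_prod_XsubC_exp (a : C) (u : seq C) i j : a \notin u ->
  coprimep (('X - a%:P) ^+ i) (\prod_(b <- u) ('X - b%:P) ^+ j).
Proof.
move=> au; rewrite big_seq; apply: (big_ind (fun p => coprimep _ p)).
- exact: coprimep1.
- by move=> p q; rewrite coprimepMr => -> ->.
- by move=> b bu; apply: coprimep_XsubC_exp; apply: contraNneq au => ->.
Qed.

(** The Chinese remainder theorem, adding one root at a time by a Bezout relation. *)
Lemma crt_XsubC (u : seq C) (f : C -> C) N : uniq u ->
  exists q : {poly C}, forall a, a \in u -> ('X - a%:P) ^+ N %| q - (f a)%:P.
Proof.
elim: u => [|a u IH] /=; first by exists 0.
move=> /andP[au /IH[q0 q0P]].
have /Bezout_eq1_coprimepP[[v1 v2] /= eq1] := coprimep_prod_XsubC_exp N N au.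
set P := \prod_(_ <- _) _ in eq1; set Q := _ ^+ N in eq1.
exists (q0 + ((f a)%:P - q0) * (v2 * P)) => b; rewrite inE => /predU1P[->|bu].
  have -> : q0 + ((f a)%:P - q0) * (v2 * P) - (f a)%:P = (q0 - (f a)%:P) * v1 * Q.
    have -> : v2 * P = 1 - v1 * Q by rewrite -eq1 [_ + v2 * P]addrC addrK.
    by ring.
  exact: dvdp_mulIr.
rewrite -addrA [_ * _ - _]addrC addrA dvdp_addl ?q0P // !mulrA dvdp_mull //.
by rewrite /P (big_rem b) //= dvdp_mulIl.
Qed.

Lemma char_poly_dvd_prod n (A : 'M[C]_n.+1) : exists u : seq C,
  [/\ uniq u, char_poly A %| \prod_(a <- u) ('X - a%:P) ^+ n.+1
     & forall a, root (char_poly A) a -> a \in u].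
Proof.
have [r] := closed_field_poly_normal (char_poly A).
rewrite (monicP (char_poly_monic A)) scale1r => Dr.
have sz_r : size r = n.+1.
  by apply: succn_inj; rewrite -(size_prod_XsubC r id) -Dr size_char_poly.
exists (undup r); split=> [||a]; first exact: undup_uniq.
  rewrite Dr -prodr_undup_exp_count; elim: (undup r) => [|a u IH].
    by rewrite !big_nil.
  by rewrite !big_cons dvdp_mul // dvdp_exp2l // -sz_r count_size.
by rewrite Dr root_prod_XsubC mem_undup.
Qed.

Lemma gen_eig_span n (A : 'M[C]_n) (P : 'rV[C]_n -> Prop) :
  P 0 -> (forall x y, P x -> P y -> P (x + y)) ->
  (forall a k x, x *m (A - a%:M) ^+ k = 0 -> P x) -> forall x, P x.
Proof.
case: n => [|n] in A P * => P0 PD Pgen x; first by rewrite thinmx0.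
have [u [uu dvd _]] := char_poly_dvd_prod A.
pose p (i : 'I_(size u)) := ('X - (u`_i)%:P) ^+ n.+1.
have pC : {in xpredT &, forall i j, j != i -> coprimep (p i) (p j)}.
  by move=> i j _ _ ij; apply: coprimep_XsubC_exp; rewrite nth_uniq // eq_sym.
have : (x <= kermxpoly A (\prod_i p i))%MS.
  apply/sub_kermxP; rewrite (big_nth 0) big_mkord in dvd.
  have /dvdpP[w ->] := dvd.
  by rewrite rmorphM /= Cayley_Hamilton mulr0 mulmx0.
rewrite (kermxpoly_prod A pC) => /sub_sumsmxP[w ->].
apply: (big_ind P) => // i _.
apply: (Pgen (u`_i) n.+1).
have : (w i *m kermxpoly A (p i) <= kermxpoly A (p i))%MS by exact: submxMl.
by move/sub_kermxP; rewrite rmorphXn /= rmorphB /= horner_mx_X horner_mx_C.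
Qed.

(** [E] is a polynomial in [A], congruent to the constant [f a] modulo a high power of X - a for
    each eigenvalue [a]; the [d i] are the diagonal entries of a triangular form of [A]. Taking [f]
    to be complex conjugation turns the trace into a sum of squared moduli. *)
Lemma semisimple_part n (A : 'M[C]_n) (f : C -> C) : exists E : 'M[C]_n,
  (forall a k (x : 'rV_n), x *m (A - a%:M) ^+ k = 0 -> x *m E = f a *: x) /\
  exists d : 'I_n -> C, \tr (A *m E) = \sum_i d i * f (d i) /\
    ((forall i, d i = 0) -> A ^+ n = 0).
Proof.
case: n => [|n] in A *.
  exists 0; split=> [a k x _|]; first by rewrite [x]thinmx0 scaler0 mul0mx.
  exists (fun _ => 0); split=> [|_]; last exact: flatmx0.
  by rewrite mulmx0 mxtrace0 big1 // => i; rewrite mul0r.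
have [u [uu dvd ru]] := char_poly_dvd_prod A.
have [q qP] := @crt_XsubC u f n.+1 uu.
exists (horner_mx A q); split=> [a k x xk|].
  have eC p : x *m horner_mx A (p * ('X - a%:P) ^+ k) = 0.
    by rewrite mulrC rmorphM /= rmorphXn rmorphB /= horner_mx_X horner_mx_C mulmxA xk mul0mx.
  have eO p : char_poly A %| p -> x *m horner_mx A p = 0.
    by move=> /dvdpP[w ->]; rewrite rmorphM /= Cayley_Hamilton mulr0 mulmx0.
  have [au|au] := boolP (a \in u); last first.
    have /Bezout_eq1_coprimepP[[v1 v2] /= eq1] := coprimep_prod_XsubC_exp k n.+1 au.
    suff -> : x = 0 by rewrite mul0mx scaler0.
    have -> : x = x *m horner_mx A 1 by rewrite rmorph1 mulmx1.
    by rewrite -eq1 rmorphD /= mulmxDr eC add0r eO // dvdp_mull.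
  have /dvdpP[w qw] := qP _ au.
  (* The factors of the other eigenvalues are invertible on [x], so Cayley-Hamilton leaves (X -
     a)^(n+1) killing [x], however large [k] is. *)
  suff eN : x *m horner_mx A (w * ('X - a%:P) ^+ n.+1) = 0.
    move: eN; rewrite -qw rmorphB /= horner_mx_C mulmxBr mul_mx_scalar.
    by move/eqP; rewrite subr_eq0 => /eqP.
  pose Q := \prod_(b <- rem a u) ('X - b%:P) ^+ n.+1.
  have aQ : a \notin rem a u by rewrite mem_rem_uniqF.
  have /Bezout_eq1_coprimepP[[v1 v2] /= eq1] := coprimep_prod_XsubC_exp k n.+1 aQ.
  set R := ('X - a%:P) ^+ n.+1; have -> : w * R =
      (v1 * w * R) * ('X - a%:P) ^+ k + (w * v2) * (R * Q).
    by rewrite -[LHS]mul1r -eq1 -/Q; ring.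
  rewrite rmorphD /= mulmxDr eC add0r eO // dvdp_mull //.
  by rewrite (big_rem a) in dvd.
have [P Pu] := @Schur _ _ A (ltn0Sn n).
have {}Pu : P \in unitmx by exact: unitarymx_unit.
rewrite /similar_to conjumx // => tT; set T := P *m A *m invmx P in tT.
have [tq dq] := trig_horner q tT; have [_ dTq] := trig_mul tT tq.
have hT p : horner_mx T p = P *m horner_mx A p *m invmx P.
  by rewrite horner_mx_uconj.
have cT : char_poly T = \prod_(i < n.+1) ('X - (T i i)%:P) by exact: char_poly_trig.
have TcA : horner_mx T (char_poly A) = 0.
  by rewrite hT Cayley_Hamilton mulmx0 mul0mx.
exists (fun i => T i i); split=> [|T0].
  transitivity (\tr (T *m horner_mx T q)).
    by rewrite hT /T !mulmxA mulmxKV // [RHS]mxtrace_mulC !mulmxA mulVmx // mul1mx.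
  apply: eq_bigr => i _; rewrite dTq dq; congr (_ * _).
  have /qP/dvdpP[w /(congr1 (fun p => p.[T i i]))] : T i i \in u.
    apply: ru; rewrite /root; have [_ <-] := trig_horner (char_poly A) tT.
    by rewrite TcA mxE.
  rewrite !(hornerE, horner_exp) subrr expr0n mulr0 => /eqP.
  by rewrite subr_eq0 => /eqP.
have : horner_mx T (char_poly T) = 0 by exact: Cayley_Hamilton.
rewrite cT; under eq_bigr do rewrite T0 subr0.
rewrite prodr_const card_ord rmorphXn /= horner_mx_X => Tn.
have -> : A = horner_mx A 'X by rewrite horner_mx_X.
rewrite -rmorphXn /=; have := hT ('X ^+ n.+1).
rewrite rmorphXn /= horner_mx_X Tn => /(congr1 (fun M => invmx P *m M *m P)).
by rewrite mulmx0 mul0mx !mulmxA mulVmx // mul1mx mulmxKV.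


Qed.

End LinearAlgebra.

(** * Lie algebras over the complex numbers with a real structure *)

Notation "A ^cj" := (map_mx Num.conj A) (at level 2, format "A ^cj") : ring_scope.

Section Conjugation.
Variable C : numClosedFieldType.

Lemma mxD m n (A B : 'M[C]_(m, n)) i j : (A + B) i j = A i j + B i j.
Proof. by rewrite mxE. Qed.
Lemma mxZ m n a (A : 'M[C]_(m, n)) i j : (a *: A) i j = a * A i j.
Proof. by rewrite mxE. Qed.
Lemma mxN m n (A : 'M[C]_(m, n)) i j : (- A) i j = - A i j.
Proof. by rewrite mxE. Qed.
Lemma mx0E m n i j : (0 : 'M[C]_(m, n)) i j = 0.
Proof. by rewrite mxE. Qed.

Lemma cjK m n : involutive (fun A : 'M[C]_(m, n) => A^cj).
Proof. by move=> A; apply/matrixP => i j; rewrite !mxE conjCK. Qed.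

Lemma cjZ m n a (A : 'M[C]_(m, n)) : (a *: A)^cj = a^* *: A^cj.
Proof. by apply/matrixP => i j; rewrite !mxE rmorphM. Qed.

Lemma inFvE (n : nat) (x : 'rV[C]_n) : inFv true x <-> x^cj = x.
Proof.
split=> [h|h i].
  by apply/rowP => i; rewrite !mxE; apply/CrealP; apply: h.
by apply/CrealP; rewrite -[in RHS]h mxE.
Qed.

Lemma row_rect n (x : 'rV[C]_n) : exists y z : 'rV[C]_n,
  [/\ inFv true y, inFv true z & x = y + 'i *: z].
Proof.
exists (map_mx (fun t => 'Re t) x), (map_mx (fun t => 'Im t) x); split.
- by move=> i; rewrite mxE /=; apply: Creal_Re.
- by move=> i; rewrite mxE /=; apply: Creal_Im.
by apply/rowP => i; rewrite !mxE -Crect.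
Qed.

End Conjugation.

(* The ring tactic does not apply to modules: check linear identities entrywise. *)
Ltac mxring := apply/matrixP => ? ?; rewrite !(mxD, mxZ, mxN, mx0E); ring.

Section LieAlgebra.
Variables (C : numClosedFieldType) (isR : bool) (g : lie_data C).
Local Notation n := (ldim g).
Local Notation V := ('rV[C]_n).
Implicit Types x y z : V.

Lemma gbrE x y : gbr x y = y *m adm x.
Proof.
apply/rowP => k; rewrite !mxE exchange_big; apply: eq_bigr => j _.
rewrite !mxE big_distrr /=; apply: eq_bigr => i _.
rewrite (bigD1 j) //= !mxE !eqxx mulr1 big1 => [|j' /negPf j'j]; first by rewrite addr0; ring.
by rewrite !mxE j'j andbF mulr0 mul0r.
Qed.

Lemma adm_is_linear : linear (@adm C g).
Proof.
move=> a x y; apply/matrixP => j k; rewrite !mxE big_distrr -big_split /=.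
apply: eq_bigr => i _; rewrite big_distrr -big_split /=; apply: eq_bigr => j' _.
by rewrite !mxE; ring.
Qed.
HB.instance Definition _ := GRing.isLinear.Build C V 'M[C]_n _ (@adm C g) adm_is_linear.

Lemma gbrDl x y z : gbr (x + y) z = gbr x z + gbr y z.
Proof. by rewrite !gbrE linearD mulmxDr. Qed.
Lemma gbrDr x y z : gbr x (y + z) = gbr x y + gbr x z.
Proof. by rewrite !gbrE mulmxDl. Qed.
Lemma gbrZl a x y : gbr (a *: x) y = a *: gbr x y.
Proof. by rewrite !gbrE linearZ -scalemxAr. Qed.
Lemma gbrZr a x y : gbr x (a *: y) = a *: gbr x y.
Proof. by rewrite !gbrE -scalemxAl. Qed.
Lemma gbr0l x : gbr 0 x = 0. Proof. by rewrite gbrE linear0 mulmx0. Qed.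
Lemma gbr0r x : gbr x 0 = 0. Proof. by rewrite gbrE mul0mx. Qed.
Lemma gbrNl x y : gbr (- x) y = - gbr x y.
Proof. by rewrite -scaleN1r gbrZl scaleN1r. Qed.
Lemma gbrNr x y : gbr x (- y) = - gbr x y.
Proof. by rewrite -scaleN1r gbrZr scaleN1r. Qed.

(** Rows with coordinates in F span all complex rows: through real and imaginary parts when F is
    real, trivially otherwise. *)
Lemma complex_ext (P : V -> Prop) :
  (forall a x y, P x -> P y -> P (a *: x + y)) ->
  (forall x, inFv isR x -> P x) -> forall x, P x.
Proof.
move=> PL PF x; case: isR PF => PF; last by apply: PF => i.
have [y [z [Ry Rz ->]]] := row_rect x.
by rewrite addrC; apply: PL; apply: PF.
Qed.

(** What [is_simple] says about complex rows. For real F only the conjugation-stable ideals are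
    known to be trivial, because the complexification itself need not be simple. *)
Record tau_simple : Prop := TauSimple {
  ts_skew : forall x y, gbr x y = - gbr y x;
  ts_jac : forall x y z, gbr x (gbr y z) = gbr (gbr x y) z + gbr y (gbr x z);
  ts_cj : isR -> forall x y, (gbr x y)^cj = gbr x^cj y^cj;
  ts_simple : forall I : V -> Prop,
    (forall a x y, I x -> I y -> I (a *: x + y)) ->
    (forall x y, I y -> I (gbr x y)) -> (isR -> forall x, I x -> I x^cj) ->
    (exists2 x, I x & x != 0) -> forall x, I x;
  ts_nab : exists x y, gbr x y != 0 }.

Lemma tau_simpleP : is_simple isR g -> tau_simple.
Proof.
move=> [[lF [alt jac]] [[x0 [y0 [_ _ nab]]] simp]].
have FD x y : inFv isR x -> inFv isR y -> inFv isR (x + y).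
  move=> Fx Fy i; rewrite mxE /inF; move: (Fx i) (Fy i); rewrite /inF; case: isR => //=.
  exact: rpredD.
have skewF x y : inFv isR x -> inFv isR y -> gbr x y = - gbr y x.
  move=> Fx Fy; apply/eqP; rewrite -subr_eq0 opprK; apply/eqP.
  by rewrite -(alt _ (FD _ _ Fx Fy)) gbrDl !gbrDr !alt // add0r addr0.
have skew x y : gbr x y = - gbr y x.
  elim/complex_ext: x y => [a x x' hx hx' y|x Fx].
    by rewrite gbrDl gbrDr gbrZl gbrZr hx hx' opprD scalerN.
  elim/complex_ext => [a y y' hy hy'|y Fy]; last exact: skewF.
  by rewrite gbrDl gbrDr gbrZl gbrZr hy hy' opprD scalerN.
have jacob x y z : gbr x (gbr y z) + gbr y (gbr z x) + gbr z (gbr x y) = 0.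
  pose J x y z := gbr x (gbr y z) + gbr y (gbr z x) + gbr z (gbr x y).
  pose gl := (gbrDl, gbrDr, gbrZl, gbrZr); rewrite -/(J x y z).
  elim/complex_ext: x y z => [a x x' hx hx' y z|x Fx].
    suff -> : J (a *: x + x') y z = a *: J x y z + J x' y z by rewrite hx hx' scaler0 addr0.
    by rewrite /J !gl; mxring.
  elim/complex_ext => [a y y' hy hy' z|y Fy].
    suff -> : J x (a *: y + y') z = a *: J x y z + J x y' z by rewrite hy hy' scaler0 addr0.
    by rewrite /J !gl; mxring.
  elim/complex_ext => [a z z' hz hz'|z Fz]; last exact: jac.
  suff -> : J x y (a *: z + z') = a *: J x y z + J x y z' by rewrite hz hz' scaler0 addr0.
  by rewrite /J !gl; mxring.
split=> //.
- move=> x y z; have /eqP := jacob x y z.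
  by rewrite [gbr z x]skew [gbr z _]skew gbrNr -addrA addr_eq0 opprD !opprK addrC => /eqP.
- move=> R x y; rewrite !gbrE map_mxM; congr (_ *m _).
  apply/matrixP => i j; rewrite !mxE rmorph_sum; apply: eq_bigr => k _ /=.
  rewrite rmorph_sum; apply: eq_bigr => k' _; rewrite !mxE !rmorphM rmorph_nat.
  congr (_ * _); apply/CrealP; move: (lF k k' j); by rewrite /inF R.
- move=> I IL Ibr Icj [x Ix xn0].
  case: (simp (fun x => inFv isR x /\ I x)).
  + split; first by move=> y [].
    split.
      split; first by move=> i; rewrite mxE /inF rpred0 implybT.
      by have := IL (-1) x x Ix Ix; rewrite scaleN1r addNr.
    split=> [a y z Fa [Fy Iy] [Fz Iz]|y z Fy [Fz Iz]].
      split; last exact: IL.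
      move=> i; move: Fa (Fy i) (Fz i); rewrite !mxE /inF; case: isR => //=.
      by move=> *; rewrite rpredD ?rpredM.
    split; last exact: Ibr.
    move=> i; rewrite mxE /inF; case: isR lF Fy Fz => //= lF Fy Fz.
    apply: rpred_sum => j _; apply: rpred_sum => k _.
    by apply: rpredM; [apply: rpredM; [apply: Fy|apply: Fz]|apply: lF].
  + move=> I0; case/eqP: xn0; case: isR I0 Icj => I0 Icj; last by apply: I0; split=> // i.
    have Rz z : I z -> z^cj = z -> z = 0 by move=> Iz /inFvE Fz; apply: I0.
    have IZ a z : I z -> I (a *: z).
      move=> Iz; rewrite -[_ *: _]addr0; apply: (IL) => //.
      by have := IL (-1) x x Ix Ix; rewrite scaleN1r addNr.
    have Ixc := Icj isT x Ix.
    (* If [I] had no nonzero real point, then x + conj x and i(x - conj x), both real and in [I],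
       would vanish, and so would [x]. *)
    have e1 : x + x^cj = 0.
      apply: (Rz); first by have := IL 1 x _ Ix Ixc; rewrite scale1r.
      by rewrite map_mxD cjK addrC.
    have e2 : 'i *: (x - x^cj) = 0.
      apply: Rz; first by apply: IZ; rewrite addrC -scaleN1r; apply: (IL).
      by rewrite cjZ conjCi map_mxB cjK scaleNr -scalerN opprB.
    move/eqP: e2; rewrite scaler_eq0 (negPf (neq0Ci _)) /= subr_eq0 => /eqP e2.
    move/eqP: e1; rewrite -e2 -mulr2n -scaler_nat scaler_eq0 pnatr_eq0 /=.
    by move/eqP.
  + by move=> h; apply: (complex_ext IL) => y /h[].
- by exists x0, y0; apply/eqP.
Qed.

End LieAlgebra.

(** * Killing form and derivations *)

Section TauSimple.
Variables (C : numClosedFieldType) (isR : bool) (g : lie_data C).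
Hypothesis gS : tau_simple isR g.
Local Notation n := (ldim g).
Local Notation V := ('rV[C]_n).
Implicit Types x y z : V.
Let skew := ts_skew gS.
Let jac := ts_jac gS.

(** Perfectness as an induction principle. The additive span of the brackets is encoded as the
    intersection of all additive sets containing them; it is a conjugation-stable ideal, nonzero
    since the algebra is not abelian. *)
Lemma bracket_span (P : V -> Prop) :
  P 0 -> (forall x y, P x -> P y -> P (x + y)) -> (forall x y, P (gbr x y)) ->
  forall x, P x.
Proof.
move=> P0 PD Pbr x.
pose I x := forall Q : V -> Prop, Q 0 -> (forall x y, Q x -> Q y -> Q (x + y)) ->
  (forall x y, Q (gbr x y)) -> Q x.
suff : I x by apply.
apply: (ts_simple gS (I := I)) => {x P P0 PD Pbr}.
- move=> a x y Ix Iy Q Q0 QD Qbr; apply: (QD); last exact: Iy.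
  apply: (Ix (fun x => Q (a *: x))) => [|u v Qu Qv|u v]; first by rewrite scaler0.
    by rewrite scalerDr; apply: QD.
  by rewrite -gbrZl.
- by move=> x y _ Q _ _.
- move=> R x Ix Q Q0 QD Qbr; apply: (Ix (fun x => Q x^cj)) => [|u v Qu Qv|u v].
  + by rewrite map_mx0.
  + by rewrite map_mxD; apply: QD.
  + by rewrite (ts_cj gS).
- by have [x [y xy]] := ts_nab gS; exists (gbr x y) => // Q _ _.
Qed.

Lemma centerless x : (forall y, gbr x y = 0) -> x = 0.
Proof.
move=> cx; apply/eqP/contraT => xn0.
have [u [v]] := ts_nab gS; suff -> : gbr u v = 0 by rewrite eqxx.
suff h w : forall y, gbr w y = 0 by apply: h.
apply: (ts_simple gS (I := fun w => forall y, gbr w y = 0)) w => [a p q hp hq y|p q hq y|R p hp y|].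
- by rewrite gbrDl gbrZl hp hq scaler0 addr0.
- by rewrite [gbr p q]skew hq oppr0 gbr0l.
- by rewrite -[y]cjK -(ts_cj gS) // hp map_mx0.
- by exists x.
Qed.

Lemma adm_gbr x y : adm (gbr x y) = adm y *m adm x - adm x *m adm y.
Proof.
apply/row_matrixP => i; rewrite !rowE mulmxBr !mulmxA -!gbrE jac.
by rewrite addrK.
Qed.

Lemma kilC x y : kil x y = kil y x.
Proof. exact: mxtrace_mulC. Qed.

Lemma kil_gbr x y z : kil (gbr x y) z = kil x (gbr y z).
Proof.
rewrite /kil !adm_gbr mulmxBr mulmxBl !raddfB /= !mulmxA; congr (_ - _).
by rewrite mxtrace_mulC mulmxA.
Qed.

Definition is_der (E : 'M[C]_n) :=
  forall x y, gbr x y *m E = gbr (x *m E) y + gbr x (y *m E).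

Lemma adm_der E x : is_der E -> adm (x *m E) = adm x *m E - E *m adm x.
Proof.
move=> dE; apply/row_matrixP => i; rewrite !rowE mulmxBr !mulmxA -!gbrE dE.
by rewrite addrK.
Qed.

(** For a derivation, ad (x E) is a commutator of ad x and [E], so cyclicity of the trace moves [E]
    onto [x]. This serves both Cartan's criterion and the innerness of derivations. *)
Lemma der_trace E x y : is_der E -> \tr (adm (gbr x y) *m E) = kil (x *m E) y.
Proof.
move=> dE; rewrite /kil adm_der // adm_gbr mulmxBr mulmxBl !raddfB /= !mulmxA; congr (_ - _).
by rewrite -[in LHS]mulmxA [LHS]mxtrace_mulC.
Qed.

(* Jacobson's form of Engel's argument: among the subalgebras whose long words act as
   zero, a proper one [D] is always extended by a [y] normalizing it. *)
Definition nil_words (D : 'M[C]_n) (k : nat) (v : V) :=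
  forall xs : seq V, size xs = k -> all (fun x => x <= D)%MS xs ->
    v *m \prod_(x <- xs) adm x = 0.

Definition subalg (D : 'M[C]_n) :=
  forall x y, (x <= D)%MS -> (y <= D)%MS -> (gbr x y <= D)%MS.

Lemma nil_words_S D k v : nil_words D k.+1 v <->
  forall d, (d <= D)%MS -> nil_words D k (v *m adm d).
Proof.
split=> [h d dD xs sxs xsD|h [//|d xs] [sxs] /= /andP[dD xsD]].
  have := h (d :: xs); rewrite /= sxs dD xsD big_cons => /(_ erefl isT).
  by rewrite mulmxA.
by rewrite big_cons mulmxA; apply: h.
Qed.

Lemma nil_words_L D k a u v : nil_words D k u -> nil_words D k v ->
  nil_words D k (a *: u + v).
Proof.
by move=> hu hv xs sx xD; rewrite mulmxDl -scalemxAl hu // hv // scaler0 addr0.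
Qed.

Lemma nil_words_0 D k : nil_words D k 0.
Proof. by move=> xs _ _; rewrite mul0mx. Qed.

Lemma nil_words_le D k v : nil_words D k v -> nil_words D k.+1 v.
Proof.
elim: k v => [v h|k IH v /nil_words_S h]; apply/nil_words_S => d dD.
  have := h [::] erefl isT; rewrite big_nil mulmx1 => ->; rewrite mul0mx.
  exact: nil_words_0.
exact/IH/h.
Qed.

Lemma nil_words_norm D y k v : (forall d, d <= D -> gbr d y <= D)%MS ->
  nil_words D k v -> nil_words D k (v *m adm y).
Proof.
move=> nD; elim: k v => [v h|k IH v /nil_words_S h].
  have := h [::] erefl isT; rewrite big_nil mulmx1 => ->; rewrite mul0mx.
  exact: nil_words_0.
apply/nil_words_S => d dD.
have -> : v *m adm y *m adm d = v *m adm d *m adm y + v *m adm (gbr d y).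
  by rewrite adm_gbr mulmxBr !mulmxA addrC subrK.
rewrite addrC -[v *m adm (gbr _ _)]scale1r; apply: nil_words_L; first exact/h/nD.
exact/IH/h.
Qed.

(** Moving letters of [D] past [y] produces only letters of [D]. Hence, modulo vectors killed by
    [D]-words one letter shorter, a word in D + y acts as a multiple of a power of [y]. That power
    vanishes after [r] letters, so each block of [r] letters lowers [k] by one. *)
Lemma nil_words_extend D y r :
  (forall d, d <= D -> gbr d y <= D)%MS -> subalg D -> adm y ^+ r = 0 ->
  forall k v, nil_words D k v -> nil_words (D + y)%MS (k * r) v.
Proof.
move=> nD sD yr; elim=> [|k IH] v hv.
  move=> xs; rewrite mul0n => /size0nil -> _; rewrite big_nil mulmx1.
  by have := hv [::] erefl isT; rewrite big_nil mulmx1.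
have word xs u : nil_words D k.+1 u -> all (fun x => x <= D + y)%MS xs ->
    exists2 c, nil_words D k.+1 (u *m \prod_(x <- xs) adm x) &
      nil_words D k (u *m \prod_(x <- xs) adm x - c *: (u *m adm y ^+ size xs)).
  elim/last_ind: xs => [|xs x IHx] hu /=.
    exists 1; first by rewrite big_nil mulmx1.
    by rewrite big_nil expr0 mulmx1 scale1r subrr; apply: nil_words_0.
  rewrite all_rcons => /andP[/sub_addsmxP[[u1 u2] /= Dx] /IHx -/(_ hu)[c h1 h2]].
  have d1 : (u1 *m D <= D)%MS by exact: submxMl.
  have [a Da] : exists a, u2 *m y = a *: y.
    by exists (u2 0 0); rewrite {1}[u2]mx11_scalar mul_scalar_mx.
  set d := u1 *m D in d1 Dx; rewrite {}Da in Dx.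
  set w := u *m _ in h1 h2.
  have eqw : u *m \prod_(i <- rcons xs x) adm i = w *m adm d + a *: (w *m adm y).
    by rewrite big_rcons /= mulmxA -/w Dx linearD linearZ /= mulmxDr -scalemxAr.
  have hd : nil_words D k (w *m adm d) by move/nil_words_S: h1; apply.
  exists (a * c).
    rewrite eqw addrC; apply: nil_words_L; first exact: nil_words_norm.
    exact: nil_words_le.
  have -> : u *m \prod_(i <- rcons xs x) adm i - (a * c) *: (u *m adm y ^+ size (rcons xs x)) =
    a *: ((w - c *: (u *m adm y ^+ size xs)) *m adm y) + w *m adm d.
    rewrite eqw size_rcons exprSr mulmxA mulmxBl scalerBr -scalemxAl scalerA.
    by rewrite -addrA addrC.
  by apply: nil_words_L => //; apply: nil_words_norm.
move=> xs; rewrite mulSn => sxs xD.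
have /andP[x1 x2] : all (fun x => x <= D + y)%MS (take r xs) &&
  all (fun x => x <= D + y)%MS (drop r xs) by rewrite -all_cat cat_take_drop.
rewrite -(cat_take_drop r xs) big_cat mulmxA; apply: IH => //.
  have [c _] := word (take r xs) v hv x1.
  by rewrite size_takel ?sxs ?leq_addr // yr mulmx0 scaler0 subr0.
by rewrite size_drop sxs addKn.
Qed.

(** If all ad x were nilpotent, [D] could be enlarged until it is the whole algebra; then all long
    words of inner derivations vanish, which perfectness forbids. *)
Lemma engel : (forall x, exists r, adm x ^+ r = 0) -> False.
Proof.
move=> nil.
have ext k : exists D N, [/\ subalg D, forall v, nil_words D N v &
    (k <= \rank D)%N \/ (1%:M <= D)%MS].
  elim: k => [|k [D [N [sD nD [kD|]]]]]; last by exists D, N; split=> //; right.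
    exists 0, 1%N; split; last by left.
    - by move=> x y /submx0null -> _; rewrite gbr0l sub0mx.
    - move=> v [|x [|//]] //= _; rewrite andbT big_seq1 => /submx0null ->.
      by rewrite linear0 mulmx0.
  have [D1|nD1] := boolP (1%:M <= D)%MS; first by exists D, N; split=> //; right.
  have [y0 y0D] : exists y0 : V, ~~ (y0 <= D)%MS.
    by have /row_subPn[i] := nD1; exists (row i 1%:M).
  have [y [yD yN]] : exists y : V, ~~ (y <= D)%MS /\ forall d, (d <= D)%MS -> (gbr d y <= D)%MS.
    (* Without such a [y], an element outside [D] could be bracketed with elements of [D] for [N]
       steps and stay outside [D], whereas words of length [N] give 0. *)
    apply: contrapT => no.
    have step (y : V) : ~~ (y <= D)%MS -> exists2 d, (d <= D)%MS & ~~ (gbr d y <= D)%MS.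
      move=> yD; apply: contrapT => no'; apply: no; exists y; split=> // d dD.
      by apply/negPn/negP => h; apply: no'; exists d.
    have [xs [sx xD]] : exists xs, [/\ size xs = N, all (fun x => x <= D)%MS xs &
        ~~ (y0 *m \prod_(x <- xs) adm x <= D)%MS].
      elim: (N) => [|M [xs [sx xD h]]].
        by exists [::]; rewrite big_nil mulmx1.
      have [d dD hd] := step _ h; exists (rcons xs d).
      by rewrite size_rcons sx all_rcons dD xD big_rcons /= mulmxA -gbrE.
    by rewrite nD // sub0mx.
  have [r yr] := nil y.
  exists (D + y)%MS, (N * r)%N; split.
  - move=> u v /sub_addsmxP[[u1 u2] /= ->] /sub_addsmxP[[v1 v2] /= ->].
    rewrite [u2]mx11_scalar [v2]mx11_scalar !mul_scalar_mx gbrDl !gbrDr !gbrZl !gbrZr.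
    have -> : gbr y y = 0.
      have /eqP := skew y y; rewrite -addr_eq0 -mulr2n -scaler_nat scaler_eq0 pnatr_eq0 /=.
      by move/eqP.
    rewrite !scaler0 addr0; apply: (submx_trans _ (addsmxSl _ _)).
    rewrite [gbr y _]skew -scaleN1r; apply: addmx_sub; first apply: addmx_sub.
    + by apply: sD; apply: submxMl.
    + by apply/scalemx_sub/yN/submxMl.
    + by do 2!apply: scalemx_sub; apply/yN/submxMl.
  - by move=> v; apply: nil_words_extend.
  - left; apply: leq_ltn_trans kD _; rewrite ltn_neqAle mxrankS ?addsmxSl // andbT.
    apply: contraNneq yD => rk; have : (D + y <= D)%MS.
      by rewrite -(geq_leqif (mxrank_leqif_sup (addsmxSl _ _))) rk.
    exact/submx_trans/addsmxSr.
have [D [N [_ nD DT]]] := ext n.+1.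
have {DT}D1 : (1%:M <= D)%MS by case: DT => // /leq_trans/(_ (rank_leq_row _)); rewrite ltnn.
have xD x : (x <= D)%MS by rewrite (submx_trans (submx1 _) D1).
(* Perfectness strips letters: if every [adm d *m B] is 0, then [B] kills all brackets, so B = 0.
   Taking the identity for [B] gives the contradiction. *)
have van k : forall B : 'M[C]_n, (forall v, nil_words D N v) -> (forall v xs, size xs = k ->
    v *m \prod_(x <- xs) adm x *m B = 0 :> V) -> B = 0.
  elim: k => [B _ h|k IH B hN h].
    apply/row_matrixP => i; rewrite rowE row0.
    by have := h (delta_mx 0 i) [::] erefl; rewrite big_nil mulmx1.
  have hB d : adm d *m B = 0.
    apply: IH => // v xs sx; have := h v (rcons xs d).
    by rewrite size_rcons sx big_rcons /= !mulmxA; apply.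
  apply/row_matrixP => i; rewrite rowE row0; move: (delta_mx 0 i).
  apply: bracket_span => [|x y hx hy|x y]; first by rewrite mul0mx.
    by rewrite mulmxDl hx hy addr0.
  by rewrite gbrE -mulmxA hB mulmx0.
have one0 : 1%:M = 0 :> 'M[C]_n.
  apply: (van N) => // v xs sx; rewrite mulmx1; apply: nD => //.
  by apply/allP => x _; apply: xD.
have [x [y]] := ts_nab gS; rewrite -[gbr x y]mulmx1 one0 mulmx0 eqxx //.
Qed.

Lemma gen_eig_gbr x a b k j u v :
  u *m (adm x - a%:M) ^+ k = 0 -> v *m (adm x - b%:M) ^+ j = 0 ->
  gbr u v *m (adm x - (a + b)%:M) ^+ (k + j) = 0.
Proof.
set A := adm x.
have AM c (w : V) : w *m (A - c%:M) = gbr x w - c *: w.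
  by rewrite mulmxBr mul_mx_scalar -gbrE.
have eA p q : gbr p q *m (A - (a + b)%:M) = gbr (p *m (A - a%:M)) q + gbr p (q *m (A - b%:M)).
  rewrite !AM jac !(gbrDl, gbrDr, gbrNl, gbrNr, gbrZl, gbrZr).
  by mxring.
elim: {k j}(k + j)%N {-2}k {-2}j (erefl (k + j)%N) u v => [|m IH] k j.
  case: k => // k0; rewrite add0n in k0; rewrite k0 expr0 => u v; rewrite !mulmx1 => -> ->.
  by rewrite gbr0l.
case: k => [|k] km u v.
  by rewrite expr0 mulmx1 => -> _; rewrite gbr0l mul0mx.
case: j => [|j] in km *.
  by move=> _; rewrite expr0 mulmx1 => ->; rewrite gbr0r mul0mx.
move=> hu hv; rewrite addnS exprS mulmxA eA mulmxDl.
have e1 : (k + j.+1 = m)%N by case: km.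
have e2 : (k.+1 + j = m)%N by rewrite addSnnS.
have h1 : u *m (A - a%:M) *m (A - a%:M) ^+ k = 0 by rewrite -mulmxA -[RHS]hu exprS.
have h2 : v *m (A - b%:M) *m (A - b%:M) ^+ j = 0 by rewrite -mulmxA -[RHS]hv exprS.
rewrite (IH k.+1 j e2 _ _ hu h2) addr0.
by have := IH k j.+1 e1 _ _ h1 hv; rewrite -addSnnS.
Qed.

(** Cartan's criterion. [E] acts on the generalized eigenspace of ad x for [a] by the conjugate of
    [a]. Conjugation is additive and brackets add eigenvalues, so [E] is a derivation; [der_trace]
    and perfectness give tr (ad x E) = 0. That trace is a sum of squared moduli of the eigenvalues,
    which therefore all vanish. *)
Lemma kil_eq0_nilpotent : (forall x y, kil x y = 0 :> C) ->
  forall x, exists r, adm x ^+ r = 0.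
Proof.
move=> K0 x; have [E [genE [d [trE dE]]]] := semisimple_part (adm x) Num.conj.
exists n; apply: dE => i.
have dE : is_der E.
  move=> u; elim/(gen_eig_span (A := adm x)): u => [y|u u' hu hu' y|a k u hu].
  - by rewrite !(gbr0l, mul0mx) addr0.
  - by rewrite !(gbrDl, mulmxDl) hu hu' addrACA.
  elim/(gen_eig_span (A := adm x)) => [|v v' hv hv'|b j v hv].
  - by rewrite !(gbr0r, mul0mx) addr0.
  - by rewrite !(gbrDr, mulmxDl) hv hv' addrACA.
  rewrite (genE _ _ _ hu) (genE _ _ _ hv) (genE _ _ _ (gen_eig_gbr hu hv)).
  by rewrite gbrZl gbrZr -scalerDl rmorphD.
have tr0 y : \tr (adm y *m E) = 0.
  elim/bracket_span: y => [|y z hx hy|y z].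
  - by rewrite linear0 mul0mx mxtrace0.
  - by rewrite linearD mulmxDl mxtraceD hx hy addr0.
  - by rewrite der_trace.
move: trE; rewrite tr0 => /esym/eqP; rewrite psumr_eq0 => [|j _]; last exact: mul_conjC_ge0.
by move=> /allP/(_ i (mem_index_enum _)); rewrite mul_conjC_eq0 => /eqP.
Qed.

Lemma adm_cj x : isR -> adm x^cj = (adm x)^cj.
Proof.
move=> R; apply/row_matrixP => i; rewrite !rowE -gbrE.
have -> : (delta_mx 0 i : V) *m (adm x)^cj = ((delta_mx 0 i : V) *m adm x)^cj.
  rewrite map_mxM; congr (_ *m _).
  by apply/matrixP => p q; rewrite !mxE rmorph_nat.
by rewrite -gbrE (ts_cj gS R) map_delta_mx.
Qed.

Lemma kil_cj x y : isR -> kil x^cj y^cj = (kil x y)^*.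
Proof.
by move=> R; rewrite /kil !adm_cj // -map_mxM trace_map_mx.
Qed.

Lemma kilDl x y z : kil (x + y) z = kil x z + kil y z.
Proof. by rewrite /kil linearD mulmxDr mxtraceD. Qed.
Lemma kilZl a x z : kil (a *: x) z = a * kil x z.
Proof. by rewrite /kil linearZ -scalemxAr mxtraceZ. Qed.
Lemma kilDr x y z : kil x (y + z) = kil x y + kil x z.
Proof. by rewrite kilC kilDl !(kilC x). Qed.
Lemma kilZr a x z : kil x (a *: z) = a * kil x z.
Proof. by rewrite kilC kilZl (kilC x). Qed.
Lemma kil0l z : kil 0 z = 0 :> C.
Proof. by rewrite -(scale0r (0 : V)) kilZl mul0r. Qed.

(** The radical is a conjugation-stable ideal. If nonzero, it is everything, all ad x are nilpotent,
    and [engel] applies. *)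
Lemma kil_nondeg x : (forall y, kil x y = 0) -> x = 0.
Proof.
move=> cx; apply/eqP/contraT => xn0; case: engel; apply: kil_eq0_nilpotent.
apply: (ts_simple gS (I := fun w => forall y, kil w y = 0)) => [a p q hp hq y|p q hq y|R p hp y|].
- by rewrite kilDl kilZl hp hq mulr0 addr0.
- by rewrite skew -scaleN1r kilZl kil_gbr hq mulr0.
- by rewrite -[y]cjK kil_cj // hp rmorph0.
- by exists x.
Qed.

Lemma kil_repr (f : V -> C) : (forall a x y, f (a *: x + y) = a * f x + f y) ->
  exists w, forall x, f x = kil w x.
Proof.
move=> fL; pose G : 'M[C]_n := \matrix_(i, j) kil (delta_mx 0 i) (delta_mx 0 j).
have f0 : f 0 = 0 by have := fL (-1) 0 0; rewrite scaleN1r addNr mulN1r addNr.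
have fS (h : V -> C) : h 0 = 0 -> (forall a x y, h (a *: x + y) = a * h x + h y) ->
    forall x, h x = \sum_j x 0 j * h (delta_mx 0 j).
  move=> h0 hL x; rewrite {1}[x]row_sum_delta.
  elim/big_rec2: _ => // j y1 y2 _ <-; rewrite -hL //.
have kG w j : (w *m G) 0 j = kil w (delta_mx 0 j).
  rewrite (fS (fun w => kil w _)) ?kil0l // => [|a x y]; last by rewrite kilDl kilZl.
  by rewrite mxE; apply: eq_bigr => i _; rewrite mxE.
have Gu : G \in unitmx.
  rewrite -row_free_unit -kermx_eq0; apply/eqP/row_matrixP => i; rewrite row0.
  apply: kil_nondeg => y.
  rewrite (fS (fun y => kil _ y)) => [||a u v]; rewrite ?kilDr ?kilZr //; last by rewrite kilC kil0l.
  by rewrite big1 // => j _; rewrite -kG -row_mul mulmx_ker row0 mxE mulr0.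
exists ((\row_j f (delta_mx 0 j)) *m invmx G) => x.
rewrite (fS f) // (fS (fun y => kil _ y)) => [||a u v]; rewrite ?kilDr ?kilZr //; last by rewrite kilC kil0l.
by apply: eq_bigr => j _; rewrite -kG mulmxKV // mxE.
Qed.

(** Let [w] represent the functional tr (ad x E). Then E - ad w is a derivation with trace 0 against
    every ad x, so [der_trace] places its values in the radical of the Killing form. *)
Lemma der_inner E : is_der E -> exists w, forall x, x *m E = gbr w x.
Proof.
move=> dE; have [|w hw] := @kil_repr (fun x => \tr (adm x *m E)).
  by move=> a x y; rewrite linearP mulmxDl -scalemxAl mxtraceD mxtraceZ.
exists w => x; apply/eqP; rewrite -subr_eq0; apply/eqP.
have dE' : is_der (E - adm w).
  move=> u v; rewrite !mulmxBr dE -!gbrE jac !(gbrDl, gbrDr, gbrNl, gbrNr).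
  by mxring.
have -> : x *m E - gbr w x = x *m (E - adm w) by rewrite mulmxBr -gbrE.
apply: kil_nondeg => y; rewrite -der_trace // mulmxBr raddfB /= hw.
by rewrite kilC /kil mxtrace_mulC subrr.
Qed.

End TauSimple.

(** * Loops as Fourier sequences *)

Definition zrange (N : nat) : seq int := [seq j%:Z - N%:Z | j <- iota 0 N.*2.+1].

Lemma mem_zrange N (k : int) : (k \in zrange N) = (`|k| <= N)%N.
Proof.
apply/mapP/idP => [[j]|kN]; first by rewrite mem_iota => ? ->; lia.
exists `|(k + N%:Z)%R|%N; last by lia.
by rewrite mem_iota; lia.
Qed.

Lemma zrange_uniq N : uniq (zrange N).
Proof. by rewrite map_inj_uniq ?iota_uniq // => i j; lia. Qed.

Section Supports.
Variable V : zmodType.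
Implicit Type F : int -> V.

Lemma big_supp (r1 r2 : seq int) F : uniq r1 -> uniq r2 ->
  (forall j, F j != 0 -> j \in r1) -> (forall j, F j != 0 -> j \in r2) ->
  \sum_(j <- r1) F j = \sum_(j <- r2) F j.
Proof.
move=> u1 u2 h1 h2.
have red r : \sum_(j <- r) F j = \sum_(j <- [seq j <- r | F j != 0]) F j.
  rewrite big_filter [in RHS]big_mkcond; apply: eq_bigr => j _.
  by case: eqVneq => //= ->.
rewrite red [RHS]red; apply/perm_big/uniq_perm; rewrite ?filter_uniq // => j.
by rewrite !mem_filter; case: eqVneq => //= nz; rewrite h1 ?h2 //; apply/eqP.
Qed.

Lemma big_supp1 (r : seq int) F k : uniq r -> k \in r -> (forall j, j != k -> F j = 0) ->
  \sum_(j <- r) F j = F k.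
Proof.
move=> ur kr h; rewrite (bigD1_seq k) //= big1 ?addr0 // => j; exact: h.
Qed.

Lemma sum_zrangeN N F : \sum_(j <- zrange N) F (- j) = \sum_(j <- zrange N) F j.
Proof.
rewrite -(big_map (fun j : int => - j) xpredT F); apply/perm_big/uniq_perm.
- by rewrite map_inj_uniq ?zrange_uniq //; apply: oppr_inj.
- exact: zrange_uniq.
move=> j; rewrite mem_zrange; apply/mapP/idP => [[i]|h].
  by rewrite mem_zrange => ? ->; rewrite abszN.
by exists (- j); rewrite ?mem_zrange ?abszN ?opprK.
Qed.
End Supports.

Section Loops.
Variables (C : numClosedFieldType) (g : lie_data C).
Local Notation n := (ldim g).
Local Notation V := ('rV[C]_n).
Local Notation L := (loopT g).
Implicit Types (u v w : L) (x y : V).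

Definition supp_in N u := forall k : int, (N < `|k|)%N -> u k = 0.

Definition mono (k : int) x : L := fun j => if j == k then x else 0.
(** Multiplication by e^{imt/l}; in particular the shift by [l] is multiplication by e^{it}. *)
Definition shift (m : int) u : L := fun j => u (j - m).
(** Pointwise conjugation of the loop; the index changes sign because e^{ikt/l} is conjugated
    too. *)
Definition tau u : L := fun k => (u (- k))^cj.

Lemma loop_linE a u v (k : int) : (a *: u + v) k = a *: u k + v k.
Proof. by []. Qed.

Lemma supp_in_le N M u : (N <= M)%N -> supp_in N u -> supp_in M u.
Proof. by move=> NM h k Mk; apply: h; apply: leq_ltn_trans NM Mk. Qed.

Lemma supp_in_common u v : finsupp u -> finsupp v ->
  exists N, supp_in N u /\ supp_in N v.
Proof.
move=> [N hN] [M hM]; exists (maxn N M); split.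
  exact: supp_in_le (leq_maxl _ _) hN.
exact: supp_in_le (leq_maxr _ _) hM.
Qed.

Lemma supp_in_bnd u : finsupp u -> supp_in (bnd u) u.
Proof. by move=> h; apply: (ClassicalEpsilon.epsilon_spec (inhabits 0%N) _ h). Qed.

(** Frees sums from the bound chosen by [epsilon]: any bound of the support gives the same value, so
    several loops can share one range. *)
Lemma isumE (W : zmodType) (F : int -> W) N u : supp_in N u ->
  (forall k, u k = 0 -> F k = 0) -> isum u F = \sum_(j <- zrange N) F j.
Proof.
move=> hN h0; have hb : supp_in (bnd u) u by apply: supp_in_bnd; exists N.
have sF M : supp_in M u -> forall j, F j != 0 -> j \in zrange M.
  move=> hM j Fj; rewrite mem_zrange leqNgt; apply: contraNN Fj => /hM/h0 ->.
  by rewrite eqxx.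
rewrite (@big_supp _ _ (zrange (bnd u))) ?zrange_uniq //; try exact: sF.
by rewrite big_map (_ : iota _ _ = index_iota 0 (bnd u).*2.+1) ?big_mkord // /index_iota subn0.
Qed.

Lemma lpbrE N u v k : supp_in N u ->
  lpbr u v k = \sum_(j <- zrange N) gbr (u j) (v (k - j)).
Proof. by move=> hN; apply: isumE => // j ->; rewrite gbr0l. Qed.

Lemma formLE N u v : supp_in N u ->
  formL u v = \sum_(j <- zrange N) kil (u j) (v (- j)).
Proof. by move=> hN; apply: isumE => // j ->; rewrite kil0l. Qed.

Lemma finsupp_lin a u v : finsupp u -> finsupp v -> finsupp (a *: u + v).
Proof.
move=> /supp_in_common h /h[N [hu hv]]; exists N => k Nk.
by rewrite /GRing.add /GRing.scale /= hu // hv // scaler0 addr0.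
Qed.

Lemma finsupp0 : finsupp (0 : L). Proof. by exists 0%N. Qed.

Lemma finsuppD u v : finsupp u -> finsupp v -> finsupp (u + v).
Proof. by rewrite -[u in finsupp (u + v)]scale1r; apply: finsupp_lin. Qed.

Lemma finsupp_mono k x : finsupp (mono k x).
Proof. by exists `|k|%N => j kj; rewrite /mono; case: eqP kj => // ->; rewrite ltnn. Qed.

Lemma finsupp_shift m u : finsupp u -> finsupp (shift m u).
Proof. by move=> [N h]; exists (N + `|m|)%N => k hk; apply: h; lia. Qed.

Lemma finsupp_tau u : finsupp u -> finsupp (tau u).
Proof. by move=> [N h]; exists N => k hk; rewrite /tau h ?map_mx0 // abszN. Qed.

Lemma finsupp_der l u : finsupp u -> finsupp (derL l u).
Proof. by move=> [N h]; exists N => k hk; rewrite /derL h // scaler0. Qed.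

Lemma finsupp_br u v : finsupp u -> finsupp v -> finsupp (lpbr u v).
Proof.
move=> /supp_in_common h /h[N [hu hv]]; exists (N + N)%N => k hk.
rewrite (lpbrE _ _ hu) big_seq big1 // => j; rewrite mem_zrange => hj.
by rewrite [v _]hv ?gbr0r //; lia.
Qed.

Lemma mono_sum N u : supp_in N u -> u = \sum_(k <- zrange N) mono k (u k).
Proof.
move=> h; rewrite fct_sumE; apply/funext => j.
have [jN|jN] := boolP (j \in zrange N).
  rewrite (@big_supp1 _ _ _ j) ?zrange_uniq // ?/mono ?eqxx // => i /negPf ij.
  by rewrite /mono eq_sym ij.
rewrite h; last by rewrite mem_zrange -ltnNge in jN.
rewrite big_seq big1 // => i iN; rewrite /mono; case: eqP => // ji.
by rewrite ji iN in jN.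
Qed.

Lemma monoD k x y : mono k (x + y) = mono k x + mono k y.
Proof. by apply/funext => j; rewrite /mono /GRing.add /=; case: ifP => // _; rewrite addr0. Qed.
Lemma monoZ k a x : mono k (a *: x) = a *: mono k x.
Proof. by apply/funext => j; rewrite /mono /GRing.scale /=; case: ifP => // _; rewrite scaler0. Qed.
Lemma mono0 k : mono k 0 = 0.
Proof. by apply/funext => j; rewrite /mono; case: ifP. Qed.

Lemma shift_mono m k x : shift m (mono k x) = mono (k + m) x.
Proof. by apply/funext => j; rewrite /shift /mono subr_eq. Qed.
Lemma shiftA m p u : shift m (shift p u) = shift (p + m) u.
Proof. by apply/funext => j; rewrite /shift opprD addrA addrAC. Qed.
Lemma shift0 u : shift 0 u = u.
Proof. by apply/funext => j; rewrite /shift subr0. Qed.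
Lemma shift_lin m a u v : shift m (a *: u + v) = a *: shift m u + shift m v.
Proof. by []. Qed.

Lemma tau_mono k x : tau (mono k x) = mono (- k) x^cj.
Proof.
by apply/funext => j; rewrite /tau /mono eqr_oppLR; case: ifP => // _; rewrite map_mx0.
Qed.
Lemma tauK u : tau (tau u) = u.
Proof. by apply/funext => j; rewrite /tau opprK cjK. Qed.
Lemma tau_lin a u v : tau (a *: u + v) = a^* *: tau u + tau v.
Proof. by apply/funext => j; rewrite /tau map_mxD cjZ. Qed.

Lemma derL_lin l a u v : derL l (a *: u + v) = a *: derL l u + derL l v.
Proof.
apply/funext => j; rewrite [RHS]loop_linE /derL loop_linE.
by rewrite scalerDr !scalerA mulrC.
Qed.
Lemma derL_mono l k x : derL l (mono k x) = ('i * k%:~R / l%:R) *: mono k x.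
Proof.
rewrite -monoZ; apply/funext => j; rewrite /derL /mono.
by case: eqP => [->|_] //; rewrite scaler0.
Qed.

Lemma lpbr_linl a u v w : finsupp u -> finsupp v ->
  lpbr (a *: u + v) w = a *: lpbr u w + lpbr v w.
Proof.
move=> /supp_in_common h /h[N [hu hv]]; apply/funext => k.
rewrite loop_linE !(lpbrE _ _ (N := N)) //.
  rewrite scaler_sumr -big_split; apply: eq_bigr => j _.
  by rewrite /= gbrDl gbrZl.
by move=> j jN; rewrite /GRing.add /GRing.scale /= hu // hv // scaler0 addr0.
Qed.

Lemma lpbr_linr a u v w : finsupp u ->
  lpbr u (a *: v + w) = a *: lpbr u v + lpbr u w.
Proof.
move=> [N hN]; apply/funext => k.
rewrite loop_linE !(lpbrE _ _ (N := N)) //.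
rewrite scaler_sumr -big_split; apply: eq_bigr => j _.
by rewrite /= gbrDr gbrZr.
Qed.

Lemma lpbr_monol k x v : lpbr (mono k x) v = fun j => gbr x (v (j - k)).
Proof.
apply/funext => j; rewrite (@lpbrE `|k|).
  rewrite (@big_supp1 _ _ _ k) ?zrange_uniq // ?mem_zrange // /mono ?eqxx //.
  by move=> i /negPf ->; rewrite gbr0l.
by move=> i; rewrite /mono; case: eqP => // ->; rewrite ltnn.
Qed.

Lemma lpbr_mono k m x y : lpbr (mono k x) (mono m y) = mono (k + m) (gbr x y).
Proof.
rewrite lpbr_monol; apply/funext => j; rewrite /mono subr_eq addrC.
by case: ifP => // _; rewrite gbr0r.
Qed.

Lemma formL_linl a u v w : finsupp u -> finsupp v ->
  formL (a *: u + v) w = a * formL u w + formL v w.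
Proof.
move=> /supp_in_common h /h[N [hu hv]]; rewrite !(formLE _ (N := N)) //.
  rewrite mulr_sumr -big_split; apply: eq_bigr => j _.
  by rewrite /= kilDl kilZl.
by move=> j jN; rewrite /GRing.add /GRing.scale /= hu // hv // scaler0 addr0.
Qed.

Lemma formL_linr a u v w : finsupp u ->
  formL u (a *: v + w) = a * formL u v + formL u w.
Proof.
move=> [N hN]; rewrite !(formLE _ hN).
rewrite mulr_sumr -big_split; apply: eq_bigr => j _.
by rewrite /= kilDr kilZr.
Qed.

Lemma formL_monol k x v : formL (mono k x) v = kil x (v (- k)).
Proof.
rewrite (@formLE `|k|).
  rewrite (@big_supp1 _ _ _ k) ?zrange_uniq // ?mem_zrange // /mono ?eqxx //.
  by move=> i /negPf ->; rewrite kil0l.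
by move=> i; rewrite /mono; case: eqP => // ->; rewrite ltnn.
Qed.

Lemma fs_ind (P : L -> Prop) :
  (forall a u v, finsupp u -> finsupp v -> P u -> P v -> P (a *: u + v)) ->
  (forall k x, P (mono k x)) -> forall u, finsupp u -> P u.
Proof.
move=> PL Pm u [N hN]; rewrite (mono_sum hN).
apply: (big_ind (fun v => finsupp v /\ P v) _ _ _).2 => [|v w [fv Pv] [fw Pw]|k _].
- by split; [exact: finsupp0|rewrite -(mono0 0)].
- by split; [exact: finsuppD|rewrite -[v]scale1r; apply: PL].
- by split; [exact: finsupp_mono|].
Qed.
End Loops.

(** * Identities for bracket, derivative, form, conjugation and shift, checked on monomials *)

Section LoopIdentities.
Variables (C : numClosedFieldType) (isR : bool) (g : lie_data C).
Hypothesis gS : tau_simple isR g.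
Local Notation n := (ldim g).
Local Notation V := ('rV[C]_n).
Local Notation L := (loopT g).
Implicit Types (u v w : L) (x y : V).

Lemma formL_mono k m x y : formL (mono k x) (mono m y) =
  if k + m == 0 then kil x y else 0.
Proof.
rewrite formL_monol /mono eq_sym -addr_eq0 addrC; case: ifP => // _.
by rewrite kilC kil0l.
Qed.

Lemma lpbrC u v : finsupp u -> finsupp v -> lpbr u v = - lpbr v u.
Proof.
move=> fu fv; elim/fs_ind: u / fu v fv => [a u u' fu fu' hu hu' v fv|k x v fv].
  by rewrite lpbr_linl // lpbr_linr // hu // hu' // opprD scalerN.
elim/fs_ind: v / fv => [a v v' fv fv' hv hv'|m y].
  rewrite lpbr_linl // lpbr_linr ?hv ?hv' ?opprD ?scalerN //; exact: finsupp_mono.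
by rewrite !lpbr_mono addrC (ts_skew gS) -scaleN1r monoZ scaleN1r.
Qed.

Lemma formLC u v : finsupp u -> finsupp v -> formL u v = formL v u.
Proof.
move=> fu fv; elim/fs_ind: u / fu v fv => [a u u' fu fu' hu hu' v fv|k x v fv].
  by rewrite formL_linl // formL_linr // hu // hu'.
elim/fs_ind: v / fv => [a v v' fv fv' hv hv'|m y].
  rewrite formL_linl // formL_linr ?hv ?hv' //; exact: finsupp_mono.
by rewrite !formL_mono addrC kilC.
Qed.

Lemma formL_der l u v : finsupp u -> finsupp v ->
  formL (derL l u) v = - formL u (derL l v).
Proof.
move=> fu fv; elim/fs_ind: u / fu v fv => [a u u' fu fu' hu hu' v fv|k x v fv].
  rewrite derL_lin !formL_linl ?hu ?hu' ?opprD ?mulrN //; exact: finsupp_der.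
elim/fs_ind: v / fv => [a v v' fv fv' hv hv'|m y].
  rewrite derL_lin !formL_linr ?hv ?hv' ?opprD ?mulrN //;
    [exact: finsupp_mono|exact/finsupp_der/finsupp_mono].
rewrite !derL_mono -!monoZ !formL_mono; case: eqP => [/eqP|]; last by rewrite oppr0.
rewrite addr_eq0 => /eqP ->; rewrite kilZl kilZr -mulNr; congr (_ * _).
by rewrite mulrNz; ring.
Qed.

Lemma formL_inv u v w : finsupp u -> finsupp v -> finsupp w ->
  formL (lpbr u v) w = formL u (lpbr v w).
Proof.
move=> fu fv fw; elim/fs_ind: u / fu v w fv fw => [a u u' fu fu' hu hu' v w fv fw|k x v w fv fw].
  by rewrite lpbr_linl // !formL_linl ?hu ?hu' //; apply: finsupp_br.
have fx := finsupp_mono k x.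
elim/fs_ind: v / fv w fw => [a v v' fv fv' hv hv' w fw|m y w fw].
  by rewrite lpbr_linl // lpbr_linr // formL_linl ?formL_linr ?hv ?hv' //; apply: finsupp_br.
have fy := finsupp_mono m y.
elim/fs_ind: w / fw => [a w w' fw fw' hw hw'|p z].
  by rewrite lpbr_linr // !formL_linr ?hw ?hw' //; apply: finsupp_br.
by rewrite !lpbr_mono !formL_mono addrA (kil_gbr gS).
Qed.

Lemma derL_br l u v : finsupp u -> finsupp v ->
  derL l (lpbr u v) = lpbr (derL l u) v + lpbr u (derL l v).
Proof.
move=> fu fv; elim/fs_ind: u / fu v fv => [a u u' fu fu' hu hu' v fv|k x v fv].
  rewrite !derL_lin !lpbr_linl ?derL_lin ?hu ?hu' //; try exact: finsupp_der.
  by rewrite scalerDr addrACA.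
have fx := finsupp_mono k x.
elim/fs_ind: v / fv => [a v v' fv fv' hv hv'|m y].
  rewrite !derL_lin !lpbr_linr ?derL_lin ?hv ?hv' //; try exact: finsupp_der.
  by rewrite scalerDr addrACA.
rewrite !(lpbr_mono, derL_mono) -!monoZ !lpbr_mono -monoD gbrZl gbrZr -scalerDl.
by rewrite intrD; congr (mono _ (_ *: _)); ring.
Qed.

Lemma tau_br u v : isR -> finsupp u -> finsupp v ->
  tau (lpbr u v) = lpbr (tau u) (tau v).
Proof.
move=> R fu fv; elim/fs_ind: u / fu v fv => [a u u' fu fu' hu hu' v fv|k x v fv].
  by rewrite lpbr_linl // !tau_lin hu // hu' // lpbr_linl //; apply: finsupp_tau.
elim/fs_ind: v / fv => [a v v' fv fv' hv hv'|m y].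
  by rewrite lpbr_linr ?tau_lin ?hv ?hv' ?lpbr_linr //; [apply/finsupp_tau|];
    apply: finsupp_mono.
by rewrite !(lpbr_mono, tau_mono) (ts_cj gS R) opprD.
Qed.

Lemma tau_der l u : tau (derL l u) = derL l (tau u).
Proof.
apply/funext => k; rewrite /tau /derL cjZ; congr (_ *: _).
rewrite !rmorphM /= conjCi fmorphV rmorph_nat rmorph_int mulrNz; ring.
Qed.

Lemma formL_tau u v : isR -> finsupp u -> finsupp v ->
  formL (tau u) (tau v) = (formL u v)^*.
Proof.
move=> R fu fv; elim/fs_ind: u / fu v fv => [a u u' fu fu' hu hu' v fv|k x v fv].
  rewrite tau_lin !formL_linl // ?hu ?hu' ?rmorphD ?rmorphM //; exact: finsupp_tau.
elim/fs_ind: v / fv => [a v v' fv fv' hv hv'|m y].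
  rewrite tau_lin !formL_linr // ?hv ?hv' ?rmorphD ?rmorphM //; [|exact: finsupp_mono].
  exact/finsupp_tau/finsupp_mono.
rewrite !tau_mono !formL_mono -opprD oppr_eq0 (kil_cj gS) //.
by case: ifP => // _; rewrite rmorph0.
Qed.

Lemma lpbr_shiftr m u v : lpbr u (shift m v) = shift m (lpbr u v).
Proof.
apply/funext => k; rewrite /shift /lpbr; congr isum; apply/funext => j.
by rewrite addrAC.
Qed.

Lemma lpbr_shiftl m u v : finsupp u -> finsupp v -> lpbr (shift m u) v = shift m (lpbr u v).
Proof.
move=> fu fv; rewrite lpbrC ?lpbr_shiftr ?[lpbr v u]lpbrC //; last exact: finsupp_shift.
by apply/funext => k; rewrite /shift; apply: opprK.
Qed.

Lemma derL_shift l m u : (0 < l)%N ->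
  derL l (shift (l%:Z * m) u) = shift (l%:Z * m) (derL l u) + ('i * m%:~R) *: shift (l%:Z * m) u.
Proof.
move=> l0; apply/funext => k; rewrite addrC [RHS]loop_linE /derL /shift -scalerDl.
congr (_ *: _); rewrite rmorphB rmorphM /= -pmulrn.
by field; rewrite pnatr_eq0 -lt0n.
Qed.

End LoopIdentities.

(** * Eigenspaces of sigma and complex twisted loops *)

Section TwistedLoops.
Variables (C : numClosedFieldType) (isR : bool) (g : lie_data C).
Variables (s : 'M[C]_(ldim g)) (l : nat).
Local Notation n := (ldim g).
Local Notation V := ('rV[C]_n).
Local Notation L := (loopT g).
Implicit Types (u v w : L) (x y : V).

Record fin_aut : Prop := FinAut {
  fa_gt0 : (0 < l)%N;
  fa_exp : s ^+ l = 1;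
  fa_br : forall x y, gbr (x *m s) (y *m s) = gbr x y *m s;
  fa_cj : isR -> s^cj = s }.

Lemma fin_autP : is_gaut isR s -> (0 < l)%N -> s ^+ l = 1 -> fin_aut.
Proof.
move=> [sF [_ sbr]] l0 sl; split=> //.
  move=> x y; elim/(@complex_ext C isR g): x y => [a x x' hx hx' y|x Fx].
    by rewrite !(gbrDl, gbrZl, mulmxDl, =^~ scalemxAl) hx hx'.
  elim/(@complex_ext C isR g) => [a y y' hy hy'|y Fy]; last exact: sbr.
  by rewrite !(gbrDr, gbrZr, mulmxDl, =^~ scalemxAl) hy hy'.
move=> R; apply/matrixP => i j; rewrite mxE; apply/CrealP.
by move: (sF i j); rewrite /inF R.
Qed.

Hypothesis sA : fin_aut.
Let l0 := fa_gt0 sA.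
Local Notation e := (eps C l).

Definition hom (k : int) x := x *m s = e ^ k *: x.
(** Twisted loops without the reality condition: the complexified loop algebra when F is real, the
    loop algebra itself when F is complex. *)
Definition LC u := finsupp u /\ forall k, hom k (u k).

Lemma eps_neq0 : e != 0.
Proof. by rewrite (prim_root_eq0 (eps_prim C l0)) -lt0n. Qed.
Let e0 := eps_neq0.

Lemma eps_conj : e^* = e^-1.
Proof.
rewrite invC_norm (unity_norm l0 (prim_expr_order (eps_prim C l0))).
by rewrite expr1n invr1 mul1r.
Qed.

Lemma eps_period k m : e ^ (k + l%:Z * m) = e ^ k.
Proof.
rewrite expfzDr // -exprz_exp -exprnP (prim_expr_order (eps_prim C l0)).
by rewrite exp1rz mulr1.
Qed.

Lemma inL_LC u : inL isR s l u <-> LC u /\ (isR -> tau u = u).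
Proof.
split=> [[fu [hu ru]]|[[fu hu] ru]].
  split=> // R; apply/funext => k; rewrite /tau ru // -[RHS]cjK; congr _^cj.
  by apply/rowP => i; rewrite !mxE.
split=> //; split=> // R k; rewrite -{1}ru // /tau opprK.
by apply/rowP => i; rewrite !mxE.
Qed.

Lemma hom_lin k a x y : hom k x -> hom k y -> hom k (a *: x + y).
Proof. by rewrite /hom mulmxDl -scalemxAl => -> ->; rewrite scalerDr !scalerA mulrC. Qed.
Lemma hom0 k : hom k 0. Proof. by rewrite /hom mul0mx scaler0. Qed.
Lemma homD k x y : hom k x -> hom k y -> hom k (x + y).
Proof. by rewrite -[x in hom k (x + y)]scale1r; apply: hom_lin. Qed.
Lemma homZ k a x : hom k x -> hom k (a *: x).
Proof. by move=> h; rewrite -[_ *: _]addr0; apply: hom_lin (hom0 k). Qed.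
Lemma hom_period k m x : hom (k + l%:Z * m) x <-> hom k x.
Proof. by rewrite /hom eps_period. Qed.

Lemma hom_br k m x y : hom k x -> hom m y -> hom (k + m) (gbr x y).
Proof.
by move=> hx hy; rewrite /hom -(fa_br sA) hx hy gbrZl gbrZr scalerA expfzDr.
Qed.

Lemma hom_cj k x : isR -> hom k x -> hom (- k) x^cj.
Proof.
move=> R; rewrite /hom => /(congr1 (fun y => y^cj)); rewrite map_mxM (fa_cj sA R) => ->.
by rewrite cjZ fmorphXz /= eps_conj exprz_inv.
Qed.

Lemma LC_lin a u v : LC u -> LC v -> LC (a *: u + v).
Proof.
move=> [fu hu] [fv hv]; split; first exact: finsupp_lin.
by move=> k; apply: hom_lin.
Qed.
Lemma LC0 : LC 0.
Proof. by split=> [|k]; [exact: finsupp0|exact: hom0]. Qed.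
Lemma LCD u v : LC u -> LC v -> LC (u + v).
Proof. by rewrite -[u in LC (u + v)]scale1r; apply: LC_lin. Qed.
Lemma LCZ a u : LC u -> LC (a *: u).
Proof. by move=> h; rewrite -[_ *: _]addr0; apply: LC_lin LC0. Qed.

Lemma LC_mono k x : hom k x -> LC (mono k x).
Proof.
move=> hx; split=> [|j]; first exact: finsupp_mono.
by rewrite /mono; case: eqP => [->|_] //; apply: hom0.
Qed.

Lemma LC_comp u k : LC u -> LC (mono k (u k)).
Proof. by move=> [_ hu]; apply: LC_mono. Qed.

Lemma LC_shift m u : LC u -> LC (shift (l%:Z * m) u).
Proof.
move=> [fu hu]; split; first exact: finsupp_shift.
by move=> k; have := (hom_period _ m _).2 (hu (k - l%:Z * m)); rewrite subrK.
Qed.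

Lemma LC_tau u : isR -> LC u -> LC (tau u).
Proof.
move=> R [fu hu]; split=> [|k]; first exact: finsupp_tau.
by have := hom_cj R (hu (- k)); rewrite opprK.
Qed.

Lemma LC_der u : LC u -> LC (derL l u).
Proof.
by move=> [fu hu]; split=> [|k]; [exact: finsupp_der|exact: homZ].
Qed.

Lemma LC_br u v : LC u -> LC v -> LC (lpbr u v).
Proof.
move=> [fu hu] [fv hv]; split=> [|k]; first exact: finsupp_br.
have [N hN] := fu; rewrite (lpbrE _ _ hN); apply: (big_ind (hom k)) => [||j _].
- exact: hom0.
- exact: homD.
- by rewrite -{1}(subrKC j k); apply: hom_br.
Qed.

Lemma LC_ind (P : L -> Prop) :
  (forall a u v, LC u -> LC v -> P u -> P v -> P (a *: u + v)) ->
  (forall k x, hom k x -> P (mono k x)) -> forall u, LC u -> P u.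
Proof.
move=> PL Pm u [[N hN] hu]; rewrite (mono_sum hN).
apply: (big_ind (fun v => LC v /\ P v) _ _ _).2 => [|v w [fv Pv] [fw Pw]|k _].
- by split; [exact: LC0|rewrite -(mono0 g 0); apply/Pm/hom0].
- by split; [exact: LCD|rewrite -[v]scale1r; apply: PL].
- by split; [exact: LC_mono|apply: Pm].
Qed.

(** The projector onto the eigenspace [hom k], obtained by averaging over the powers of sigma. *)
Definition proj (k : int) : 'M[C]_n :=
  l%:R^-1 *: \sum_(j < l) e ^ (- k * j%:Z) *: s ^+ j.

Lemma hom_exp k x j : hom k x -> x *m s ^+ j = e ^ (k * j%:Z) *: x.
Proof.
move=> hx; elim: j => [|j IH]; first by rewrite mulr0 expr0z expr0 mulmx1 scale1r.
rewrite exprSr mulmxA IH -scalemxAl hx scalerA -expfzDr //.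
by congr (_ ^ _ *: _); lia.
Qed.

Lemma sum_eps m : e ^ m != 1 -> \sum_(j < l) e ^ (m * j%:Z) = 0.
Proof.
rewrite -subr_eq0 => m1; apply: (mulfI m1); rewrite mulr0.
under eq_bigr do rewrite -exprz_exp -exprnP.
by rewrite -subrX1 exprnP exprz_exp mulrC -[X in e ^ X]add0r eps_period expr0z subrr.
Qed.

Lemma proj_id k x : hom k x -> x *m proj k = x.
Proof.
move=> hx; rewrite -scalemxAr mulmx_sumr.
under eq_bigr do rewrite -scalemxAr (hom_exp _ hx) scalerA -expfzDr // mulNr addNr expr0z scale1r.
by rewrite sumr_const card_ord -scaler_nat scalerA mulVf ?scale1r // pnatr_eq0 -lt0n.
Qed.

Lemma proj_eq0 k m x : hom k x -> e ^ k != e ^ m -> x *m proj m = 0.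
Proof.
move=> hx km; rewrite -scalemxAr mulmx_sumr.
under eq_bigr do rewrite -scalemxAr (hom_exp _ hx) scalerA -expfzDr // -mulrDl.
rewrite -scaler_suml sum_eps ?scale0r ?scaler0 //.
rewrite addrC expfzDr // -invr_expz -(can_eq (mulfK (expfz_neq0 m e0))) mul1r.
by rewrite mulfVK ?expfz_neq0.
Qed.

Lemma proj_hom k x : hom k (x *m proj k).
Proof.
rewrite /hom /proj -!scalemxAr -scalemxAl scalerA mulrC -scalerA; congr (_ *: _).
rewrite -mulmxA mulmx_suml scalemxAr; congr (_ *m _).
pose a (j : nat) := e ^ (- k * j%:Z) *: s ^+ j.
have aS j : a j *m s = e ^ k *: a j.+1.
  rewrite -scalemxAl scalerA -expfzDr // exprSr; congr (_ ^ _ *: _); lia.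
have al : a l = a 0.
  rewrite /a (fa_exp sA) expr0 mulr0 mulrC -[l%:Z * _]add0r.
  by rewrite eps_period.
under eq_bigr do rewrite -/(a _) aS.
rewrite -scaler_sumr; congr (_ *: _); apply: (@addrI _ (a 0)).
by rewrite -(big_ord_recl _ a) big_ord_recr addrC al.
Qed.

Lemma proj_sum : \sum_(k < l) proj k%:Z = 1.
Proof.
rewrite -scaler_sumr exchange_big /=.
rewrite (bigD1 (Ordinal l0)) //= [X in _ + X]big1 => [|j j0].
  rewrite addr0 expr0; under eq_bigr do rewrite mulr0 expr0z scale1r.
  by rewrite sumr_const card_ord -scaler_nat scalerA mulVf ?scale1r // pnatr_eq0 -lt0n.
rewrite -scaler_suml; under eq_bigr do rewrite mulNr -mulrN mulrC.
rewrite sum_eps ?scale0r // -invr_expz -exprnP invr_eq1.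
rewrite -(prim_order_dvd (eps_prim C l0)); apply: contraNN j0 => /dvdnP[q jq].
rewrite -val_eqE /=; apply/eqP; move: (ltn_ord j); rewrite jq; case: q jq => // q _.
by rewrite ltnNge mulSn leq_addr.
Qed.

Lemma proj_dec x : x = \sum_(k < l) x *m proj k%:Z.
Proof. by rewrite -mulmx_sumr proj_sum mulmx1. Qed.

Lemma proj_period k m : proj (k + l%:Z * m) = proj k.
Proof.
congr (_ *: _); apply: eq_bigr => j _; congr (_ *: _).
by rewrite -[RHS](eps_period _ (- m * j%:Z)); congr (_ ^ _); lia.
Qed.

Lemma hom_ind (P : V -> Prop) : (forall x y, P x -> P y -> P (x + y)) ->
  (forall k x, hom k x -> P x) -> forall x, P x.
Proof.
move=> PD Ph x; rewrite (proj_dec x); apply: big_ind => // [|k _].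
  by apply: (Ph 0); apply: hom0.
exact/Ph/proj_hom.
Qed.

End TwistedLoops.

(** * Operators commuting with multiplication by exp(it) *)

Lemma linear_mx (C : fieldType) n p (f : 'rV[C]_n -> 'rV[C]_p) :
  (forall a x y, f (a *: x + y) = a *: f x + f y) -> exists M, forall x, f x = x *m M.
Proof.
move=> fL; exists (\matrix_i f (delta_mx 0 i)) => x.
have f0 : f 0 = 0 by have := fL (-1) 0 0; rewrite !scaleN1r !addNr.
rewrite {1}[x]row_sum_delta mulmx_sum_row.
elim/big_rec2: _ => // i y1 y2 _ <-.
by rewrite fL rowK.
Qed.

(** Units among Laurent polynomials are monomials: products of extreme coefficients do not vanish,
    so the top degrees of the two factors add up to 0, and so do the bottom degrees. *)
Lemma laurent_unit (C : fieldType) (chi psi : int -> C) N :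
  (forall m, (N < `|m|)%N -> chi m = 0) -> (forall m, (N < `|m|)%N -> psi m = 0) ->
  (forall j, \sum_(m <- zrange N) chi m * psi (j - m) = (j == 0)%:R) ->
  exists d, (forall m, m != d -> chi m = 0) /\ (forall m, m != - d -> psi m = 0).
Proof.
move=> hchi hpsi conv.
have top (f : int -> C) : (forall m, (N < `|m|)%N -> f m = 0) -> (exists m, f m != 0) ->
    exists q, f q != 0 /\ forall m, q < m -> f m = 0.
  move=> hf [m0 fm0]; have m0N : (`|m0| <= N)%N by rewrite leqNgt; apply: contraNN fm0 => /hf ->.
  have ex : exists d : nat, f (N%:Z - d%:Z) != 0.
    by exists `|(N%:Z - m0)%R|%N; rewrite (_ : _ - _ = m0) //; lia.
  case: (ex_minnP ex) => d fd dmin; exists (N%:Z - d%:Z); split=> // m dm.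
  have [mN|mN] := leqP `|m| N; last exact: hf.
  apply/eqP/contraT => fm; have := dmin `|(N%:Z - m)%R|%N.
  have -> : N%:Z - `|(N%:Z - m)%R|%N%:Z = m by lia.
  by move=> /(_ fm); lia.
have bot (f : int -> C) : (forall m, (N < `|m|)%N -> f m = 0) -> (exists m, f m != 0) ->
    exists q, f q != 0 /\ forall m, m < q -> f m = 0.
  move=> hf [m0 fm0]; have [||q [fq hq]] := top (fun m => f (- m)).
  - by move=> m hm; apply: hf; rewrite abszN.
  - by exists (- m0); rewrite opprK.
  by exists (- q); split=> // m hm; rewrite -[m]opprK; apply: hq; lia.
have /existsNP[m1 cm1] : ~ (forall m, chi m * psi (- m) = 0).
  move=> h; have := conv 0; rewrite eqxx big1 => [/eqP|m _]; last by rewrite sub0r.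
  by rewrite eq_sym oner_eq0.
have chi0 : exists m, chi m != 0 by exists m1; apply/eqP => h; rewrite h mul0r in cm1.
have psi0 : exists m, psi m != 0.
  by exists (- m1); apply/eqP => h; rewrite h mulr0 in cm1.
have [q [fq hq]] := top _ hchi chi0; have [q' [fq' hq']] := top _ hpsi psi0.
have [p [fp hp]] := bot _ hchi chi0; have [p' [fp' hp']] := bot _ hpsi psi0.
have inr m : chi m != 0 -> m \in zrange N.
  by move=> h; rewrite mem_zrange leqNgt; apply: contraNN h => /hchi ->.
have single a b : chi a != 0 -> psi b != 0 ->
    (forall m, m != a -> chi m * psi (a + b - m) = 0) -> a + b = 0.
  move=> ca pb h; have := conv (a + b); rewrite (@big_supp1 _ _ _ a) ?zrange_uniq ?inr //.
  rewrite addrAC subrr add0r; case: eqP => // _ /eqP.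
  by rewrite mulf_eq0 (negPf ca) (negPf pb).
have e1 : q + q' = 0.
  apply: single => // m mq; have [lt|gt] : m < q \/ q < m by lia.
    by rewrite [psi _]hq' ?mulr0 //; lia.
  by rewrite hq ?mul0r.
have e2 : p + p' = 0.
  apply: single => // m mp; have [lt|gt] : m < p \/ p < m by lia.
    by rewrite hp ?mul0r.
  by rewrite [psi _]hp' ?mulr0 //; lia.
have pq : p <= q by rewrite leNgt; apply: contraNN fp => /hq ->.
have pq' : p' <= q' by rewrite leNgt; apply: contraNN fp' => /hq' ->.
have ? : p = q by lia. subst p.
have ? : p' = q' by lia. subst p'.
exists q; split=> m mq.
  have [lt|gt] : m < q \/ q < m by lia.
    exact: hp.
  exact: hq.
have [lt|gt] : m < q' \/ q' < m by lia.
  exact: hp'.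
exact: hq'.
Qed.

Section Convolution.
Variables (C : numClosedFieldType) (isR : bool) (g : lie_data C).
Variables (s : 'M[C]_(ldim g)) (l : nat).
Hypothesis gS : tau_simple isR g.
Hypothesis sA : fin_aut isR s l.
Local Notation n := (ldim g).
Local Notation V := ('rV[C]_n).
Local Notation L := (loopT g).
Local Notation LC := (@LC C g s l).
Local Notation hom := (@hom C g s l).
Local Notation proj := (@proj C g s l).
Implicit Types (u v w : L) (x y : V).

Definition lin_LC (W : lmodType C) (E : L -> W) :=
  forall a u v, LC u -> LC v -> E (a *: u + v) = a *: E u + E v.

Section LinLC.
Variables (W : lmodType C) (E : L -> W).
Hypothesis EL : lin_LC E.

Lemma lin_LC0 : E 0 = 0.
Proof. by have := EL (-1) (LC0 s l) (LC0 s l); rewrite !scaleN1r !addNr. Qed.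
Lemma lin_LCD u v : LC u -> LC v -> E (u + v) = E u + E v.
Proof. by move=> hu hv; have := EL 1 hu hv; rewrite !scale1r. Qed.
Lemma lin_LCZ a u : LC u -> E (a *: u) = a *: E u.
Proof. by move=> hu; have := EL a hu (LC0 s l); rewrite !addr0 lin_LC0 addr0. Qed.
Lemma lin_LC_sum I (r : seq I) (F : I -> L) : (forall i, LC (F i)) ->
  E (\sum_(i <- r) F i) = \sum_(i <- r) E (F i).
Proof.
move=> hF; suff [] : LC (\sum_(i <- r) F i) /\ E (\sum_(i <- r) F i) = \sum_(i <- r) E (F i) by [].
elim: r => [|i r [h1 h2]]; first by rewrite !big_nil lin_LC0; split=> //; apply: LC0.
by rewrite !big_cons lin_LCD // h2; split=> //; apply: LCD.
Qed.
End LinLC.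

Lemma lin_LC_ext (W : lmodType C) (E F : L -> W) : lin_LC E -> lin_LC F ->
  (forall k x, hom k x -> E (mono k x) = F (mono k x)) -> forall u, LC u -> E u = F u.
Proof.
move=> EL FL h u; elim/LC_ind: u / => // a u v hu hv eu ev.
by rewrite EL // FL // eu ev.
Qed.

Lemma supp_in_family (I : finType) (F : I -> L) : (forall i, finsupp (F i)) ->
  exists N, forall i, supp_in N (F i).
Proof.
move=> hF; exists (\max_i bnd (F i)) => i.
exact: supp_in_le (leq_bigmax i) (supp_in_bnd (hF i)).
Qed.

(* [E] is extended to all of g_C[z, 1/z], where it acts by a Laurent polynomial with matrix
   coefficients. *)
Lemma conv_rep (E : L -> L) : lin_LC E -> (forall u, LC u -> LC (E u)) ->
  (forall m u, LC u -> E (shift (l%:Z * m) u) = shift (l%:Z * m) (E u)) ->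
  exists N (e : int -> 'M[C]_n), (forall m, (N < `|m|)%N -> e m = 0) /\
    forall k x, hom k x -> forall j, E (mono k x) j = x *m e (j - k).
Proof.
move=> EL Ehom Es.
have LCp k x : LC (mono k (x *m proj k)) by apply: LC_mono; apply: (proj_hom sA).
(* The degrees 0 to l - 1 exhaust the eigenspaces; all other degrees follow since [E] commutes with
   the shift by [l]. *)
pose f (m : int) x := \sum_(k < l) E (mono k (x *m proj k)) (k%:Z + m).
have fL m a x y : f m (a *: x + y) = a *: f m x + f m y.
  rewrite /f scaler_sumr -big_split; apply: eq_bigr => k _ /=.
  by rewrite mulmxDl monoD -scalemxAl monoZ EL.
have [e he] : {e : int -> 'M[C]_n & forall m x, f m x = x *m e m}.
  by apply: (@choice _ _ (fun m M => forall x, f m x = x *m M)) => m; apply: linear_mx.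
have [N hN] := @supp_in_family ('I_l * 'I_n)%type
  (fun ki => E (mono ki.1 (delta_mx 0 ki.2 *m proj ki.1))) (fun ki => (Ehom _ (LCp _ _)).1).
exists (N + l)%N, e; split=> [m hm|k x hx j].
  apply/row_matrixP => i; rewrite rowE -he row0 /f big1 // => k _.
  by apply: (hN (k, i)); move: (ltn_ord k); lia.
have l0 := fa_gt0 sA; rewrite -he /f.
have kl : (`|(k %% l)%Z| < l)%N.
  by have := ltz_mod k (_ : l%:Z != 0); have := modz_ge0 k (_ : l%:Z != 0); lia.
pose r : 'I_l := Ordinal kl.
have rE : r%:Z = (k %% l)%Z by rewrite gez0_abs // modz_ge0 //; lia.
have kE : k = r%:Z + l%:Z * (k %/ l)%Z by rewrite rE mulrC addrC -divz_eq.
have hr : hom r%:Z x by move: hx; rewrite {1}kE => /(hom_period sA).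
rewrite (bigD1 r) //= big1 ?addr0 => [|i ir].
  rewrite (proj_id sA hr) {1}kE -shift_mono Es; last exact: LC_mono.
  by rewrite /shift; congr (E _ _); lia.
rewrite (proj_eq0 sA hr) ?mono0 ?(lin_LC0 EL) //.
rewrite -!exprnP (eq_prim_root_expr (eps_prim C l0)) !modn_small ?ltn_ord //.
by rewrite eq_sym.
Qed.

(** Perfectness passes from the Lie algebra to its complex loops. For eigenvectors [x] and [y],
    [x, y] contributes to degree [k] only if the eigenvalues match, and then [y] may be placed in
    degree k - p next to [x] in degree p. *)
Lemma loop_bracket_span (P : L -> Prop) :
  P 0 -> (forall u v, LC u -> LC v -> P u -> P v -> P (u + v)) ->
  (forall u v, LC u -> LC v -> P (lpbr u v)) -> forall u, LC u -> P u.
Proof.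
move=> P0 PD Pbr.
have Ph x k : P (mono k (x *m proj k)).
  have LCp y : LC (mono k (y *m proj k)) by apply: LC_mono; apply: (proj_hom sA).
  elim/(bracket_span gS): x => [|x y hx hy|x y].
  - by rewrite mul0mx mono0.
  - by rewrite mulmxDl monoD; apply: PD.
  elim/(hom_ind sA): x y => [x x' hx hx' y|p x hx].
    by rewrite gbrDl mulmxDl monoD; apply: PD.
  elim/(hom_ind sA) => [y y' hy hy'|q y hy].
    by rewrite gbrDr mulmxDl monoD; apply: PD.
  have hxy := hom_br sA hx hy.
  have [epq|npq] := eqVneq (eps C l ^ (p + q)) (eps C l ^ k); last first.
    by rewrite (proj_eq0 sA hxy npq) mono0.
  rewrite (_ : _ *m proj k = gbr x y); last first.
    by apply: (proj_id sA); rewrite /hom -epq.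
  have hy' : hom (k - p) y.
    rewrite /hom hy; congr (_ *: _).
    have e0 := eps_neq0 sA.
    by apply: (mulfI (expfz_neq0 p e0)); rewrite -!expfzDr // epq; congr (_ ^ _); lia.
  rewrite -{1}(subrKC p k) -lpbr_mono; apply: Pbr; exact: LC_mono.
move=> u [[N hN] hu]; rewrite (mono_sum hN).
apply: (big_ind (fun v => LC v /\ P v) _ _ _).2 => [|v w [fv Pv] [fw Pw]|k _].
- by split; [exact: LC0|].
- by split; [exact: LCD|apply: PD].
- by split; [exact: LC_mono|rewrite -(proj_id sA (hu k))].
Qed.

(** The trace of the block of [T] from degree [k] to itself; the projector lets the standard basis
    stand in for a basis of the eigenspace. *)
Definition trace_at (T : L -> L) (k : int) : C :=
  \sum_(i < n) (T (mono k (delta_mx 0 i *m proj k)) k) 0 i.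

Lemma trace_at_period T k m : (forall u, LC u -> T (shift (l%:Z * m) u) = shift (l%:Z * m) (T u)) ->
  trace_at T (k + l%:Z * m) = trace_at T k.
Proof.
move=> Ts; apply: eq_bigr => i _; rewrite -shift_mono (proj_period sA) Ts.
  by rewrite /shift addrK.
by apply: LC_mono; apply: (proj_hom sA).
Qed.

(** Over one period the projectors add up to the identity, so the block traces of ad u ad v assemble
    into the full traces of the Killing form. *)
Lemma trace_ad u v : LC u -> LC v ->
  \sum_(k < l) trace_at (fun w => lpbr u (lpbr v w)) k%:Z = formL u v.
Proof.
move=> [[N hN] hu] [fv hv]; rewrite (formLE _ hN).
transitivity (\sum_(k < l) \sum_(p <- zrange N) \tr (proj k%:Z *m (adm (v (- p)) *m adm (u p)))).
  apply: eq_bigr => k _; rewrite /trace_at exchange_big /=; apply: eq_bigr => i _.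
  rewrite (lpbrE _ _ hN) summxE; apply: eq_bigr => p _.
  have -> : lpbr v (mono k (delta_mx 0 i *m proj k)) (k%:Z - p) = gbr (v (- p)) (delta_mx 0 i *m proj k).
    rewrite (lpbrC gS) ?lpbr_monol //; last exact: finsupp_mono.
    rewrite [LHS](_ : _ = - gbr (delta_mx 0 i *m proj k) (v (k%:Z - p - k%:Z))) //.
    by rewrite addrAC subrr add0r (ts_skew gS) opprK.
  by rewrite !gbrE -!mulmxA -rowE mxE.
rewrite exchange_big; apply: eq_bigr => p _ /=.
by rewrite -raddf_sum /= -mulmx_suml (proj_sum sA) mul1mx.
Qed.

Lemma trace_id : \sum_(k < l) trace_at id k%:Z = n%:R.
Proof.
transitivity (\sum_(k < l) \tr (proj k%:Z)).
  by apply: eq_bigr => k _; apply: eq_bigr => i _; rewrite /mono eqxx -rowE mxE.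
by rewrite -raddf_sum /= (proj_sum sA) mxtrace1.
Qed.

End Convolution.

(** * Traces over a ring of loops *)

Section Frames.
Variables (C : numClosedFieldType) (isR : bool) (g : lie_data C).
Variables (s : 'M[C]_(ldim g)) (l : nat).
Hypothesis gS : tau_simple isR g.
Hypothesis sA : fin_aut isR s l.
Local Notation n := (ldim g).
Local Notation V := ('rV[C]_n).
Local Notation L := (loopT g).
Local Notation LC := (@LC C g s l).
Local Notation hom := (@hom C g s l).
Local Notation proj := (@proj C g s l).
Local Notation lin_LC := (@lin_LC C g s l).
Implicit Types (u v w : L) (x y : V).

Variable X : int -> L -> L.

Record unit_op : Prop := UnitOp {
  uo_lin : forall m, lin_LC (X m);
  uo_LC : forall m u, LC u -> LC (X m u);
  uo_K : forall m u, LC u -> X m (X (- m) u) = u }.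

(* The trace of an operator over the ring generated by [X 1] does not depend on the frame
   used to compute it; here are the coefficients of degree 0 in two such traces. *)
Lemma trace_frames (I J : finType) (T : L -> L) (e : I -> L) (f : J -> L)
    (ec : I -> L -> C^o) (fc : J -> L -> C^o) M :
  unit_op -> lin_LC T -> (forall u, LC u -> LC (T u)) ->
  (forall m u, LC u -> T (X m u) = X m (T u)) ->
  (forall i, LC (e i)) -> (forall j, LC (f j)) ->
  (forall i, lin_LC (ec i)) -> (forall j, lin_LC (fc j)) ->
  (forall j, f j = \sum_(m <- zrange M) \sum_i ec i (X (- m) (f j)) *: X m (e i)) ->
  (forall i, T (e i) = \sum_(m <- zrange M) \sum_j fc j (X (- m) (T (e i))) *: X m (f j)) ->
  \sum_i ec i (T (e i)) = \sum_j fc j (T (f j)).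
Proof.
move=> [XL XLC XK] TL TLC TX eL fL ecL fcL He Hf.
have sumLC (K : finType) (F : int -> K -> L) : (forall m k, LC (F m k)) ->
    forall m, LC (\sum_k F m k).
  by move=> hF m; apply: big_ind => //; [exact: LC0|move=> *; exact: LCD].
have sumZ (W : lmodType C) (E : L -> W) (K : finType) (c : int -> K -> C) (F : int -> K -> L) :
    lin_LC E -> (forall m k, LC (F m k)) ->
    E (\sum_(m <- zrange M) \sum_k c m k *: F m k) = \sum_(m <- zrange M) \sum_k c m k *: E (F m k).
  move=> EL hF; rewrite (lin_LC_sum EL); last by apply: sumLC => m k; apply: LCZ.
  apply: eq_bigr => m _; rewrite (lin_LC_sum EL); last by move=> k; apply: LCZ.
  by apply: eq_bigr => k _; rewrite (lin_LCZ EL).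
transitivity (\sum_(m <- zrange M) \sum_i \sum_j fc j (X (- m) (T (e i))) * ec i (X m (f j))).
  rewrite exchange_big; apply: eq_bigr => i _ /=; rewrite {1}Hf sumZ //.
  by move=> m j; apply: XLC.
(* The double sum is symmetric in the two frames up to replacing m by -m; this is tr (AB) = tr
   (BA). *)
rewrite -sum_zrangeN /=; under eq_bigr do rewrite exchange_big.
rewrite exchange_big; apply: eq_bigr => j _ /=; rewrite [in RHS]He [T _]sumZ //; last first.
  by move=> m i; apply: XLC.
rewrite sumZ //; last by move=> m i; apply/TLC/XLC.
apply: eq_bigr => m _; apply: eq_bigr => i _.
by rewrite opprK TX // mulrC.
Qed.

Variable d : int.
Hypothesis d0 : d != 0.
Hypothesis XU : unit_op.
Hypothesis Xhom : forall m k x, hom k x -> forall j, j != k + d * m -> X m (mono k x) j = 0.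

Lemma unit_op_mono m k x : hom k x -> X m (mono k x) = mono (k + d * m) (X m (mono k x) (k + d * m)).
Proof.
move=> hx; apply/funext => j; rewrite [RHS]/mono; case: eqP => [->//|/eqP]; exact: Xhom.
Qed.

Lemma unit_op_comp m k v : LC v ->
  X m (mono k (X (- m) v k)) = mono (k + d * m) (v (k + d * m)).
Proof.
move: v; pose E v := X m (mono k (X (- m) v k)); pose F v := mono (k + d * m) (v (k + d * m)).
have FL : lin_LC F by move=> a u v _ _; rewrite /F loop_linE monoD monoZ.
have EL : lin_LC E.
  move=> a u v hu hv; rewrite /E (uo_lin XU) // loop_linE monoD monoZ (uo_lin XU) //;
  exact/LC_comp/(uo_LC XU).
apply: (lin_LC_ext EL FL) => j x hx; rewrite /E /F.
have e1 : k + d * m + d * - m = k by lia.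
have [jk|kj] := eqVneq j (k + d * m).
  subst j; have := unit_op_mono (- m) hx; rewrite e1 => <-.
  by rewrite (uo_K XU) ?/mono ?eqxx //; apply: LC_mono.
rewrite (@Xhom _ _ _ hx) ?mono0 ?(lin_LC0 (uo_lin XU m)); last by lia.
by rewrite /mono eq_sym (negPf kj); apply/funext => i; case: ifP.
Qed.

(** The |d| degrees starting at [k0] are a fundamental domain for translation by [d], so these
    vectors generate all loops under the operators [X m]. Being projections of a basis, they may be
    dependent; with [frame_coord] they still satisfy the expansion formula, which is all that
    [trace_frames] asks. *)
Definition frame_vec (k0 : int) (ri : 'I_`|d|%N * 'I_n) : L :=
  mono (k0 + ri.1%:Z) (delta_mx 0 ri.2 *m proj (k0 + ri.1%:Z)).
Definition frame_coord (k0 : int) (ri : 'I_`|d|%N * 'I_n) (u : L) : C^o :=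
  u (k0 + ri.1%:Z) 0 ri.2.

Lemma frame_vecLC k0 ri : LC (frame_vec k0 ri).
Proof. by apply/LC_mono/(proj_hom sA). Qed.

Lemma frame_coord_lin k0 ri : lin_LC (frame_coord k0 ri).
Proof. by move=> a u v _ _; rewrite /frame_coord loop_linE mxD mxZ. Qed.

Lemma frame_expand k0 v : LC v -> exists M0, forall M, (M0 <= M)%N ->
  v = \sum_(m <- zrange M) \sum_ri frame_coord k0 ri (X (- m) v) *: X m (frame_vec k0 ri).
Proof.
(* Dividing j - k0 by [d] yields a quotient of absolute value at most |j - k0| + 1, hence this bound
   on [m]. *)
move=> hv; have [[N hN] hvk] := hv; exists (N + `|k0| + 1)%N => M hM.
transitivity (\sum_(m <- zrange M) \sum_(r < `|d|%N)
    mono (k0 + r%:Z + d * m) (v (k0 + r%:Z + d * m))); last first.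
  apply: eq_bigr => m _; pose G r i := frame_coord k0 (r, i) (X (- m) v) *: X m (frame_vec k0 (r, i)).
  rewrite [RHS](eq_bigr (fun ri => G ri.1 ri.2)); last by case.
  rewrite -(pair_bigA _ G) /=.
  apply: eq_bigr => r _; rewrite -unit_op_comp //; set k := k0 + r%:Z.
  have hy := (uo_LC XU (- m) hv).2 k; rewrite -{1}(proj_id sA hy).
  rewrite {1}[X (- m) v k]row_sum_delta mulmx_suml.
  have -> : mono k (\sum_(i < n) (X (- m) v k 0 i *: delta_mx 0 i) *m proj k) =
     \sum_(i < n) X (- m) v k 0 i *: frame_vec k0 (r, i).
    apply/funext => j; rewrite fct_sumE /mono; case: ifP => jk.
      by apply: eq_bigr => i _; rewrite -scalemxAl -monoZ /frame_vec /= /mono jk.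
    by rewrite big1 // => i _; rewrite -monoZ /mono /= jk.
  rewrite (lin_LC_sum (uo_lin XU m)); last by move=> i; apply/LCZ/frame_vecLC.
  by apply: eq_bigr => i _; rewrite (lin_LCZ (uo_lin XU m)) //; apply: frame_vecLC.
apply/funext => j; rewrite fct_sumE.
under eq_bigr do rewrite fct_sumE.
have jE := divz_eq (j - k0) d.
have r0 := modz_ge0 (j - k0) d0; have rd := ltz_mod (j - k0) d0.
set q := divz _ _ in jE; set r := modz _ _ in jE r0 rd.
have rl : (`|r| < `|d|)%N by lia.
have uniqmr m (r' : 'I_`|d|%N) : j = k0 + r'%:Z + d * m -> m = q /\ r'%:Z = r.
  move=> jm; have rd' := ltn_ord r'.
  have e : j - k0 = m * d + r'%:Z by lia.
  have e2 : m = q by rewrite /q e divzMDl // divz_small ?addr0 //; lia.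
  by split=> //; move: e; rewrite jE e2; lia.
have [jM|jM] := leqP `|q| M; last first.
  rewrite big_seq big1 => [|m mM].
    apply: hN; rewrite ltnNge; apply/negP => jN; move: jM; rewrite ltnNge => /negP; apply.
    have h : (`|q| * `|d| <= `|(j - k0)%R| + `|d|)%N by rewrite -abszM; lia.
    have qle : (`|q| <= `|(j - k0)%R| + 1)%N by move: h rl; clear; nia.
    by lia.
  rewrite big1 // => r' _; rewrite /mono; case: eqP => // /uniqmr[mq _].
  by rewrite mq mem_zrange leqNgt jM in mM.
rewrite (@big_supp1 _ _ _ q) ?zrange_uniq ?mem_zrange // => [|m mq]; last first.
  by rewrite big1 // => r' _; rewrite /mono; case: eqP => // /uniqmr[/eqP]; rewrite (negPf mq).
rewrite (bigD1 (Ordinal rl)) //= big1 ?addr0 => [|r' nr]; last first.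
  rewrite /mono; case: eqP => // /uniqmr[_ h]; case/eqP: nr; apply: val_inj => /=; lia.
rewrite /mono; case: eqP => [<- //|[]]; lia.
Qed.

End Frames.

(** * Isomorphisms of loop algebras *)

Record loop_mor (C : numClosedFieldType) (isR : bool) (g h : lie_data C)
    (s : 'M[C]_(ldim g)) (l : nat) (sh : 'M[C]_(ldim h)) (lh : nat)
    (f : loopT g -> loopT h) : Prop := LoopMor {
  lm_lin : @lin_LC C g s l _ f;
  lm_LC : forall u, LC s l u -> LC sh lh (f u);
  lm_br : forall u v, LC s l u -> LC s l v -> f (lpbr u v) = lpbr (f u) (f v);
  lm_tau : isR -> forall u, LC s l u -> f (tau u) = tau (f u) }.

(** * The centroid *)

Section Centroid.
Variables (C : numClosedFieldType) (isR : bool) (g : lie_data C).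
Hypothesis gS : tau_simple isR g.
Local Notation n := (ldim g).
Local Notation V := ('rV[C]_n).

Definition centroid (A : 'M[C]_n) := forall x y : V, gbr x y *m A = gbr x (y *m A).

Lemma centroidl A (x y : V) : centroid A -> gbr x y *m A = gbr (x *m A) y.
Proof. by move=> cA; rewrite (ts_skew gS) mulNmx cA (ts_skew gS) opprK. Qed.

(** On a bracket, [A] can act on one argument and [B] on the other, so the order does not matter
    there; brackets span. *)
Lemma centroidC A B : centroid A -> centroid B -> A *m B = B *m A.
Proof.
move=> cA cB; apply/row_matrixP => i; rewrite !rowE; move: (delta_mx 0 i) => x.
elim/(bracket_span gS): x => [|x y hx hy|x y]; first by rewrite !mul0mx.
  by rewrite !mulmxDl hx hy.
by rewrite !mulmxA cA centroidl // -cA -(centroidl x) //.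
Qed.
End Centroid.

(** * The operator X on the target *)

Section Transport.
Variables (C : numClosedFieldType) (isR : bool) (g h : lie_data C).
Variables (s : 'M[C]_(ldim g)) (l : nat) (sh : 'M[C]_(ldim h)) (lh : nat).
Hypotheses (gS : tau_simple isR g) (hS : tau_simple isR h).
Hypotheses (sA : fin_aut isR s l) (shA : fin_aut isR sh lh).
Variables (phi : loopT g -> loopT h) (psi : loopT h -> loopT g).
Hypotheses (phiM : loop_mor isR s l sh lh phi) (psiM : loop_mor isR sh lh s l psi).
Hypotheses (phiK : forall u, LC s l u -> psi (phi u) = u)
           (psiK : forall v, LC sh lh v -> phi (psi v) = v).
Local Notation LCg := (LC s l).
Local Notation LCh := (LC sh lh).

Definition conj_shift (m : int) (v : loopT h) : loopT h := phi (shift (l%:Z * m) (psi v)).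
Local Notation X := conj_shift.

Lemma X_unit_op : unit_op sh lh X.
Proof.
split=> [m a u v hu hv|m u hu|m u hu].
- by rewrite /X (lm_lin psiM) // shift_lin (lm_lin phiM) //; apply/(LC_shift sA)/(lm_LC psiM).
- by apply/(lm_LC phiM)/(LC_shift sA)/(lm_LC psiM).
- rewrite /X phiK; last by apply/(LC_shift sA)/(lm_LC psiM).
  by rewrite shiftA mulrN addNr shift0 psiK.
Qed.

Lemma X_br m u v : LCh u -> LCh v -> X m (lpbr u v) = lpbr u (X m v).
Proof.
move=> hu hv; rewrite /X (lm_br psiM) // -lpbr_shiftr (lm_br phiM) ?psiK //.
  exact: (lm_LC psiM).
by apply/(LC_shift sA)/(lm_LC psiM).
Qed.

Lemma X_brl m u v : LCh u -> LCh v -> X m (lpbr u v) = lpbr (X m u) v.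
Proof.
move=> hu hv; have [XL XLC _] := X_unit_op; have [fu fv] := (hu.1, hv.1).
rewrite (lpbrC hS) // -scaleN1r (lin_LCZ (XL m)); last exact: (LC_br shA).
by rewrite X_br // scaleN1r (lpbrC hS) ?opprK //; apply: (XLC m u hu).1.
Qed.

(** On a bracket, [X] can be moved to the first argument and the shift to the second; perfectness
    does the rest. *)
Lemma X_shift m k u : LCh u -> X m (shift (lh%:Z * k) u) = shift (lh%:Z * k) (X m u).
Proof.
have [XL XLC _] := X_unit_op.
elim/(loop_bracket_span hS shA) => [|{}u v hu hv eu ev|{}u v hu hv].
- by rewrite (lin_LC0 (XL m)).
- have -> : shift (lh%:Z * k) (u + v) = shift (lh%:Z * k) u + shift (lh%:Z * k) v by [].
  rewrite !(lin_LCD (XL m)) //; try exact: (LC_shift shA).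
  by rewrite eu ev.
rewrite -lpbr_shiftr X_brl //; last exact: (LC_shift shA).
by rewrite X_brl // -lpbr_shiftr.
Qed.

(** Conjugating multiplication by e^{imt} gives multiplication by e^{-imt}, and both isomorphisms
    commute with [tau]. *)
Lemma X_tau m u : isR -> LCh u -> X m (tau u) = tau (X (- m) u).
Proof.
move=> R hu; have hp := lm_LC psiM hu.
rewrite /X (lm_tau psiM R hu) -(lm_tau phiM R); last exact: (LC_shift sA).
congr phi; apply/funext => k; rewrite /tau /shift; congr (_^cj); congr (psi u _); lia.
Qed.

Lemma X_matrix : exists (d : int) (a b : 'M[C]_(ldim h)), [/\ a *m b = 1, b *m a = 1,
  forall k x, hom sh lh k x -> X 1 (mono k x) = mono (k + d) (x *m a) &
  forall k x, hom sh lh k x -> X (- 1) (mono k x) = mono (k - d) (x *m b)].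
Proof.
have [XL XLC XK] := X_unit_op.
have [N1 [e [eN he]]] := conv_rep shA (XL 1) (XLC 1) (X_shift 1).
have [N2 [f [fN hf]]] := conv_rep shA (XL (-1)) (XLC (-1)) (X_shift (-1)).
have cen m (E : int -> 'M[C]_(ldim h)) :
    (forall k x, hom sh lh k x -> forall j, X m (mono k x) j = x *m E (j - k)) ->
    forall j, centroid (E j).
  move=> hE j; elim/(hom_ind shA) => [x x' hx hx' y|p x hx].
    by rewrite !gbrDl mulmxDl hx hx'.
  elim/(hom_ind shA) => [y y' hy hy'|q y hy].
    by rewrite mulmxDl !gbrDr mulmxDl hy hy'.
  have := congr1 (fun w => w (p + q + j)) (X_br m (LC_mono hx) (LC_mono hy)).
  rewrite lpbr_mono hE; last exact: (hom_br shA).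
  rewrite addrAC subrr add0r lpbr_monol hE // => ->.
  by congr (gbr _ (_ *m E _)); lia.
have ce := cen _ _ he; have cf := cen _ _ hf.
pose N := maxn N1 N2.
have eN' m : (N < `|m|)%N -> e m = 0 by move=> ?; apply: eN; lia.
have fN' m : (N < `|m|)%N -> f m = 0 by move=> ?; apply: fN; lia.
have ef (x : 'rV[C]_(ldim h)) j : \sum_(m <- zrange N) x *m e m *m f (j - m) = (j == 0)%:R *: x.
  elim/(hom_ind shA): x => [x y hx hy|k x hx].
    by rewrite scalerDr -hx -hy -big_split; apply: eq_bigr => m _; rewrite !mulmxDl.
  have hM := LC_mono hx.
  have [Y0 homY] := XLC 1 _ hM.
  have supY : supp_in (N + `|k|) (X 1 (mono k x)).
    by move=> i hi; rewrite he // eN' ?mulmx0 //; lia.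
  have := congr1 (fun w => w (k + j)) (XK (-1) _ hM); rewrite opprK.
  rewrite [in X in X -> _](mono_sum supY) (lin_LC_sum (XL (-1))); last by move=> i; apply: LC_mono.
  rewrite fct_sumE => e1.
  transitivity (mono k x (k + j)); last first.
    rewrite /mono (_ : (k + j == k) = (j == 0)); last by lia.
    by case: eqP => _; rewrite ?scale1r ?scale0r.
  rewrite -e1; under [RHS]eq_bigr do rewrite hf // he //.
  pose G i := x *m e (i - k) *m f (k + j - i).
  transitivity (\sum_(m <- zrange N) G (k + m)).
    by apply: eq_bigr => m _; congr (_ *m e _ *m f _); lia.
  rewrite -(big_map (fun m => k + m) xpredT G); apply: big_supp => [||i Gi|i Gi].
  - by rewrite map_inj_uniq ?zrange_uniq //; apply: addrI.
  - exact: zrange_uniq.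
  - apply/mapP; exists (i - k); last by lia.
    rewrite mem_zrange leqNgt; apply: contraNN Gi => /eN'.
    by rewrite /G => ->; rewrite mulmx0 mul0mx.
  - rewrite mem_zrange leqNgt; apply: contraNN Gi => hi.
    by rewrite /G eN' ?mulmx0 ?mul0mx //; lia.
have n0 : (0 < ldim h)%N.
  rewrite lt0n; apply/negP => /eqP n0; have [x [y]] := ts_nab hS.
  by move: (gbr x y); rewrite n0 => z; rewrite thinmx0 eqxx.
pose As := [seq e m | m <- zrange N] ++ [seq f m | m <- zrange N].
have cAs A : A \in As -> centroid A.
  by rewrite mem_cat => /orP[] /mapP[m _ ->].
(* The coefficients commute, and on a common eigenvector [e] and [f] become scalar Laurent
   polynomials inverse to each other. This singles out the degree [d]. *)
have [|v v0 /allP stv] := @common_eigenvector _ _ As n0.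
  by move=> A B hA hB; apply: (centroidC hS); apply: cAs.
have eig (E : int -> 'M[C]_(ldim h)) : (forall m, (N < `|m|)%N -> E m = 0) ->
    (forall m, m \in zrange N -> E m \in As) ->
    {chi : int -> C & forall m, v *m E m = chi m *: v}.
  move=> EN hE; apply: (@choice _ _ (fun m c => v *m E m = c *: v)) => m.
  have [mN|mN] := leqP `|m| N; last by exists 0; rewrite EN // mulmx0 scale0r.
  have /stv/eigenvectorP[a ha] : E m \in As by apply: hE; rewrite mem_zrange.
  by exists a; apply/eigenspaceP.
have [|chi hchi] := eig e eN'.
  by move=> m mN; rewrite mem_cat map_f.
have [|psi' hpsi] := eig f fN'.
  by move=> m mN; rewrite mem_cat map_f ?orbT.
have sc a : a *: v = 0 -> a = 0 by move/eqP; rewrite scaler_eq0 (negPf v0) orbF => /eqP.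
have [|||d [chi0 psi0]] := @laurent_unit _ chi psi' N.
- by move=> m mN; apply: sc; rewrite -hchi eN' ?mulmx0.
- by move=> m mN; apply: sc; rewrite -hpsi fN' ?mulmx0.
- move=> j; apply/eqP; rewrite -subr_eq0; apply/eqP/sc; rewrite scalerBl -ef scaler_suml.
  rewrite -sumrB big1 // => m _.
  by rewrite hchi -scalemxAl hpsi scalerA subrr.
(* Conditions on both [e] and [f] are imposed because conjugation exchanges [e m] with [f (- m)];
   only together do they define a conjugation-stable ideal. *)
pose I (x : 'rV[C]_(ldim h)) := (forall m, m != d -> x *m e m = 0) /\
  (forall m, m != - d -> x *m f m = 0).
have Iall x : I x.
  apply: (ts_simple hS (I := I)) => [a y z [ey fy] [ez fz]|y z [ez fz]|R y [ey fy]|].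
  - by split=> m hm; rewrite mulmxDl -scalemxAl ?ey ?ez ?fy ?fz // scaler0 addr0.
  - by split=> m hm; rewrite ?ce ?cf ?ez ?fz // gbr0r.
  - have cj m (E F : int -> 'M[C]_(ldim h)) :
        (forall k x, hom sh lh k x -> forall j, X m (mono k x) j = x *m E (j - k)) ->
        (forall k x, hom sh lh k x -> forall j, X (- m) (mono k x) j = x *m F (j - k)) ->
        forall j (z : 'rV[C]_(ldim h)), (z *m E j)^cj = z^cj *m F (- j).
      move=> hE hF j z; elim/(hom_ind shA): z => [z z' hz hz'|k z hz].
        by rewrite mulmxDl !map_mxD mulmxDl hz hz'.
      have hz' := hom_cj shA R hz.
      have := congr1 (fun w => w (- k - j)) (X_tau (- m) R (LC_mono hz)).
      rewrite opprK tau_mono hF // /tau hE // => e1.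
      rewrite (_ : - j = - k - j - - k) ?e1; last by lia.
      by congr ((_ *m E _)^cj); lia.
    split=> m hm.
      by rewrite -[m]opprK -(cj (-1) f e) // fy ?map_mx0 //; lia.
    by rewrite -[m]opprK -(cj 1 e f) // ey ?map_mx0 //; lia.
  - exists v => //; split=> m hm; [rewrite hchi chi0|rewrite hpsi psi0] => //; exact: scale0r.
have e0 m : m != d -> e m = 0.
  by move=> hm; apply/row_matrixP => i; rewrite rowE row0; apply: (Iall _).1.
have f0 m : m != - d -> f m = 0.
  by move=> hm; apply/row_matrixP => i; rewrite rowE row0; apply: (Iall _).2.
have ab : e d *m f (- d) = 1.
  apply/row_matrixP => i; rewrite !rowE mulmx1 mulmxA.
  have := ef (delta_mx 0 i) 0; rewrite eqxx scale1r => efi; rewrite -[RHS]efi.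
  have [dN|dN] := leqP `|d| N.
    rewrite (@big_supp1 _ _ _ d) ?zrange_uniq ?mem_zrange // ?sub0r // => m hm.
    by rewrite e0 ?mulmx0 ?mul0mx.
  rewrite eN' // mulmx0 mul0mx big1 // => m _.
  have [->|/e0->] := eqVneq m d; first by rewrite eN' ?mulmx0 ?mul0mx.
  by rewrite mulmx0 mul0mx.
exists d, (e d), (f (- d)); split=> // [|k x hx|k x hx].
- exact: mulmx1C.
- apply/funext => j; rewrite he // /mono; case: eqP => [->|/eqP jd].
    by congr (_ *m e _); lia.
  by rewrite e0 ?mulmx0 //; lia.
- apply/funext => j; rewrite hf // /mono; case: eqP => [->|/eqP jd].
    by congr (_ *m f _); lia.
  by rewrite f0 ?mulmx0 //; lia.
Qed.

End Transport.

Lemma sum_period (R : zmodType) (f : nat -> R) p r : (forall k, f (k + p)%N = f k) ->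
  \sum_(k < p) f (k + r)%N = \sum_(k < p) f k.
Proof.
move=> fp; elim: r => [|r IH]; first by apply: eq_bigr => k _; rewrite addn0.
have e1 : \sum_(k < p.+1) f (k + r)%N = f r + \sum_(k < p) f (k + r.+1)%N.
  rewrite big_ord_recl add0n; congr (_ + _); apply: eq_bigr => k _.
  by rewrite lift0 addSnnS.
apply: (@addrI _ (f r)); rewrite -e1 -IH big_ord_recr /= addrC.
by rewrite addnC fp.
Qed.

(** * The degree of X and the transported derivative *)

Section Transport.
Variables (C : numClosedFieldType) (isR : bool) (g h : lie_data C).
Variables (s : 'M[C]_(ldim g)) (l : nat) (sh : 'M[C]_(ldim h)) (lh : nat).
Hypotheses (gS : tau_simple isR g) (hS : tau_simple isR h).
Hypotheses (sA : fin_aut isR s l) (shA : fin_aut isR sh lh).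
Variables (phi : loopT g -> loopT h) (psi : loopT h -> loopT g).
Hypotheses (phiM : loop_mor isR s l sh lh phi) (psiM : loop_mor isR sh lh s l psi).
Hypotheses (phiK : forall u, LC s l u -> psi (phi u) = u)
           (psiK : forall v, LC sh lh v -> phi (psi v) = v).
Local Notation LCg := (LC s l).
Local Notation LCh := (LC sh lh).
Local Notation X := (conj_shift l phi psi).
Let XU : unit_op sh lh X := X_unit_op sA phiM psiM phiK psiK.
Let XL := uo_lin XU.
Let XLC := uo_LC XU.

Lemma XD m p v : LCh v -> X m (X p v) = X (p + m) v.
Proof.
move=> hv; rewrite /X phiK ?shiftA -?mulrDr //.
by apply/(LC_shift sA)/(lm_LC psiM).
Qed.

Lemma X_phi m u : LCg u -> X m (phi u) = phi (shift (l%:Z * m) u).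
Proof. by move=> hu; rewrite /X phiK. Qed.

Lemma psi_X m v : LCh v -> psi (X m v) = shift (l%:Z * m) (psi v).
Proof. by move=> hv; rewrite /X phiK //; apply/(LC_shift sA)/(lm_LC psiM). Qed.

Lemma hom_of_LC (k : int) y : LCh (mono k y) -> hom sh lh k y.
Proof. by move=> [_ /(_ k)]; rewrite /mono eqxx. Qed.

Lemma X_degree : exists d : int, d != 0 /\
  forall m k x, hom sh lh k x -> exists2 y, hom sh lh (k + d * m) y & X m (mono k x) = mono (k + d * m) y.
Proof.
have [d [a [b [ab ba Xa Xb]]]] := X_matrix gS hS sA shA phiM psiM phiK psiK.
have Xnat (q : bool) (m : nat) k x : hom sh lh k x -> exists2 y,
    hom sh lh (k + d * ((-1) ^+ q * m%:Z)) y & X ((-1) ^+ q * m%:Z) (mono k x) = mono (k + d * ((-1) ^+ q * m%:Z)) y.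
  move=> hx; elim: m => [|m [y hy IH]].
    exists x; rewrite !mulr0 addr0 // /X mulr0 shift0 psiK //; exact: LC_mono.
  have -> : (-1) ^+ q * m.+1%:Z = (-1) ^+ q * m%:Z + (-1) ^+ q by rewrite -addn1 PoszD mulrDr mulr1.
  rewrite mulrDr addrA -XD; last exact: LC_mono.
  rewrite IH; case: q hy {IH} => hy /=.
    have e := Xb _ _ hy; exists (y *m b); last by rewrite e expr1 mulrN1.
    by apply: hom_of_LC; rewrite mulrN1 -e; apply/XLC/LC_mono.
  have e := Xa _ _ hy; exists (y *m a); last by rewrite e expr0 mulr1.
  by apply: hom_of_LC; rewrite mulr1 -e; apply/XLC/LC_mono.
exists d; split; last first.
  move=> m k x hx; case: m => m; first by have := Xnat false m k x hx; rewrite expr0 mul1r.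
  by have := Xnat true m.+1 k x hx; rewrite expr1 mulN1r NegzE.
(* If [d] were 0, [X 1] would preserve degrees and have an eigenvector in some degree [k]. Its
   preimage [u] satisfies e^{it} u = c u, so each coefficient of [u] is a multiple of coefficients
   arbitrarily far out, and these are 0. *)
apply/eqP => d0; subst d.
have n0 : (0 < ldim h)%N.
  rewrite lt0n; apply/negP => /eqP n0; have [x [y]] := ts_nab hS.
  by move: (gbr x y); rewrite n0 => z; rewrite thinmx0 eqxx.
have [c /eigenvalueP[v va v0]] := eigenvalue_closed a n0.
have [k vk] : exists k : 'I_lh, v *m proj sh lh k%:Z != 0.
  apply/existsP; apply: contraNT v0; rewrite negb_exists => /forallP h0.
  rewrite (proj_dec shA v) big1 // => k _; apply/eqP; have := h0 k; exact: negbNE.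
have ahom j x : hom sh lh j x -> hom sh lh j (x *m a).
  by move=> hx; apply: hom_of_LC; rewrite -[j]addr0 -Xa //; apply/XLC/LC_mono.
have pa j (x : 'rV_(ldim h)) : x *m a *m proj sh lh j = x *m proj sh lh j *m a.
  elim/(hom_ind shA): x => [x x' hx hx'|i x hx]; first by rewrite !mulmxDl hx hx'.
  have [eij|eij] := eqVneq (eps C lh ^ i) (eps C lh ^ j); last first.
    by rewrite !(proj_eq0 shA _ eij) ?mul0mx //; apply: ahom.
  have h1 : hom sh lh j x by rewrite /hom -eij.
  by rewrite !(proj_id shA) //; apply: ahom.
set w := v *m proj sh lh k%:Z in vk.
have wa : w *m a = c *: w by rewrite /w -pa va -scalemxAl.
have hw : hom sh lh k%:Z w by apply: (proj_hom shA).
have hM := LC_mono hw; pose u := psi (mono k%:Z w).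
have hu : LCg u by apply: (lm_LC psiM).
have su : shift (l%:Z * 1) u = c *: u.
  by rewrite /u -psi_X // Xa // addr0 wa monoZ (lin_LCZ (lm_lin psiM)).
have [[N hN] _] := hu.
have us (j : nat) i : u i = c ^+ j *: u (i + l%:Z * j%:Z).
  elim: j => [|j ->]; first by rewrite expr0 scale1r mulr0 addr0.
  rewrite exprSr -scalerA; congr (_ *: _).
  have e1 : shift (l%:Z * 1) u (i + l%:Z * j.+1%:Z) = c *: u (i + l%:Z * j.+1%:Z).
    by rewrite su.
  by rewrite -e1 /shift; congr (u _); lia.
have u0 : u = 0.
  apply/funext => i; rewrite (us (N + `|i| + 1)%N i) hN ?scaler0 //.
  have := fa_gt0 sA; nia.
have := psiK hM; rewrite -/u u0 (lin_LC0 (lm_lin phiM)) => /(congr1 (fun f => f k%:Z)).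
by rewrite /mono eqxx => w0; rewrite -w0 eqxx in vk.
Qed.

Variable d : int.
Hypothesis d0 : d != 0.
Hypothesis Xd : forall m k x, hom sh lh k x ->
  exists2 y, hom sh lh (k + d * m) y & X m (mono k x) = mono (k + d * m) y.

Lemma derL_X m v : LCh v ->
  derL lh (X m v) = X m (derL lh v) + ('i * (d * m)%:~R / lh%:R) *: X m v.
Proof.
move: v; apply: (@lin_LC_ext C h sh lh _ (fun v => derL lh (X m v)) (fun v => X m (derL lh v) + ('i * (d * m)%:~R / lh%:R) *: X m v)).
- by move=> a u v hu hv; rewrite XL // derL_lin.
- move=> a u v hu hv; rewrite derL_lin !XL //; try exact: LC_der.
  by rewrite !scalerDr !scalerA mulrC addrACA.
- move=> k x hx; have [y hy e] := Xd m hx.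
  rewrite derL_mono (lin_LCZ (XL m)) ?e ?derL_mono -?scalerDl; last exact: LC_mono.
  by congr (_ *: _); rewrite intrD; ring.
Qed.

Let al : C := d%:~R / lh%:R.
(** [X m] raises degrees by d m in units of 1/lh, while its counterpart on the source multiplies by
    e^{imt}; [al] = d/lh is the ratio for which the terms from differentiating e^{imt} cancel. *)
Definition der_diff (u : loopT g) : loopT g := psi (derL lh (phi u)) - al *: derL l u.

Lemma der_diff_lin : lin_LC s l der_diff.
Proof.
move=> a u v hu hv; rewrite /der_diff (lm_lin phiM) // !derL_lin (lm_lin psiM).
- rewrite scalerBr [al *: _]scalerDr !scalerA [al * a]mulrC opprD.
  by rewrite addrACA.
- exact/LC_der/(lm_LC phiM).
- exact/LC_der/(lm_LC phiM).
Qed.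

Lemma der_diff_LC u : LCg u -> LCg (der_diff u).
Proof.
move=> hu; rewrite /der_diff addrC -scaleNr; apply: LC_lin; first exact: LC_der.
by apply/(lm_LC psiM)/LC_der/(lm_LC phiM).
Qed.

Lemma der_diff_shift m u : LCg u ->
  der_diff (shift (l%:Z * m) u) = shift (l%:Z * m) (der_diff u).
Proof.
move=> hu; have hp := lm_LC phiM hu.
rewrite /der_diff -X_phi // derL_X // (lin_LCD (lm_lin psiM)); first last.
- by apply/LCZ/XLC.
- by apply/XLC/LC_der.
rewrite (lin_LCZ (lm_lin psiM)); last exact: XLC.
rewrite !psi_X //; last exact: LC_der.
rewrite phiK // (derL_shift _ _ (fa_gt0 sA)) scalerDr opprD addrACA scalerA.
rewrite -scalerBl (_ : 'i * _ / _ - al * ('i * m%:~R) = 0) ?scale0r ?addr0 //.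
by rewrite /al intrM; ring.
Qed.

Lemma der_diff_br u v : LCg u -> LCg v ->
  der_diff (lpbr u v) = lpbr (der_diff u) v + lpbr u (der_diff v).
Proof.
move=> hu hv; have [hpu hpv] := (lm_LC phiM hu, lm_LC phiM hv).
have [fu fv] := (hu.1, hv.1).
have [hdu hdv] := (LC_der hpu, LC_der hpv).
rewrite /der_diff (lm_br phiM) // derL_br; try exact: hpu.1; try exact: hpv.1.
rewrite (lin_LCD (lm_lin psiM)); try exact: (LC_br shA).
rewrite !(lm_br psiM) // !phiK // derL_br //.
set a := psi _; set b := psi _.
have fa : finsupp a by apply: (lm_LC psiM _).1.
have ea : a - al *: derL l u = (- al) *: derL l u + a by rewrite addrC scaleNr.
have eb : b - al *: derL l v = (- al) *: derL l v + b by rewrite addrC scaleNr.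
rewrite ea eb lpbr_linl //; last exact: finsupp_der.
rewrite lpbr_linr // !scaleNr scalerDr opprD.
by rewrite [RHS]addrACA [RHS]addrC.
Qed.

Lemma der_diff_tau u : isR -> LCg u -> der_diff (tau u) = tau (der_diff u).
Proof.
move=> R hu; have hp := lm_LC phiM hu; have hd := LC_der hp.
rewrite /der_diff (lm_tau phiM) // -tau_der (lm_tau psiM) // -tau_der.
rewrite addrC -scaleNr [_ - _ in RHS]addrC -[in RHS]scaleNr tau_lin.
by rewrite /al rmorphN fmorph_div rmorph_int rmorph_nat.
Qed.

(** The matrix coefficients of [der_diff] are derivations, hence inner. The center is 0, so the
    elements inducing them are unique; uniqueness makes [w] twisted, finitely supported and real. *)
Lemma der_conj_inner : exists w, [/\ LCg w, isR -> tau w = w &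
  forall u, LCg u -> derL lh (phi u) = phi (al *: derL l u + lpbr w u)].
Proof.
have [N [e [eN he]]] := conv_rep sA der_diff_lin der_diff_LC der_diff_shift.
have ed m : is_der (e m).
  elim/(hom_ind sA) => [x x' hx hx' y|k x hx].
    by rewrite !(gbrDl, mulmxDl) hx hx' addrACA.
  elim/(hom_ind sA) => [y y' hy hy'|j y hy].
    by rewrite !(gbrDr, mulmxDl) hy hy' addrACA.
  have fE i z (hz : hom s l i z) : finsupp (der_diff (mono i z)) := (der_diff_LC (LC_mono hz)).1.
  have e1 : lpbr (der_diff (mono k x)) (mono j y) (k + j + m) = gbr (x *m e m) y.
    rewrite (lpbrC gS) ?lpbr_monol //; [|exact: fE|exact: finsupp_mono].
    rewrite [LHS](_ : _ = - gbr y (der_diff (mono k x) (k + j + m - j))) //.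
    by rewrite (ts_skew gS) opprK he //; congr (gbr (_ *m e _) _); lia.
  have e2 : lpbr (mono k x) (der_diff (mono j y)) (k + j + m) = gbr x (y *m e m).
    by rewrite lpbr_monol he //; congr (gbr _ (_ *m e _)); lia.
  rewrite -e1 -e2; have := congr1 (fun f => f (k + j + m)) (der_diff_br (LC_mono hx) (LC_mono hy)).
  rewrite lpbr_mono he; last exact: (hom_br sA).
  by rewrite addrAC subrr add0r.
have [w hw] : {w : loopT g & forall m x, x *m e m = gbr (w m) x}.
  by apply: (@choice _ _ (fun m w => forall x, x *m e m = gbr w x)) => m; apply: (der_inner gS).
have wE k x j : hom s l k x -> der_diff (mono k x) j = gbr (w (j - k)) x.
  by move=> hx; rewrite he // hw.
have e0 := eps_neq0 sA.
have whom m : hom s l m (w m).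
  apply/eqP; rewrite -subr_eq0; apply/eqP; apply: (centerless gS).
  elim/(hom_ind sA) => [x y hx hy|k x hx]; first by rewrite gbrDr hx hy addr0.
  have [_ /(_ (k + m))] := der_diff_LC (LC_mono hx).
  rewrite wE // /hom addrAC subrr add0r -(fa_br sA) hx gbrZr expfzDr // -scalerA.
  move/(scalerI (expfz_neq0 k e0)) => e1.
  by rewrite gbrDl gbrNl gbrZl e1 subrr.
have fw : finsupp w.
  exists N => m mN; apply: (centerless gS) => y.
  by rewrite -hw eN // mulmx0.
have hwL : LCg w by [].
exists w; split=> // [R|u hu].
  apply/funext => m; rewrite /tau; apply/eqP; rewrite -subr_eq0; apply/eqP; apply: (centerless gS).
  elim/(hom_ind sA) => [x y hx hy|k x hx]; first by rewrite gbrDr hx hy addr0.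
  have hx' := hom_cj sA R hx.
  have := congr1 (fun f => f (k + m)) (der_diff_tau R (LC_mono hx')).
  rewrite tau_mono opprK cjK /tau !wE // addrAC subrr add0r => e1.
  rewrite gbrDl gbrNl e1 (ts_cj gS R) cjK (_ : - (k + m) - - k = - m) ?subrr //.
  by lia.
have -> : al *: derL l u + lpbr w u = psi (derL lh (phi u)); last first.
  by rewrite psiK //; apply/LC_der/(lm_LC phiM).
have key : der_diff u = lpbr w u.
  apply: (lin_LC_ext der_diff_lin _ _ hu) => [a v v' hv hv'|k x hx].
    by rewrite lpbr_linr.
  rewrite (lpbrC gS) ?lpbr_monol //; last exact: finsupp_mono.
  apply/funext => j; rewrite [RHS](_ : _ = - gbr x (w (j - k))) // wE //.
  by rewrite (ts_skew gS).
by rewrite -key /der_diff addrC subrK.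
Qed.

End Transport.

(** * Comparing invariant forms and dimensions by traces *)

Section Transport.
Variables (C : numClosedFieldType) (isR : bool) (g h : lie_data C).
Variables (s : 'M[C]_(ldim g)) (l : nat) (sh : 'M[C]_(ldim h)) (lh : nat).
Hypotheses (gS : tau_simple isR g) (hS : tau_simple isR h).
Hypotheses (sA : fin_aut isR s l) (shA : fin_aut isR sh lh).
Variables (phi : loopT g -> loopT h) (psi : loopT h -> loopT g).
Hypotheses (phiM : loop_mor isR s l sh lh phi) (psiM : loop_mor isR sh lh s l psi).
Hypotheses (phiK : forall u, LC s l u -> psi (phi u) = u)
           (psiK : forall v, LC sh lh v -> phi (psi v) = v).
Local Notation LCg := (LC s l).
Local Notation LCh := (LC sh lh).
Local Notation X := (conj_shift l phi psi).
Let XU : unit_op sh lh X := X_unit_op sA phiM psiM phiK psiK.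
Let XL := uo_lin XU.
Let XLC := uo_LC XU.

Variable d : int.
Hypothesis d0 : d != 0.
Hypothesis Xd : forall m k x, hom sh lh k x ->
  exists2 y, hom sh lh (k + d * m) y & X m (mono k x) = mono (k + d * m) y.

Lemma shift_unit_op : unit_op s l (fun m => shift (l%:Z * m)).
Proof.
split=> [m a u v _ _|m u|m u hu]; first exact: shift_lin.
  exact: (LC_shift sA).
by rewrite shiftA mulrN addNr shift0.
Qed.

(** Two frames over the same operators: degrees 0 to l - 1 of the source under the shift by [l], and
    the pullback of |d| consecutive degrees of the target, where that shift becomes an operator of
    degree [d]. *)
Lemma trace_window (T : loopT g -> loopT g) k0 : lin_LC s l T ->
  (forall u, LCg u -> LCg (T u)) ->
  (forall m u, LCg u -> T (shift (l%:Z * m) u) = shift (l%:Z * m) (T u)) ->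
  \sum_(k < l) trace_at s l T k%:Z =
  \sum_(r < `|d|) trace_at sh lh (phi \o T \o psi) (k0 + r%:Z).
Proof.
move=> TL TLC TX.
have SU := shift_unit_op.
have Shom m k x : hom s l k x -> forall j, j != k + l%:Z * m -> shift (l%:Z * m) (mono k x) j = 0 :> 'rV_(ldim g).
  by move=> _ j /negPf jk; rewrite shift_mono /mono jk.
have Xhom m k x : hom sh lh k x -> forall j, j != k + d * m -> X m (mono k x) j = 0.
  by move=> hx j /negPf jk; have [y _ ->] := Xd m hx; rewrite /mono jk.
have l0 : l%:Z != 0 by have := fa_gt0 sA; lia.
pose e := @frame_vec C g s l l%:Z 0; pose ec := @frame_coord C g l%:Z 0.
pose f j := psi (@frame_vec C h sh lh d k0 j); pose fc j (u : loopT g) : C^o := @frame_coord C h d k0 j (phi u).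
have eL i : LCg (e i) by apply: (frame_vecLC sA).
have fvL j : LCh (@frame_vec C h sh lh d k0 j) by apply: (frame_vecLC shA).
have fL j : LCg (f j) by apply/(lm_LC psiM).
have [M1 hM1] : {M1 : _ -> nat & forall j M, (M1 j <= M)%N ->
    f j = \sum_(m <- zrange M) \sum_ri ec ri (shift (l%:Z * - m) (f j)) *: shift (l%:Z * m) (e ri)}.
  apply: (@choice _ _ (fun j (M1 : nat) => forall M, (M1 <= M)%N -> f j = \sum_(m <- zrange M) \sum_ri ec ri (shift (l%:Z * - m) (f j)) *: shift (l%:Z * m) (e ri))) => j.
  exact: (frame_expand sA l0 SU Shom 0 (fL j)).
have [M2 hM2] : {M2 : _ -> nat & forall i M, (M2 i <= M)%N ->
    T (e i) = \sum_(m <- zrange M) \sum_rj fc rj (shift (l%:Z * - m) (T (e i))) *: shift (l%:Z * m) (f rj)}.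
  apply: (@choice _ _ (fun i (M2 : nat) => forall M, (M2 <= M)%N -> T (e i) = \sum_(m <- zrange M) \sum_rj fc rj (shift (l%:Z * - m) (T (e i))) *: shift (l%:Z * m) (f rj))) => i.
  have hT := TLC _ (eL i); have hpT := lm_LC phiM hT.
  have [M0 hM] := frame_expand shA d0 XU Xhom k0 hpT; exists M0 => M /hM.
  move=> /(congr1 psi); rewrite phiK // => {1}->.
  have sL m : LCh (\sum_ri @frame_coord C h d k0 ri (X (- m) (phi (T (e i)))) *: X m (@frame_vec C h sh lh d k0 ri)).
    apply: big_ind => [||ri _]; [exact: LC0|exact: LCD|].
    by apply/LCZ/XLC.
  rewrite (lin_LC_sum (lm_lin psiM)) //; apply: eq_bigr => m _.
  rewrite (lin_LC_sum (lm_lin psiM)); last by move=> ri; apply/LCZ/XLC.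
  apply: eq_bigr => rj _; rewrite (lin_LCZ (lm_lin psiM)); last exact: XLC.
  rewrite (psi_X sA psiM phiK) //; congr (_ *: _).
  by rewrite /fc (X_phi phiK).
pose M := maxn (\max_j M1 j) (\max_i M2 i).
transitivity (\sum_i ec i (T (e i))).
  pose G (k : 'I_l) i := (T (mono k%:Z (delta_mx 0 i *m proj s l k%:Z)) k%:Z) 0 i.
  rewrite (pair_bigA _ G) /=; apply: eq_bigr => -[k i] _.
  by rewrite /G /ec /frame_coord /e /frame_vec /= !add0r.
rewrite (@trace_frames C g s l _ _ _ T e f ec fc M SU TL TLC) //.
- pose G (r : 'I_`|d|) i := (phi (T (psi (mono (k0 + r%:Z) (delta_mx 0 i *m proj sh lh (k0 + r%:Z))))) (k0 + r%:Z)) 0 i.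
  rewrite /trace_at (pair_bigA _ G); apply: eq_bigr => -[r i] _.
  by rewrite /G /fc /frame_coord /f /frame_vec /=.
- by move=> i; apply: frame_coord_lin.
- move=> j a u v hu hv; rewrite /fc (lm_lin phiM) //.
  by apply: (@frame_coord_lin C h sh lh d k0 j); apply: (lm_LC phiM).
- by move=> j; apply: hM1; rewrite leq_max leq_bigmax.
- by move=> i; apply: hM2; rewrite leq_max leq_bigmax ?orbT.
Qed.

(** Summing over [lh] consecutive starting points of the window counts every degree modulo [lh]
    exactly |d| times. The last hypothesis makes the block traces on the target periodic. *)
Lemma trace_compare (T : loopT g -> loopT g) : lin_LC s l T ->
  (forall u, LCg u -> LCg (T u)) ->
  (forall m u, LCg u -> T (shift (l%:Z * m) u) = shift (l%:Z * m) (T u)) ->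
  (forall m v, LCh v -> phi (T (psi (shift (lh%:Z * m) v))) = shift (lh%:Z * m) (phi (T (psi v)))) ->
  lh%:R * (\sum_(k < l) trace_at s l T k%:Z) =
  `|d|%N%:R * \sum_(k < lh) trace_at sh lh (phi \o T \o psi) k%:Z.
Proof.
move=> TL TLC TX TX'; pose t (k : nat) := trace_at sh lh (phi \o T \o psi) k%:Z.
have tp k : t (k + lh)%N = t k.
  by rewrite /t PoszD -[lh%:Z]mulr1 (trace_at_period shA) //; apply: TX'.
transitivity (\sum_(k0 < lh) \sum_(r < `|d|) t (k0 + r)%N).
  rewrite mulr_natl -[in LHS](card_ord lh) -sumr_const; apply: eq_bigr => k0 _.
  rewrite (trace_window k0%:Z TL TLC TX); apply: eq_bigr => r _.
  by rewrite /t PoszD.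
rewrite exchange_big /=; under eq_bigr do rewrite (sum_period _ tp).
by rewrite sumr_const card_ord mulr_natl.
Qed.

Lemma formL_compare u v : LCg u -> LCg v ->
  lh%:R * formL u v = `|d|%N%:R * formL (phi u) (phi v).
Proof.
move=> hu hv; have [hpu hpv] := (lm_LC phiM hu, lm_LC phiM hv).
have [fu fv] := (hu.1, hv.1).
rewrite -(trace_ad gS sA hu hv) -(trace_ad hS shA hpu hpv).
rewrite trace_compare.
- congr (_ * _); apply: eq_bigr => k _; apply: eq_bigr => i _.
  set m := mono _ _; have hm : LCh m by apply/LC_mono/(proj_hom shA).
  have hpm := lm_LC psiM hm.
  rewrite /= !(lm_br phiM) ?psiK //; exact: (LC_br sA).
- by move=> a w w' hw hw'; rewrite !lpbr_linr.
- by move=> w hw; do 2!apply: (LC_br sA) => //.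
- by move=> m w hw; rewrite !lpbr_shiftr.
- move=> m w hw; have hpw := lm_LC psiM hw.
  have hpw' := lm_LC psiM (LC_shift shA m hw).
  rewrite !(lm_br phiM) ?psiK ?lpbr_shiftr //; try exact: (LC_br sA); exact: (LC_shift shA).
Qed.

(** The identity operator in [trace_compare]; when source and target coincide it forces |d| = lh. *)
Lemma ldim_compare : lh%:R * (ldim g)%:R = `|d|%N%:R * (ldim h)%:R :> C.
Proof.
rewrite -(trace_id sA) -(trace_id shA) trace_compare //.
  congr (_ * _); apply: eq_bigr => k _; apply: eq_bigr => i _ /=.
  by rewrite psiK //; apply/LC_mono/(proj_hom shA).
by move=> m v hv; rewrite !psiK //; apply: (LC_shift shA).
Qed.

End Transport.

(** * Loops with values in g *)

Lemma loop_iso_standard (C : numClosedFieldType) (isR : bool) (g h : lie_data C)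
    (s : 'M[C]_(ldim g)) (l : nat) (sh : 'M[C]_(ldim h)) (lh : nat)
    (phi : loopT g -> loopT h) (psi : loopT h -> loopT g) :
  tau_simple isR g -> tau_simple isR h -> fin_aut isR s l -> fin_aut isR sh lh ->
  loop_mor isR s l sh lh phi -> loop_mor isR sh lh s l psi ->
  (forall u, LC s l u -> psi (phi u) = u) -> (forall v, LC sh lh v -> phi (psi v) = v) ->
  exists (a kap : C) (w : loopT g),
    [/\ a \is Num.real, 0 < kap, (a * kap) ^+ 2 = 1 & kap * (ldim g)%:R = (ldim h)%:R] /\
    [/\ LC s l w, isR -> tau w = w,
      forall u, LC s l u -> derL lh (phi u) = phi (a *: derL l u + lpbr w u) &
      forall u v, LC s l u -> LC s l v -> formL (phi u) (phi v) = kap * formL u v].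
Proof.
move=> gS hS sA shA phiM psiM phiK psiK.
have [d [d0 Xd]] := X_degree gS hS sA shA phiM psiM phiK psiK.
have [w [hw rw dw]] := der_conj_inner gS hS sA shA phiM psiM phiK psiK d0 Xd.
have cf := formL_compare gS hS sA shA phiM psiM phiK psiK d0 Xd.
have cd := ldim_compare sA shA phiM psiM phiK psiK d0 Xd.
have dn0 : `|d|%N%:R != 0 :> C by rewrite pnatr_eq0 absz_eq0.
have l0 : lh%:R != 0 :> C by rewrite pnatr_eq0 -lt0n (fa_gt0 shA).
exists (d%:~R / lh%:R), (lh%:R / `|d|%N%:R), w; split; split=> //.
- by rewrite rpred_div ?realz ?realn.
- by rewrite divr_gt0 ?ltr0n ?absz_gt0 // (fa_gt0 shA).
- rewrite mulrA divfK // expr_div_n natr_absz intr_norm real_normK ?realz //.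
  by rewrite divff // sqrf_eq0 intr_eq0.
- by rewrite mulrAC cd mulrAC divff ?mul1r.
- by move=> u v hu hv; rewrite mulrAC cf // mulrAC divff ?mul1r.
Qed.

Section RealForm.
Variables (C : numClosedFieldType) (isR : bool) (g : lie_data C).
Variables (s : 'M[C]_(ldim g)) (l : nat).
Hypotheses (gS : tau_simple isR g) (sA : fin_aut isR s l).
Local Notation L := (loopT g).
Local Notation LC := (LC s l).
Local Notation M := (inL isR s l).
Implicit Types u v w : L.

Lemma inL_inLC u : M u -> LC u.
Proof. by move/inL_LC => []. Qed.

Lemma inL_fin u : M u -> finsupp u.
Proof. by move/inL_inLC => []. Qed.

Lemma inF_conj (a : C) : inF isR a -> isR -> a^* = a.
Proof. by rewrite /inF; case: isR => //= /CrealP. Qed.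

Lemma conj_inF (a : C) : (isR -> a^* = a) -> inF isR a.
Proof. by rewrite /inF; case: isR => //= h; apply/CrealP/h. Qed.

Lemma inL_lin a u v : inF isR a -> M u -> M v -> M (a *: u + v).
Proof.
move=> Fa /inL_LC[hu ru] /inL_LC[hv rv]; apply/inL_LC; split; first exact: LC_lin.
by move=> R; rewrite tau_lin (ru R) (rv R) (inF_conj Fa R).
Qed.

Lemma inF1 : inF isR (1 : C). Proof. by apply: conj_inF => _; rewrite rmorph1. Qed.
Lemma inF0 : inF isR (0 : C). Proof. by apply: conj_inF => _; rewrite rmorph0. Qed.
Lemma inFN (a : C) : inF isR a -> inF isR (- a).
Proof. by move=> h; apply: conj_inF => R; rewrite rmorphN /= inF_conj. Qed.
Lemma inFD (a b : C) : inF isR a -> inF isR b -> inF isR (a + b).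
Proof. by move=> ha hb; apply: conj_inF => R; rewrite rmorphD /= !inF_conj. Qed.
Lemma inFM (a b : C) : inF isR a -> inF isR b -> inF isR (a * b).
Proof. by move=> ha hb; apply: conj_inF => R; rewrite rmorphM /= !inF_conj. Qed.
Lemma inFV (a : C) : inF isR a -> inF isR a^-1.
Proof. by move=> h; apply: conj_inF => R; rewrite fmorphV /= inF_conj. Qed.

Lemma inL0 : M 0.
Proof. by apply/inL_LC; split=> [|_]; [exact: LC0|apply/funext => k; rewrite /tau map_mx0]. Qed.
Lemma inLD u v : M u -> M v -> M (u + v).
Proof. by rewrite -[u in M (u + v)]scale1r; apply/inL_lin/inF1. Qed.
Lemma inLZ a u : inF isR a -> M u -> M (a *: u).
Proof. by move=> Fa h; rewrite -[_ *: _]addr0; apply: inL_lin inL0. Qed.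
Lemma inLN u : M u -> M (- u).
Proof. by rewrite -scaleN1r; apply/inLZ/inFN/inF1. Qed.

Lemma inL_br u v : M u -> M v -> M (lpbr u v).
Proof.
move=> /inL_LC[hu ru] /inL_LC[hv rv]; apply/inL_LC; split; first exact: (LC_br sA).
by move=> R; rewrite (tau_br gS) ?ru ?rv //; [case: hu|case: hv].
Qed.

Lemma inL_der u : M u -> M (derL l u).
Proof.
move=> /inL_LC[hu ru]; apply/inL_LC; split; first exact: LC_der.
by move=> R; rewrite tau_der ru.
Qed.

Lemma formL_inF u v : M u -> M v -> inF isR (formL u v).
Proof.
move=> /inL_LC[hu ru] /inL_LC[hv rv]; apply: conj_inF => R.
by rewrite -(formL_tau gS) ?ru ?rv //; [case: hu|case: hv].
Qed.

(** Real part with respect to [tau]. For complex F every loop counts as real, with imaginary part 0,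
    so one decomposition serves both fields. *)
Definition reL u : L := if isR then 2^-1 *: (u + tau u) else u.
Definition imL u : L := if isR then (2 * 'i)^-1 *: (u - tau u) else 0.

Lemma rect_dec u : u = reL u + 'i *: imL u.
Proof.
rewrite /reL /imL; case: isR; last by rewrite scaler0 addr0.
rewrite scalerA invfM mulrCA divff ?neq0Ci // mulr1 -scalerDr addrACA subrr addr0.
by rewrite -mulr2n -scaler_nat scalerA mulVf ?scale1r // pnatr_eq0.
Qed.

Lemma tauD u v : tau (u + v) = tau u + tau v.
Proof. by apply/funext => k; rewrite /tau map_mxD. Qed.
Lemma tauZ a u : tau (a *: u) = a^* *: tau u.
Proof. by apply/funext => k; rewrite /tau cjZ. Qed.

Lemma reL_lin a u v : inF isR a -> reL (a *: u + v) = a *: reL u + reL v.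
Proof.
move=> Fa; rewrite /reL; case: isR Fa => // Fa.
rewrite tau_lin (CrealP Fa) addrACA -scalerDr.
by rewrite [2^-1 *: (a *: _ + _)]scalerDr !scalerA [a * _]mulrC.
Qed.

Lemma reL_LC u : LC u -> M (reL u).
Proof.
move=> hu; apply/inL_LC; rewrite /reL; have := fun R => LC_tau sA R hu.
case: isR => // /(_ isT) ht; split=> [|_]; first exact/LCZ/LCD.
by rewrite tauZ tauD tauK addrC fmorphV rmorph_nat.
Qed.

Lemma imL_LC u : LC u -> M (imL u).
Proof.
move=> hu; apply/inL_LC; rewrite /imL; have := fun R => LC_tau sA R hu.
case: isR => [/(_ isT) ht|_]; last by split=> //; apply: LC0.
have e : u - tau u = - 1 *: tau u + u by rewrite addrC scaleN1r.
split=> [|_]; first by apply: LCZ; rewrite e; apply: LC_lin.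
have tauB : tau (u - tau u) = - (u - tau u).
  by rewrite opprB e tau_lin tauK rmorphN rmorph1 scaleN1r addrC.
rewrite tauZ tauB scalerN -scaleNr; congr (_ *: _).
by rewrite fmorphV rmorphM rmorph_nat /= conjCi mulrN invrN opprK.
Qed.

Lemma complexL_ind (P : L -> Prop) :
  (forall a u v, LC u -> LC v -> P u -> P v -> P (a *: u + v)) ->
  (forall u, M u -> P u) -> forall u, LC u -> P u.
Proof.
move=> PL PM u hu; rewrite (rect_dec u) addrC.
have [hr hi] := (reL_LC hu, imL_LC hu).
by apply: PL; try exact: inL_inLC; exact: PM.
Qed.

Lemma reL_id u : M u -> reL u = u.
Proof.
move=> /inL_LC[_]; rewrite /reL; case: isR => // /(_ isT) ->.
by rewrite -mulr2n -scaler_nat scalerA mulVf ?scale1r // pnatr_eq0.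
Qed.

Lemma reL_i u : M u -> isR -> reL ('i *: u) = 0.
Proof.
move=> /inL_LC[_]; rewrite /reL; case: isR => // /(_ isT) e _.
by rewrite tauZ e conjCi scaleNr subrr scaler0.
Qed.

(** The real part of a bracket of complex loops is [Re u, Re v] - [Im u, Im v], a sum of brackets
    within the real form, so perfectness descends to it. *)
Lemma perfect_inL (P : L -> Prop) : P 0 ->
  (forall u v, M u -> M v -> P u -> P v -> P (u + v)) ->
  (forall u v, M u -> M v -> P (lpbr u v)) -> forall u, M u -> P u.
Proof.
move=> P0 PD Pbr u hu; suff h v : LC v -> P (reL v).
  by rewrite -(reL_id hu); apply/h/inL_inLC.
move: v => {u hu}; apply: (loop_bracket_span gS sA (P := fun u => P (reL u))).
- by rewrite reL_id; [exact: P0|exact: inL0].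
- move=> u v hu hv pu pv; have := reL_lin u v inF1; rewrite !scale1r => ->.
  by apply: PD => //; apply: reL_LC.
move=> u v hu hv.
have [hur hui] := (reL_LC hu, imL_LC hu); have [hvr hvi] := (reL_LC hv, imL_LC hv).
have [R|nR] := boolP isR; last first.
  have e x : reL x = x by rewrite /reL (negPf nR).
  by rewrite !e in hur hvr *; apply: Pbr.
rewrite {1}[u]rect_dec {1}[v]rect_dec ![_ + 'i *: _]addrC.
have fin x : M x -> finsupp x by exact: inL_fin.
rewrite lpbr_linl ?lpbr_linr; try exact: fin.
set A := lpbr _ _; set B := lpbr _ _; set D := lpbr (reL u) _; set E := lpbr _ _.
have [hA hB hD hE] : [/\ M A, M B, M D & M E] by split; apply: inL_br.
have -> : 'i *: ('i *: A + B) + ('i *: D + E) = -1 *: A + ('i *: (B + D) + E).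
  by rewrite scalerDr scalerA -expr2 sqrCi -!addrA scalerDr -!addrA.
rewrite reL_lin; last by apply/inFN/inF1.
have := reL_lin ('i *: (B + D)) E inF1; rewrite !scale1r => ->.
rewrite (reL_i (inLD hB hD) R) add0r !reL_id // addrC.
apply: PD => //; first by apply: inLZ => //; apply/inFN/inF1.
  exact: Pbr.
rewrite scaleN1r -(lpbrC gS) ; try exact: fin.
exact: Pbr.
Qed.

End RealForm.

(** * The derivative is outer and the cocycle is nontrivial *)

Section NotInner.
Variables (C : numClosedFieldType) (isR : bool) (g : lie_data C).
Variables (s : 'M[C]_(ldim g)) (l : nat).
Hypotheses (gS : tau_simple isR g) (sA : fin_aut isR s l).
Local Notation L := (loopT g).
Local Notation LC := (LC s l).
Local Notation M := (inL isR s l).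
Implicit Types u v w : L.

Lemma LC_nontriv : exists k x, hom s l k x /\ x != 0.
Proof.
apply: contrapT => h; have [x [y]] := ts_nab gS; suff -> : y = 0 by rewrite gbr0r eqxx.
elim/(hom_ind sA): y => [y y' -> ->|k y hy]; first by rewrite addr0.
by apply/eqP/contraT => y0; case: h; exists k, y.
Qed.

Lemma inL_centerless w : LC w -> (forall u, M u -> lpbr w u = 0) -> w = 0.
Proof.
move=> hw h; have {}h u : LC u -> lpbr w u = 0.
  move=> hu; elim/(complexL_ind sA): u / hu => // a u v hu hv eu ev.
  by rewrite lpbr_linr ?eu ?ev ?scaler0 ?addr0 //; case: hw.
apply/funext => j; apply: (centerless gS); elim/(hom_ind sA) => [x y hx hy|k x hx].
  by rewrite gbrDr hx hy addr0.
have := h _ (LC_mono hx); rewrite (lpbrC gS) ?lpbr_monol; [|by case: hw|exact: finsupp_mono].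
move=> /(congr1 (fun f => f (j + k))) /eqP; rewrite oppr_eq0 => /eqP.
by rewrite addrK => e; rewrite (ts_skew gS) e oppr0.
Qed.

(** Inner derivations commute with multiplication by e^{it}, the derivative does not: evaluating on
    e^{it} u leaves i c e^{it} u = 0. *)
Lemma derL_not_inner (c : C) w : LC w -> (forall u, M u -> c *: derL l u + lpbr w u = 0) ->
  c = 0 /\ w = 0.
Proof.
move=> hw h; have hC u : LC u -> c *: derL l u + lpbr w u = 0.
  move=> hu; elim/(complexL_ind sA): u / hu => // a u v hu hv eu ev.
  rewrite derL_lin lpbr_linr; last by case: hw.
  rewrite scalerDr addrACA ev addr0 scalerA mulrC -scalerA -scalerDr eu.
  by rewrite scaler0.
have c0 : c = 0.
  have [k [x [hx x0]]] := LC_nontriv; have hm := LC_mono hx.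
  have := hC _ (LC_shift sA 1 hm).
  rewrite (derL_shift _ _ (fa_gt0 sA)) lpbr_shiftr scalerDr addrAC.
  rewrite -[c *: shift _ _ + _]/(shift (l%:Z * 1) (c *: derL l (mono k x) + lpbr w (mono k x))).
  rewrite (hC _ hm) mulr1 => /(congr1 (fun f => f (k + l%:Z))).
  rewrite [X in X = _ -> _](_ : _ = 0 + c *: (('i * 1%:~R) *: x)); last first.
    by rewrite shift_mono; congr (0 + c *: (_ *: _)); rewrite /mono eqxx.
  move/eqP; rewrite mulr1z mulr1 add0r !scaler_eq0 (negPf (neq0Ci _)) (negPf x0) !orbF.
  by move/eqP.
split=> //; apply: inL_centerless => // u hu.
by have := h u hu; rewrite c0 scale0r add0r.
Qed.

Lemma kil_aut (x y : 'rV[C]_(ldim g)) : kil (x *m s) (y *m s) = kil x y.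
Proof.
have su : s \in unitmx.
  apply: (@mulmx1_unit _ _ _ (s ^+ l.-1) _).1.
  by rewrite -[_ *m _](exprS s l.-1) prednK ?(fa_gt0 sA) // (fa_exp sA).
have ad z : s *m adm (z *m s) = adm z *m s.
  by apply/row_matrixP => i; rewrite !rowE !mulmxA -!gbrE (fa_br sA).
rewrite /kil -[adm (y *m s)](mulKmx su) ad -!mulmxA ad mxtrace_mulC.
by rewrite !mulmxA mulmxK.
Qed.

(** The Killing form is nondegenerate and sigma-invariant, so an eigenvector pairs nontrivially only
    with eigenvectors of the inverse eigenvalue. *)
Lemma kil_hom k x : hom s l k x -> x != 0 -> exists y, hom s l (- k) y /\ kil x y != 0.
Proof.
move=> hx x0; apply: contrapT => h; case/eqP: x0; apply: (kil_nondeg gS) => y.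
elim/(hom_ind sA): y => [y z hy hz|j y hy]; first by rewrite kilDr hy hz addr0.
apply/eqP/contraT => Kxy; case: h; exists y; split=> //.
have e0 := eps_neq0 sA.
have := kil_aut x y; rewrite hx hy kilZl kilZr mulrA -expfzDr // -{2}[kil x y]mul1r.
move/(mulIf Kxy) => e1; rewrite /hom hy; congr (_ *: _).
by apply: (mulfI (expfz_neq0 k e0)); rewrite -!expfzDr // e1 subrr expr0z.
Qed.

(* With the real multiplier [rho = z^l + z^-l] one has [rho u, v] = [u, rho v], while the
   cocycle (u', v) distinguishes the two brackets. *)
Lemma cocycle_nontriv : exists u1 v1 u2 v2, [/\ M u1, M v1, M u2 & M v2] /\
  lpbr u1 v1 = lpbr u2 v2 /\ formL (derL l u1) v1 != formL (derL l u2) v2.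
Proof.
pose rho u := shift (l%:Z * 1) u + shift (l%:Z * (-1)) u.
have rhoM u : M u -> M (rho u).
  move=> /inL_LC[hu ru]; apply/inL_LC; split; first by apply: LCD; apply: (LC_shift sA).
  move=> R; rewrite /rho tauD addrC.
  by rewrite -[in RHS](ru R); congr (_ + _); apply/funext => k; rewrite /tau /shift;
    congr (_^cj); congr (u _); lia.
have rhoF u : finsupp u -> finsupp (rho u).
  by move=> fu; apply: finsuppD; apply: finsupp_shift.
apply: contrapT => no.
have eqR u v : M u -> M v -> formL (derL l (rho u)) v = formL (derL l u) (rho v).
  move=> hu hv; apply/eqP/negP => /negP h; apply: no; exists (rho u), v, u, (rho v).
  split; first by split=> //; apply: rhoM.
  split=> //; have [fu fv] := (inL_fin hu, inL_fin hv).
  have rhoE f : rho f = 1 *: shift (l%:Z * 1) f + shift (l%:Z * -1) f by rewrite scale1r.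
  rewrite !rhoE lpbr_linl ?lpbr_linr //; try exact: finsupp_shift.
  by rewrite !lpbr_shiftr !(lpbr_shiftl gS).
have rhoL a u v : rho (a *: u + v) = a *: rho u + rho v.
  by rewrite /rho !shift_lin scalerDr addrACA.
have LCrho u : LC u -> LC (rho u) by move=> hu; apply: LCD; apply: (LC_shift sA).
have eqC u v : LC u -> LC v -> formL (derL l (rho u)) v = formL (derL l u) (rho v).
  move=> hu; elim/(complexL_ind sA): u / hu v => [a u u' hu hu' eu eu' v hv|u hu v hv].
    have fd w : LC w -> finsupp (derL l w) by move=> hw; case: (LC_der hw).
    by rewrite rhoL !derL_lin !formL_linl ?eu ?eu' //; apply: fd => //; apply: LCrho.
  elim/(complexL_ind sA): v / hv => [a v v' hv hv' ev ev'|v hv]; last exact: eqR.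
  rewrite rhoL !formL_linr ?ev ?ev' //; apply: finsupp_der; 
    by [exact: inL_fin hu|apply/rhoF/(inL_fin hu)].
have [k [x [hx x0]]] := LC_nontriv.
have [y [hy Kxy]] := kil_hom hx x0.
(* With [y] in degree -k - l only the upward shifts reach total degree 0. The two sides are i(k +
   l)/l and ik/l times [kil x y], so they differ by i times a nonzero number. *)
have hy' : hom s l (- k - l%:Z) y.
  by have := (hom_period sA (- k) (-1) y).2 hy; rewrite mulrN1.
have := eqC _ _ (LC_mono hx) (LC_mono hy').
have l0 := fa_gt0 sA; have l0' : l%:R != 0 :> C by rewrite pnatr_eq0 -lt0n.
have rhoE i z : rho (mono i z) = mono (i + l%:Z) z + mono (i - l%:Z) z.
  by rewrite /rho !shift_mono mulr1 mulrN1.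
have derE i z : derL l (mono i z) = mono i (('i * i%:~R / l%:R) *: z).
  by rewrite derL_mono monoZ.
have formD (f1 f2 f3 : L) : finsupp f1 -> finsupp f2 -> formL (f1 + f2) f3 = formL f1 f3 + formL f2 f3.
  by move=> h1 h2; rewrite -[f1]scale1r formL_linl // mul1r scale1r.
have derD (f1 f2 : L) : derL l (f1 + f2) = derL l f1 + derL l f2.
  by rewrite -[f1]scale1r derL_lin !scale1r.
have formDr (f1 f2 f3 : L) : finsupp f3 -> formL f3 (f1 + f2) = formL f3 f1 + formL f3 f2.
  by move=> h1; rewrite -[f1]scale1r formL_linr // mul1r scale1r.
rewrite !rhoE derD formD ?formDr ?derE; try exact: finsupp_mono.
rewrite !formL_mono.
have -> : (k + l%:Z + (- k - l%:Z) == 0) = true by apply/eqP; clear; lia.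
have -> : (k - l%:Z + (- k - l%:Z) == 0) = false by apply/eqP; clear -l0; lia.
have -> : (k + (- k - l%:Z + l%:Z) == 0) = true by apply/eqP; clear; lia.
have -> : (k + (- k - l%:Z - l%:Z) == 0) = false by apply/eqP; clear -l0; lia.
rewrite !addr0 !kilZl => /(mulIf Kxy)/eqP.
rewrite -subr_eq0 -mulrBl -mulrBr intrD addrAC subrr add0r -pmulrn mulfK //.
by rewrite (negPf (neq0Ci _)).
Qed.

End NotInner.

(** * Complexification of isomorphisms *)

Section LoopEval.
Variables (C : numClosedFieldType) (g : lie_data C).
Implicit Types u v : loopT g.
Lemma loopDE u v k : (u + v) k = u k + v k. Proof. by []. Qed.
Lemma loopZE a u k : (a *: u) k = a *: u k. Proof. by []. Qed.
Lemma loopNE u k : (- u) k = - u k. Proof. by []. Qed.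
End LoopEval.

Ltac loopring_i C := apply/funext => ?; rewrite !(loopDE, loopZE, loopNE);
  apply/matrixP => ? ?; rewrite !(mxD, mxZ, mxN); ring: (sqrCi C).

Lemma iso_inverse (C : numClosedFieldType) (isR : bool) (A B : LieAlg C) (f : car A -> car B) (x0 : car A) :
  (forall x y : car A, Defs.mem x -> Defs.mem y -> Defs.mem (ladd x y)) ->
  (forall a (x : car A), inF isR a -> Defs.mem x -> Defs.mem (lscl a x)) ->
  (forall x y : car A, Defs.mem x -> Defs.mem y -> Defs.mem (lbrk x y)) ->
  is_iso isR f -> exists f' : car B -> car A,
    [/\ is_iso isR f', forall x, Defs.mem x -> f' (f x) = x & forall y, Defs.mem y -> f (f' y) = y].
Proof.
move=> AD AZ Abr [fM [fD [fZ [fbr [finj fsurj]]]]].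
have [f' hf'] : {f' : car B -> car A & forall y, Defs.mem y -> Defs.mem (f' y) /\ f (f' y) = y}.
  apply: (@choice _ _ (fun y x => Defs.mem y -> Defs.mem x /\ f x = y)) => y.
  (* [x0] is the default value outside [B]. *)
  have [my|my] := pselect (Defs.mem y); last by exists x0.
  by have [x mx fx] := fsurj y my; exists x.
have M' y : Defs.mem y -> Defs.mem (f' y) by move=> /hf'[].
have K' y : Defs.mem y -> f (f' y) = y by move=> /hf'[].
have K x : Defs.mem x -> f' (f x) = x.
  by move=> mx; apply: finj => //; [apply/M'/fM|apply/K'/fM].
have eqf' x y : Defs.mem x -> Defs.mem y -> f x = y -> f' y = x by move=> mx my <-; apply: K.
exists f'; split=> //; split=> //; split=> [x y mx my|].
  rewrite -{1}(K' x mx) -{1}(K' y my) -fD; try exact: M'.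
  by apply/K/AD; apply: M'.
split=> [a x Fa mx|].
  by rewrite -{1}(K' x mx) -fZ //; [apply/K/AZ => //|]; apply: M'.
split=> [x y mx my|].
  rewrite -{1}(K' x mx) -{1}(K' y my) -fbr; try exact: M'.
  by apply/K/Abr; apply: M'.
split=> [x y mx my e|x mx]; first by rewrite -(K' x mx) e K'.
by exists (f x); [apply: fM|apply: K].
Qed.

Section Complexify.
Variables (C : numClosedFieldType) (isR : bool) (g h : lie_data C).
Variables (s : 'M[C]_(ldim g)) (l : nat) (sh : 'M[C]_(ldim h)) (lh : nat).
Hypotheses (gS : tau_simple isR g) (hS : tau_simple isR h).
Hypotheses (sA : fin_aut isR s l) (shA : fin_aut isR sh lh).
Local Notation Mg := (inL isR s l).
Local Notation Mh := (inL isR sh lh).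

Definition extL (f : loopT g -> loopT h) u : loopT h :=
  if isR then f (reL isR u) + 'i *: f (imL isR u) else f u.

Variable f : loopT g -> loopT h.
Hypothesis fI : @is_iso C isR (Loop isR s l) (Loop isR sh lh) f.

Let fM u : Mg u -> Mh (f u). Proof. by case: fI => h1 _; apply: h1. Qed.
Let fD u v : Mg u -> Mg v -> f (u + v) = f u + f v.
Proof. by case: fI => _ [h1 _]; apply: h1. Qed.
Let fZ a u : inF isR a -> Mg u -> f (a *: u) = a *: f u.
Proof. by case: fI => _ [_ [h1 _]]; apply: h1. Qed.
Let fbr u v : Mg u -> Mg v -> f (lpbr u v) = lpbr (f u) (f v).
Proof. by case: fI => _ [_ [_ [h1 _]]]; apply: h1. Qed.
Let f0 : f 0 = 0.
Proof. by have := fZ (inF0 C isR) (inL0 isR s l); rewrite !scale0r. Qed.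
Let fN u : Mg u -> f (- u) = - f u.
Proof. by move=> hu; rewrite -scaleN1r fZ ?scaleN1r //; apply/inFN/inF1. Qed.

Lemma extL_id u : Mg u -> extL f u = f u.
Proof.
move=> hu; rewrite /extL; case: ifP => // R.
have e : reL isR u = u by apply: (reL_id hu).
have -> : imL isR u = 0.
  move/inL_LC: hu => [_ ru]; rewrite /imL R ru ?R // subrr scaler0 //.
by rewrite e f0 scaler0 addr0.
Qed.

Lemma extL_rect x y : isR -> Mg x -> Mg y -> extL f (x + 'i *: y) = f x + 'i *: f y.
Proof.
move=> R hx hy; rewrite /extL R.
have [rx ry] : tau x = x /\ tau y = y by move/inL_LC: hx => [_ ->] //; move/inL_LC: hy => [_ ->].
have two0 : 2 != 0 :> C by rewrite pnatr_eq0.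
congr (f _ + _ *: f _).
  rewrite /reL tauD tauZ rx ry conjCi scaleNr addrACA subrr addr0.
  by rewrite -mulr2n -scaler_nat scalerA mulVf ?scale1r.
rewrite /imL tauD tauZ rx ry conjCi scaleNr opprD opprK addrACA subrr add0r.
rewrite -mulr2n -scaler_nat [2%:R *: _]scalerA scalerA mulVf ?scale1r //.
by rewrite mulf_neq0 ?neq0Ci.
Qed.

Lemma extL_mor : loop_mor isR s l sh lh (extL f).
Proof.
have [R|/negP nR] := pselect isR; last first.
  have eM u : LC s l u -> Mg u by move=> hu; apply/inL_LC; split=> //; rewrite (negPf nR).
  have ee : extL f = f by rewrite /extL (negPf nR).
  have aF a : inF isR a by rewrite /inF (negPf nR).
  rewrite ee; split=> [a u v hu hv|u hu|u v hu hv|R]; last by rewrite R in nR.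
  - by rewrite fD ?fZ //; [exact: eM|apply/inLZ/eM|exact: eM].
  - exact/inL_inLC/fM/eM.
  - by apply: fbr; apply: eM.
have rect u : LC s l u -> exists x y, [/\ Mg x, Mg y & u = x + 'i *: y].
  move=> hu; exists (reL isR u), (imL isR u); split; [exact: (reL_LC sA)|exact: (imL_LC sA)|exact: rect_dec].
split=> [a u v hu hv|u hu|u v hu hv|_ u hu].
- have [x [y [hx hy ->]]] := rect u hu; have [x' [y' [hx' hy' ->]]] := rect v hv.
  have [p [q [Fp Fq ->]]] : exists p q, [/\ inF isR p, inF isR q & a = p + 'i * q].
    exists ('Re a), ('Im a); split; rewrite -?Crect // /inF R /=.
      exact: Creal_Re.
    exact: Creal_Im.
  have -> : (p + 'i * q) *: (x + 'i *: y) + (x' + 'i *: y') =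
      (p *: x - q *: y + x') + 'i *: (q *: x + p *: y + y').
    by loopring_i C.
  rewrite !extL_rect //; first last.
  + by apply: inLD => //; apply: inLD; apply: inLZ.
  + by apply: inLD => //; apply: inLD; [apply: inLZ|apply/inLN/inLZ].
  rewrite !fD ?fN ?fZ //; try (by apply: inLZ); try (by apply: inLN; apply: inLZ).
  + by loopring_i C.
  + by apply: inLD; apply: inLZ.
  + by apply: inLD; [apply: inLZ|apply/inLN/inLZ].
- have [x [y [hx hy ->]]] := rect u hu; rewrite extL_rect // addrC.
  by apply: LC_lin; apply/inL_inLC/fM.
- have [x [y [hx hy ->]]] := rect u hu; have [x' [y' [hx' hy' ->]]] := rect v hv.
  have fin w : Mg w -> finsupp w by exact: inL_fin.
  have fin' w : Mh w -> finsupp w by exact: inL_fin.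
  have [hxx hxy hyx hyy] : [/\ Mg (lpbr x x'), Mg (lpbr x y'), Mg (lpbr y x') & Mg (lpbr y y')].
    by split; apply: (inL_br gS sA).
  have brE (k : lie_data C) (x1 y1 x2 y2 : loopT k) :
      finsupp x1 -> finsupp y1 -> finsupp x2 -> finsupp y2 ->
      lpbr (x1 + 'i *: y1) (x2 + 'i *: y2) =
      (lpbr x1 x2 - lpbr y1 y2) + 'i *: (lpbr x1 y2 + lpbr y1 x2).
    move=> f1 f2 f3 f4; rewrite ![_ + 'i *: _]addrC lpbr_linl // !lpbr_linr //.
    by loopring_i C.
  rewrite !extL_rect // !brE; try (by apply: fin); try (by apply/fin'/fM).
  by rewrite extL_rect ?fD ?fN ?fbr //; [apply: inLN|apply: inLD => //; apply: inLN|apply: inLD].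
- have [x [y [hx hy ->]]] := rect u hu.
  have rx w : Mg w -> tau w = w by move/inL_LC => [_ ->].
  have rx' w : Mh w -> tau w = w by move/inL_LC => [_ ->].
  rewrite tauD tauZ !rx // conjCi scaleNr -scalerN !extL_rect //; last exact: inLN.
  by rewrite tauD tauZ !rx' ?fN ?conjCi ?scaleNr ?scalerN //; apply: fM.
Qed.
End Complexify.

Section Standard.
Variables (C : numClosedFieldType) (isR : bool) (g h : lie_data C).
Variables (s : 'M[C]_(ldim g)) (l : nat) (sh : 'M[C]_(ldim h)) (lh : nat).
Hypotheses (gS : tau_simple isR g) (hS : tau_simple isR h).
Hypotheses (sA : fin_aut isR s l) (shA : fin_aut isR sh lh).
Local Notation Mg := (inL isR s l).
Local Notation Mh := (inL isR sh lh).

Lemma extL_cancel (f : loopT g -> loopT h) (f' : loopT h -> loopT g) :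
  @is_iso C isR (Loop isR s l) (Loop isR sh lh) f ->
  @is_iso C isR (Loop isR sh lh) (Loop isR s l) f' ->
  (forall u, Mg u -> f' (f u) = u) ->
  forall u, LC s l u -> extL isR f' (extL isR f u) = u.
Proof.
move=> fI fI' K u hu; have [R|/negP nR] := pselect isR; last first.
  rewrite /extL (negPf nR) K //; apply/inL_LC; split=> //; by rewrite (negPf nR).
have [hr hi] := (reL_LC sA hu, imL_LC sA hu); have [fM _] := fI.
rewrite {1}[u](rect_dec isR) (extL_rect f R hr hi) (extL_rect f' R (fM _ hr) (fM _ hi)).
by rewrite !K // -rect_dec.
Qed.

End Standard.

Section Standard.
Variables (C : numClosedFieldType) (isR : bool) (g h : lie_data C).
Variables (s : 'M[C]_(ldim g)) (l : nat) (sh : 'M[C]_(ldim h)) (lh : nat).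
Hypotheses (gS : tau_simple isR g) (hS : tau_simple isR h).
Hypotheses (sA : fin_aut isR s l) (shA : fin_aut isR sh lh).
Local Notation Mg := (inL isR s l).
Local Notation Mh := (inL isR sh lh).

Lemma loop_iso_inverse (f : loopT g -> loopT h) :
  @is_iso C isR (Loop isR s l) (Loop isR sh lh) f -> exists f' : loopT h -> loopT g,
    [/\ @is_iso C isR (Loop isR sh lh) (Loop isR s l) f',
      forall u, Mg u -> f' (f u) = u & forall v, Mh v -> f (f' v) = v].
Proof.
apply: iso_inverse; first exact: (0 : loopT g).
- exact: inLD.
- exact: inLZ.
- exact: (inL_br gS sA).
Qed.

Lemma loop_iso_deriv_form (phi : loopT g -> loopT h) :
  @is_iso C isR (Loop isR s l) (Loop isR sh lh) phi ->
  exists (a kap : C) (w : loopT g),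
    [/\ inF isR a, inF isR kap, (a * kap) ^+ 2 = 1, 0 < kap & kap * (ldim g)%:R = (ldim h)%:R] /\
    [/\ Mg w,
      forall u, Mg u -> derL lh (phi u) = phi (a *: derL l u + lpbr w u) &
      forall u v, Mg u -> Mg v -> formL (phi u) (phi v) = kap * formL u v].
Proof.
move=> phiI; have [psi [psiI phiK psiK]] := loop_iso_inverse phiI.
have [a [kap [w [[Ra k0 ak kd] [hw rw dw fw]]]]] := loop_iso_standard gS hS sA shA
  (extL_mor gS sA phiI) (extL_mor hS shA psiI)
  (extL_cancel sA phiI psiI phiK) (extL_cancel shA psiI phiI psiK).
have phiM u : Mg u -> Mh (phi u) by case: phiI => h1 _; apply: h1.
have inFr (x : C) : x \is Num.real -> inF isR x by rewrite /inF => ->; rewrite implybT.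
have Fa := inFr _ Ra.
have Mw : Mg w by apply/inL_LC.
have Fk := inFr _ (gtr0_real k0).
exists a, kap, w; split; split=> // [u hu|u v hu hv].
  have hr : Mg (a *: derL l u + lpbr w u).
    by apply: inLD; [apply/inLZ/inL_der|apply: (inL_br gS sA)].
  by have := dw u (inL_inLC hu); rewrite !(extL_id phiI).
by have := fw u v (inL_inLC hu) (inL_inLC hv); rewrite !(extL_id phiI).
Qed.
End Standard.

(** * Affine algebras *)

Section LoopOps.
Variables (C : numClosedFieldType) (g : lie_data C).
Lemma lpaddE (u v : loopT g) : lpadd u v = u + v. Proof. by []. Qed.
Lemma lpsclE c (u : loopT g) : lpscl c u = c *: u. Proof. by []. Qed.
Lemma loop0E k : (0 : loopT g) k = 0. Proof. by []. Qed.
Lemma formL0r (u : loopT g) : finsupp u -> formL u 0 = 0.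
Proof.
move=> fu; have := formL_linr (-1) 0 0 fu; rewrite scaleN1r addNr mulN1r => {1}->.
by rewrite addNr.
Qed.
Lemma formLZr a (u v : loopT g) : finsupp u -> formL u (a *: v) = a * formL u v.
Proof. by move=> fu; rewrite -[a *: v]addr0 formL_linr // formL0r // addr0. Qed.
Definition lpE := (lpaddE, lpsclE).
End LoopOps.

Ltac loopring := apply/funext => ?; rewrite !(loopDE, loopZE, loopNE, loop0E); mxring.

(** * Lifting an isomorphism of loop algebras *)

Section Lift.
Variables (C : numClosedFieldType) (isR : bool) (g h : lie_data C).
Variables (s : 'M[C]_(ldim g)) (l : nat) (sh : 'M[C]_(ldim h)) (lh : nat).
Hypotheses (gS : tau_simple isR g) (hS : tau_simple isR h).
Hypotheses (sA : fin_aut isR s l) (shA : fin_aut isR sh lh).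
Local Notation Mg := (inL isR s l).
Local Notation Mh := (inL isR sh lh).
Variable phi : loopT g -> loopT h.
Hypothesis phiI : @is_iso C isR (Loop isR s l) (Loop isR sh lh) phi.
Variables (a kap : C) (w : loopT g).
Hypotheses (Fa : inF isR a) (Fk : inF isR kap) (ak : a * kap != 0) (hw : Mg w).
Hypothesis dphi : forall u, Mg u -> derL lh (phi u) = phi (a *: derL l u + lpbr w u).
Hypothesis fphi : forall u v, Mg u -> Mg v -> formL (phi u) (phi v) = kap * formL u v.

(** By [dphi], phi carries the derivative to a^{-1} (d/dt - ad (phi w)), so d must go to a^{-1} (d -
    phi w) up to a central term, taken to be 0. By [form_der_phi], phi changes the cocycle by the
    factor a kap and by kap (w, [u, v]): the first rescales c, the second is absorbed by adding (phi
    w, phi u) c to the image of u. *)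
Definition lift (x : affT g) : affT h :=
  (phi (aloop x) - (dcoef x * a^-1) *: phi w,
   a * kap * acoef x + formL (phi w) (phi (aloop x)), a^-1 * dcoef x).

Let phiM u : Mg u -> Mh (phi u). Proof. by case: phiI => h1 _; apply: h1. Qed.
Let phiD u v : Mg u -> Mg v -> phi (u + v) = phi u + phi v.
Proof. by case: phiI => _ [h1 _]; apply: h1. Qed.
Let phiZ c u : inF isR c -> Mg u -> phi (c *: u) = c *: phi u.
Proof. by case: phiI => _ [_ [h1 _]]; apply: h1. Qed.
Let phibr u v : Mg u -> Mg v -> phi (lpbr u v) = lpbr (phi u) (phi v).
Proof. by case: phiI => _ [_ [_ [h1 _]]]; apply: h1. Qed.
Let phi_inj u v : Mg u -> Mg v -> phi u = phi v -> u = v.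
Proof. by case: phiI => _ [_ [_ [_ [h1 _]]]]; apply: h1. Qed.
Let phi_surj v : Mh v -> exists2 u, Mg u & phi u = v.
Proof. by case: phiI => _ [_ [_ [_ [_ h1]]]]; apply: h1. Qed.
Let a0 : a != 0. Proof. by apply: contraNneq ak => ->; rewrite mul0r. Qed.
Let fin u : Mg u -> finsupp u. Proof. exact: inL_fin. Qed.
Let finh v : Mh v -> finsupp v. Proof. exact: inL_fin. Qed.

Lemma lift_mem x : inAff isR s l x -> inAff isR sh lh (lift x).
Proof.
move: x => [[u c] d] [/= hu [Fc Fd]]; split=> /=.
  by apply: inLD; [apply: phiM|apply/inLN/inLZ; [apply/inFM/inFV|apply: phiM]].
split; last by apply/inFM; first exact: inFV.
apply: inFD; first by apply: inFM => //; apply: inFM.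
by apply: (formL_inF hS (s := sh) (l := lh)); apply: phiM.
Qed.

Lemma lift_add x y : inAff isR s l x -> inAff isR s l y ->
  lift (affadd x y) = affadd (lift x) (lift y).
Proof.
move: x y => [[u c] d] [[v c'] d'] [/= hu _] [/= hv _].
rewrite /lift /affadd /aloop /acoef /dcoef /=.
congr (_, _, _).
- rewrite !lpE phiD //.
  by rewrite mulrDl scalerDl opprD addrACA.
- rewrite !lpE phiD // -[phi u]scale1r formL_linr ?mul1r ?scale1r; last exact/finh/phiM.
  by ring.
- by rewrite mulrDr.
Qed.

Lemma lift_scl c x : inF isR c -> inAff isR s l x -> lift (affscl c x) = affscl c (lift x).
Proof.
move=> Fc; move: x => [[u e] d] [/= hu _].
rewrite /lift /affscl /aloop /acoef /dcoef /=; congr (_, _, _).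
- rewrite !lpE phiZ //.
  by rewrite -mulrA -scalerA scalerBr.
- rewrite !lpE phiZ // -[c *: phi u]addr0 formL_linr; last exact/finh/phiM.
  rewrite (formL0r (finh (phiM hw))).
  by ring.
- by rewrite mulrCA.
Qed.

Lemma form_der_phi u v : Mg u -> Mg v ->
  formL (derL lh (phi u)) (phi v) = a * kap * formL (derL l u) v + kap * formL w (lpbr u v).
Proof.
move=> hu hv; rewrite dphi // fphi //; last first.
  by apply: inLD; [apply/inLZ/inL_der|apply: (inL_br gS sA)].
rewrite formL_linl; [|exact: finsupp_der (fin hu)|by apply: finsupp_br; apply: fin].
by rewrite (formL_inv gS (fin hw) (fin hu) (fin hv)); ring.
Qed.

Lemma lift_br x y : inAff isR s l x -> inAff isR s l y ->
  lift (affbr l x y) = affbr lh (lift x) (lift y).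
Proof.
move: x y => [[u c] d] [[v c'] d'] [/= hu [_ Fd]] [/= hv [_ Fd']].
have [hpu [hpv hpw]] := (phiM hu, (phiM hv, phiM hw)).
have [du dv] := (inL_der hu, inL_der hv).
have buv := inL_br gS sA hu hv.
rewrite /lift /affbr /aloop /acoef /dcoef /=.
have Fal := inFV Fa; have FNd' := inFN Fd'.
have [dhu [dhv dhw]] := (inL_der (l := lh) hpu, (inL_der (l := lh) hpv, inL_der (l := lh) hpw)).
have [fpu [fpv fpw]] := (finh hpu, (finh hpv, finh hpw)).
have Mduv : Mg (d *: derL l v + (- d') *: derL l u) by apply: inLD; apply: inLZ.
have phin : phi (lpbr u v + (d *: derL l v + (- d') *: derL l u)) =
    lpbr (phi u) (phi v) + (d *: phi (derL l v) + (- d') *: phi (derL l u)).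
  by rewrite !phiD ?phiZ ?phibr //; apply: inLZ.
have dE z : Mg z -> phi (derL l z) = a^-1 *: (derL lh (phi z) - lpbr (phi w) (phi z)).
  move=> hz; have dz := inL_der hz; rewrite dphi // phiD ?phiZ ?phibr //.
  - by rewrite addrK scalerA mulVf ?scale1r.
  - exact: inLZ.
  - exact: (inL_br gS sA).
rewrite !lpE; congr (_, _, _).
- rewrite mul0r scale0r subr0 phin !dE //.
  rewrite ![_ - _ *: phi w]addrC -!scaleNr.
  rewrite lpbr_linl ?lpbr_linr // !derL_lin.
  have -> : lpbr (phi w) (phi w) = 0.
    have /eqP := lpbrC hS fpw fpw; rewrite -subr_eq0 opprK -mulr2n -scaler_nat scaler_eq0.
    by rewrite pnatr_eq0 => /eqP.
  rewrite [lpbr (phi u) (phi w)](lpbrC hS) //.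
  by loopring.
- have [fu [fv fw]] := (fin hu, (fin hv, fin hw)).
  have [fdu [fdv fdw]] := (finsupp_der l fu, (finsupp_der l fv, finsupp_der l fw)).
  rewrite fphi //; last by apply: inLD.
  rewrite ![_ - _ *: phi w]addrC -!scaleNr derL_lin.
  rewrite formL_linl; [|exact: inL_fin dhw|exact: inL_fin dhu].
  rewrite !formL_linr; [|exact: inL_fin dhu|exact: inL_fin dhw].
  rewrite !form_der_phi // -[lpbr u v in LHS]scale1r !formL_linr // formLZr //.
  have ww0 : formL (derL l w) w = 0.
    have /eqP := formL_der l fw fw; rewrite [formL w _]formLC // -addr_eq0.
    by rewrite -mulr2n -mulr_natl mulf_eq0 pnatr_eq0 => /eqP.
  have ww : lpbr w w = 0.
    have /eqP := lpbrC gS fw fw; rewrite -subr_eq0 opprK -mulr2n -scaler_nat scaler_eq0.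
    by rewrite pnatr_eq0 => /eqP.
  have wuw : formL w (lpbr u w) = 0.
    by rewrite formLC ?(formL_inv gS) ?ww ?formL0r //; apply: finsupp_br.
  have wwv : formL w (lpbr w v) = 0.
    by rewrite -(formL_inv gS) // ww formLC ?formL0r //; apply: finsupp0.
  rewrite ww0 ww wuw wwv formL0r // [formL (derL l w) v](formL_der l fw fv).
  by rewrite [formL w (derL l u)]formLC //; field.
- by rewrite mulr0.
Qed.

Lemma lift_inj x y : inAff isR s l x -> inAff isR s l y -> lift x = lift y -> x = y.
Proof.
move: x y => [[u c] d] [[v c'] d'] [/= hu _] [/= hv _].
rewrite /lift /aloop /acoef /dcoef /= => -[e1 e2 /(mulfI (invr_neq0 a0)) e3].
subst d'; move/addIr: e1 => /phi_inj -/(_ hu hv) e1; subst v.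
by move/addIr: e2 => /(mulfI ak) ->.
Qed.

Lemma lift_surj y : inAff isR sh lh y -> exists2 x, inAff isR s l x & lift x = y.
Proof.
move: y => [[v c] d] [/= hv [Fc Fd]]; have hpw := phiM hw.
have [|u hu eu] := @phi_surj (v + d *: phi w); first by apply: inLD => //; apply: inLZ.
have Fak : inF isR (a * kap) by apply: inFM.
exists (u, (a * kap)^-1 * (c - formL (phi w) (phi u)), a * d).
  split; first by []; split; last exact: inFM.
  apply/inFM; first exact: inFV.
  by apply: inFD => //; apply/inFN/(formL_inF hS (s := sh) (l := lh)) => //; apply: phiM.
rewrite /lift /aloop /acoef /dcoef /=; congr (_, _, _).
- by rewrite eu mulrAC divff // mul1r addrK.
- by rewrite mulrA divff // mul1r subrK.
- by rewrite mulrA mulVf // mul1r.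
Qed.

Lemma lift_iso : @is_iso C isR (Aff isR s l) (Aff isR sh lh) lift.
Proof.
split; first exact: lift_mem.
split; first exact: lift_add.
split; first by move=> c x Fc; exact: lift_scl.
split; first exact: lift_br.
split; first exact: lift_inj.
exact: lift_surj.
Qed.

Lemma lift_dcoef x : dcoef x = 0 -> dcoef (lift x) = 0.
Proof. by rewrite /lift {2}/dcoef /= => ->; rewrite mulr0. Qed.

Lemma lift_iso_der : @is_iso C isR (Der isR s l) (Der isR sh lh) lift.
Proof.
split; first by move=> x [hx /lift_dcoef dx]; split; first exact: lift_mem.
split; first by move=> x y [hx _] [hy _]; exact: lift_add.
split; first by move=> c x Fc [hx _]; exact: lift_scl.
split; first by move=> x y [hx _] [hy _]; exact: lift_br.
split; first by move=> x y [hx _] [hy _]; exact: lift_inj.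
move=> y [hy dy]; have [x hx e] := lift_surj hy; exists x => //; split=> //.
by move: dy; rewrite -e {1}/dcoef /= => /eqP; rewrite mulf_eq0 invr_eq0 (negPf a0) => /eqP.
Qed.

Lemma induced_lift u : Mg u -> induced lift u = phi u.
Proof. by move=> _; rewrite /induced /lift /aloop /dcoef /= mul0r scale0r subr0. Qed.

End Lift.

(** * Automorphisms of the derived algebra and the maps they induce *)

Section AffineAut.
Variables (C : numClosedFieldType) (isR : bool) (g : lie_data C).
Variables (s : 'M[C]_(ldim g)) (l : nat).
Hypotheses (gS : tau_simple isR g) (sA : fin_aut isR s l).
Local Notation M := (inL isR s l).
Local Notation MA := (inAff isR s l).
Local Notation MD := (inDer isR s l).
Local Notation Aff := (Aff isR s l).
Local Notation Der := (Der isR s l).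
Local Notation Loop := (Loop isR s l).
Implicit Types (u v w : loopT g) (x y : affT g) (F G : affT g -> affT g).
Let fin u : M u -> finsupp u. Proof. exact: inL_fin. Qed.

Lemma inDerE u c : MD (u, c, 0) <-> M u /\ inF isR c.
Proof. by split=> [[[hu [hc _]] _]|[hu hc]] //; do 2!split=> //; split=> //; apply: inF0. Qed.

Lemma inDerP x : MD x -> exists u c, [/\ M u, inF isR c & x = (u, c, 0)].
Proof. by move: x => [[u c] d] [[hu [hc _]]]; rewrite /dcoef /= => ->; exists u, c. Qed.

Lemma affaddE u c d v c' d' :
  affadd (u, c, d) (v, c', d') = (u + v, c + c', d + d') :> affT g.
Proof. by []. Qed.
Lemma affsclE a u c d : affscl a (u, c, d) = (a *: u, a * c, a * d) :> affT g.
Proof. by []. Qed.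
Lemma affbrE u c d v c' d' : affbr l (u, c, d) (v, c', d') =
  (lpbr u v + (d *: derL l v + (- d') *: derL l u), formL (derL l u) v, 0) :> affT g.
Proof. by []. Qed.
Lemma affbr0E u c v c' : affbr l (u, c, 0) (v, c', 0) = (lpbr u v, formL (derL l u) v, 0) :> affT g.
Proof. by rewrite affbrE oppr0 !scale0r !addr0. Qed.

Lemma uAE u : uA u = (u, 0, 0). Proof. by []. Qed.
Lemma cAE : cA g = (0, 1, 0). Proof. by []. Qed.
Lemma dAE : dA g = (0, 0, 1). Proof. by []. Qed.
Lemma lpbr0l v : lpbr (0 : loopT g) v = 0.
Proof.
by have := lpbr_linl (-1) v (finsupp0 g) (finsupp0 g); rewrite !scaleN1r !addNr.
Qed.
Lemma lpbrZl a u v : finsupp u -> lpbr (a *: u) v = a *: lpbr u v.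
Proof.
by move=> fu; rewrite -[a *: u]addr0 lpbr_linl //; [rewrite lpbr0l addr0|exact: finsupp0].
Qed.
Lemma formL0l v : formL (0 : loopT g) v = 0.
Proof.
have := formL_linl (-1) v (finsupp0 g) (finsupp0 g).
by rewrite scaleN1r addNr mulN1r => {1}->; rewrite addNr.
Qed.
Lemma formLZl a u v : finsupp u -> formL (a *: u) v = a * formL u v.
Proof.
by move=> fu; rewrite -[a *: u]addr0 formL_linl //; [rewrite formL0l addr0|exact: finsupp0].
Qed.
Lemma derL0 : derL l (0 : loopT g) = 0.
Proof. by have := derL_lin l (-1) (0 : loopT g) 0; rewrite !scaleN1r !addNr. Qed.
Lemma derLZ a u : derL l (a *: u) = a *: derL l u.
Proof. by rewrite -[a *: u]addr0 derL_lin derL0 addr0. Qed.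

(* The derived algebra is perfect; [cocycle_nontriv] puts the centre into its commutators. *)
Lemma der_ind (P : affT g -> Prop) :
  (forall x y, MD x -> MD y -> P x -> P y -> P (affadd x y)) ->
  (forall x y, MD x -> MD y -> P (affbr l x y)) -> forall x, MD x -> P x.
Proof.
move=> PD Pbr.
have F0 := inF0 C isR.
have Pc c : inF isR c -> P (0, c, 0).
  move=> Fc; have [u1 [v1 [u2 [v2 [[h1 h2 h3 h4] [e12 n12]]]]]] := cocycle_nontriv gS sA.
  set D := formL (derL l u1) v1 - formL (derL l u2) v2.
  have D0 : D != 0 by rewrite subr_eq0.
  have FD : inF isR D.
    by apply: inFD; last apply: inFN; apply: (formL_inF gS (s := s) (l := l)) => //; apply: inL_der.
  pose t := c / D; have Ft : inF isR t by apply/inFM/inFV.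
  have FNt := inFN Ft.
  have -> : (0, c, 0) = affadd (affbr l (t *: u1, 0, 0) (v1, 0, 0)) (affbr l ((- t) *: u2, 0, 0) (v2, 0, 0)) :> affT g.
    rewrite !affbr0E affaddE !addr0 !lpbrZl ?derLZ ?formLZl;
      try exact: fin; try exact: finsupp_der (fin _).
    rewrite e12 scaleNr subrr; congr (_, _, _).
    by rewrite mulNr -mulrBr -/D divfK.
  have hd x y : MD x -> MD y -> MD (affbr l x y).
    move=> /inDerP[u [a [hu Fa ->]]] /inDerP[v [b [hv Fb ->]]]; rewrite affbr0E; apply/inDerE.
    split; first exact: (inL_br gS sA).
    by apply: (formL_inF gS (s := s) (l := l)) => //; apply: inL_der.
  by apply: PD; try apply: hd; try apply: Pbr; apply/inDerE; split=> //; apply: inLZ.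
have hQ u : M u -> exists2 c, inF isR c & P (u, c, 0).
  move=> hu; elim/(perfect_inL gS sA): u / hu => [|u v hu hv [c Fc Pu] [c' Fc' Pv]|u v hu hv].
  - by exists 0 => //; apply: Pc.
  - exists (c + c'); first exact: inFD.
    have -> : (u + v, c + c', 0) = affadd (u, c, 0) (v, c', 0) :> affT g by rewrite affaddE addr0.
    by apply: PD => //; apply/inDerE.
  - exists (formL (derL l u) v).
      by apply: (formL_inF gS (s := s) (l := l)) => //; apply: inL_der.
    by rewrite -(affbr0E u 0 v 0); apply: Pbr; apply/inDerE.
move=> x /inDerP[u [c [hu Fc ->]]]; have [c' Fc' Pu] := hQ u hu.
have -> : (u, c, 0) = affadd (u, c', 0) (0, c - c', 0) :> affT g.
  by rewrite affaddE !addr0 subrKC.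
have Fcc : inF isR (c - c') by apply/inFD/inFN.
by apply: PD; [apply/inDerE| apply/inDerE; split=> //; apply: inL0| |apply: Pc].
Qed.

Lemma MA_add x y : MA x -> MA y -> MA (affadd x y).
Proof.
move: x y => [[u c] d] [[v c'] d'] [hu [Fc Fd]] [hv [Fc' Fd']].
by split; [apply: inLD|split; apply: inFD].
Qed.
Lemma MA_scl a x : inF isR a -> MA x -> MA (affscl a x).
Proof.
move=> Fa; move: x => [[u c] d] [hu [Fc Fd]].
by split; [apply: inLZ|split; apply: inFM].
Qed.
Lemma MA_br x y : MA x -> MA y -> MA (affbr l x y).
Proof.
move: x y => [[u c] d] [[v c'] d'] [hu [Fc Fd]] [hv [Fc' Fd']]; rewrite affbrE; split.
  apply: inLD; first exact: (inL_br gS sA).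
  by apply: inLD; apply: inLZ; rewrite ?inFN //; apply: inL_der.
split; last exact: inF0.
by apply: (formL_inF gS (s := s) (l := l)) => //; apply: inL_der.
Qed.

(** Brackets have no d-component and generate the derived algebra, so [F] maps it into itself; the
    same argument for the inverse gives surjectivity. *)
Lemma aff_aut_der F : @is_aut C isR Aff F -> @is_aut C isR Der F.
Proof.
have F_der (F' : affT g -> affT g) : @is_aut C isR Aff F' -> forall x, MD x -> MD (F' x).
  move=> [FM [FD [_ [Fbr _]]]] x hx; split; first by apply: FM; case: hx.
  move: x hx; apply: der_ind => [x y [hx _] [hy _] ex ey|x y [hx _] [hy _]].
    by have := FD x y hx hy; rewrite /= => ->; rewrite /dcoef /= -[LHS]/(dcoef _ + dcoef _) ex ey addr0.
  by have := Fbr x y hx hy; rewrite /= => ->.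
move=> FA; have [F' [FA' K K']] := @iso_inverse C isR Aff Aff F (0 : loopT g, 0, 0) MA_add MA_scl MA_br FA.
have [FM [FD [FZ [Fbr [Finj Fsurj]]]]] := FA.
split; first exact: F_der.
split; first by move=> x y [hx _] [hy _]; apply: FD.
split; first by move=> a x Fa [hx _]; apply: FZ.
split; first by move=> x y [hx _] [hy _]; apply: Fbr.
split; first by move=> x y [hx _] [hy _]; apply: Finj.
move=> y hy; exists (F' y); first exact: F_der.
by apply: K'; case: hy.
Qed.

Section DerAut.
Variable F : affT g -> affT g.
Hypothesis FA : @is_aut C isR Der F.
Let FM x : MD x -> MD (F x). Proof. by case: FA => h1 _; apply: h1. Qed.
Let FD x y : MD x -> MD y -> F (affadd x y) = affadd (F x) (F y).
Proof. by case: FA => _ [h1 _]; apply: h1. Qed.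
Let FZ a x : inF isR a -> MD x -> F (affscl a x) = affscl a (F x).
Proof. by case: FA => _ [_ [h1 _]]; apply: h1. Qed.
Let Fbr x y : MD x -> MD y -> F (affbr l x y) = affbr l (F x) (F y).
Proof. by case: FA => _ [_ [_ [h1 _]]]; apply: h1. Qed.
Let Finj x y : MD x -> MD y -> F x = F y -> x = y.
Proof. by case: FA => _ [_ [_ [_ [h1 _]]]]; apply: h1. Qed.
Let Fsurj y : MD y -> exists2 x, MD x & F x = y.
Proof. by case: FA => _ [_ [_ [_ [_ h1]]]]; apply: h1. Qed.

Lemma uA_MD u : M u -> MD (uA u).
Proof. by move=> hu; apply/inDerE; split=> //; apply: inF0. Qed.
Lemma cA_MD : MD (cA g).
Proof. by apply/inDerE; split; [exact: inL0|exact: inF1]. Qed.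

Lemma F_uA u : M u -> exists2 c, inF isR c & F (uA u) = (induced F u, c, 0).
Proof.
move=> hu; have [v [c [hv Fc e]]] := inDerP (FM (uA_MD hu)).
by exists c => //; rewrite /induced e.
Qed.

(** The loop part of F c commutes with every loop, since [F] is onto, and the loop algebra has no
    center. *)
Lemma F_cA : exists k, [/\ inF isR k, k != 0 & F (cA g) = (0, k, 0)].
Proof.
have [v [k [hv Fk e]]] := inDerP (FM cA_MD).
have v0 : v = 0.
  apply: (inL_centerless gS sA (inL_inLC hv)) => z hz.
  have [x hx ex] := Fsurj (uA_MD hz).
  have := Fbr cA_MD hx; rewrite ex e uAE affbr0E.
  have [u [c [hu Fc ->]]] := inDerP hx.
  rewrite cAE affbr0E lpbr0l derL0 formL0l.
  have -> : (0, 0, 0) = affscl 0 (uA (0 : loopT g)) by rewrite affsclE !scale0r !mul0r.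
  rewrite FZ; [|exact: inF0|exact: uA_MD (inL0 _ _ _)].
  have [c' _ ->] := F_uA (inL0 isR s l).
  by rewrite affsclE scale0r => -[].
exists k; split=> //; last by rewrite e v0.
apply/negP => /eqP k0; have : cA g = affscl 0 (cA g).
  apply: Finj; first exact: cA_MD.
    by rewrite cAE affsclE scale0r !mul0r; apply/inDerE; split; [exact: inL0|exact: inF0].
  by rewrite FZ ?e ?v0 ?k0 ?affsclE ?scale0r ?mul0r //; [exact: inF0|exact: cA_MD].
by rewrite cAE affsclE mul0r => -[_ /eqP]; rewrite oner_eq0.
Qed.

Lemma F_decomp u c : M u -> inF isR c -> F (u, c, 0) = affadd (F (uA u)) (affscl c (F (cA g))).
Proof.
move=> hu Fc; have hc : MD (affscl c (cA g)).
  by rewrite cAE affsclE mulr0; apply/inDerE; split; [apply/inLZ/inL0|apply/inFM/inF1].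
rewrite -FZ -?FD //; try exact: uA_MD; last exact: cA_MD.
by rewrite cAE uAE affsclE affaddE scaler0 mulr0 mulr1 addr0 add0r addr0.
Qed.

Lemma F_loop u c : M u -> inF isR c -> aloop (F (u, c, 0)) = induced F u.
Proof.
move=> hu Fc; rewrite F_decomp //; have [k [_ _ ->]] := F_cA.
have [c' _ ->] := F_uA hu.
by rewrite affsclE affaddE /aloop /= scaler0 addr0.
Qed.

Lemma induced_aut : @is_aut C isR Loop (induced F).
Proof.
have [k [Fk k0 ec]] := F_cA.
split; first by move=> u hu; case: (FM (uA_MD hu)) => -[].
split.
  move=> u v hu hv; rewrite /induced /=.
  have -> : uA (lpadd u v) = affadd (uA u) (uA v) by rewrite affaddE !addr0.
  by rewrite FD //; apply: uA_MD.
split.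
  move=> a u Fa hu; rewrite /induced /=.
  have -> : uA (lpscl a u) = affscl a (uA u) by rewrite affsclE !mulr0.
  by rewrite FZ //; apply: uA_MD.
split.
  move=> u v hu hv /=.
  have Fc : inF isR (formL (derL l u) v).
    by apply: (formL_inF gS (s := s) (l := l)) => //; apply: inL_der.
  rewrite -(F_loop (inL_br gS sA hu hv) Fc) -(affbr0E u 0 v 0) Fbr; try exact: uA_MD.
  have [c1 _ e1] := F_uA hu; have [c2 _ e2] := F_uA hv.
  by rewrite -/(uA u) -/(uA v) e1 e2 affbr0E.
split.
  move=> u v hu hv /= e.
  have [c1 F1 e1] := F_uA hu; have [c2 F2 e2] := F_uA hv.
  (* F u and F v may still differ by a multiple of c; adding this multiple of c to [u] removes the
     difference, so that injectivity of [F] applies. *)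
  have Ft : inF isR ((c2 - c1) / k) by apply: inFM; [apply/inFD/inFN|apply: inFV].
  have : (u, (c2 - c1) / k, 0) = uA v.
    apply: Finj; [by apply/inDerE|exact: uA_MD|].
    rewrite F_decomp // ec e1 e2 affsclE affaddE scaler0 mulr0 !addr0 e.
    by rewrite divfK // subrKC.
  by case.
move=> v hv; have [x hx ex] := Fsurj (uA_MD hv).
have [u [c [hu Fc eu]]] := inDerP hx; subst x.
by exists u => //; rewrite -(F_loop hu Fc) ex.
Qed.
End DerAut.

Lemma induced_comp F G : @is_aut C isR Der F -> @is_aut C isR Der G ->
  @eqOn C Loop (induced (F \o G)) (induced F \o induced G).
Proof.
move=> FA GA u hu; have [c Fc e] := F_uA GA hu.
have hG : M (induced G u) by case: (induced_aut GA) => h1 _; apply: h1.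
by rewrite /= /induced /= e (F_loop FA).
Qed.

(** If the induced maps agree, F x and G x differ by a multiple of c, which disappears in brackets;
    brackets generate the derived algebra. *)
Lemma induced_eq F G : @is_aut C isR Der F -> @is_aut C isR Der G ->
  @eqOn C Loop (induced F) (induced G) -> @eqOn C Der F G.
Proof.
move=> FA GA e; apply: der_ind => [x y hx hy ex ey|x y hx hy].
  have [_ [FD _]] := FA; have [_ [GD _]] := GA.
  by rewrite (FD x y hx hy) (GD x y hx hy) ex ey.
have [_ [_ [_ [Fbr _]]]] := FA; have [_ [_ [_ [Gbr _]]]] := GA.
rewrite (Fbr x y hx hy) (Gbr x y hx hy).
have aux z : MD z -> exists2 v, exists c, F z = (v, c, 0) & exists c, G z = (v, c, 0).
  move=> hz; have [u [c [hu Fc ez]]] := inDerP hz.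
  have [FM _] := FA; have [GM _] := GA.
  have [v1 [c1 [_ _ e1]]] := inDerP (FM z hz); have [v2 [c2 [_ _ e2]]] := inDerP (GM z hz).
  have := F_loop FA hu Fc; have := F_loop GA hu Fc; rewrite -ez e1 e2 /aloop /= => -> ->.
  by exists (induced F u); [exists c1|exists c2; rewrite (e u hu)].
have [v [c1 ->] [c2 ->]] := aux x hx; have [v' [c1' ->] [c2' ->]] := aux y hy.
by rewrite /= !affbr0E.
Qed.

End AffineAut.

(** * The explicit form of an affine automorphism *)

Section AffineAut.
Variables (C : numClosedFieldType) (isR : bool) (g : lie_data C).
Variables (s : 'M[C]_(ldim g)) (l : nat).
Hypotheses (gS : tau_simple isR g) (sA : fin_aut isR s l).
Local Notation M := (inL isR s l).
Local Notation MA := (inAff isR s l).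
Local Notation MD := (inDer isR s l).
Local Notation Aff := (Aff isR s l).
Local Notation Der := (Der isR s l).
Local Notation Loop := (Loop isR s l).
Implicit Types (u v w : loopT g) (x y : affT g) (F G : affT g -> affT g).
Let fin u : M u -> finsupp u. Proof. exact: inL_fin. Qed.

Lemma ldim_neq0 : (ldim g)%:R != 0 :> C.
Proof.
rewrite pnatr_eq0; apply/negP => /eqP n0; have [x [y]] := ts_nab gS.
by move: (gbr x y); rewrite n0 => z; rewrite thinmx0 eqxx.
Qed.

Lemma dA_MA : MA (dA g).
Proof. by split; [exact: inL0|split; [exact: inF0|exact: inF1]]. Qed.

Lemma aff_aut_formula F : @is_aut C isR Aff F -> exists (a b : C) phi w,
  [/\ a ^+ 2 = 1, inF isR a, inF isR b, M w & forall u, M u -> M (phi u)] /\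
  [/\ F (cA g) = (0, a, 0),
    forall u v, M u -> M v -> formL (phi u) (phi v) = formL u v &
    forall u c d, MA (u, c, d) -> F (u, c, d) =
      (phi u - (d * a) *: phi w, a * c + formL w u + d * b, a * d)].
Proof.
move=> FA; have FDer := aff_aut_der gS sA FA; have phiA := induced_aut gS sA FDer.
have [a [kap [w [[Fa Fk ak k0 kd] [hw dphi fphi]]]]] := loop_iso_deriv_form gS gS sA sA phiA.
have kap1 : kap = 1 by apply: (mulIf ldim_neq0); rewrite mul1r.
subst kap; rewrite mulr1 in ak; set phi := induced F in phiA dphi fphi.
have {}fphi u v : M u -> M v -> formL (phi u) (phi v) = formL u v.
  by move=> hu hv; rewrite fphi // mul1r.
have [FM [FD [FZ [Fbr _]]]] := FA.
have [phiM [phiD [phiZ [phibr [phi_inj phi_surj]]]]] := phiA.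
have {}FD x y : MA x -> MA y -> F (affadd x y) = affadd (F x) (F y) := FD x y.
have {}FZ c x : inF isR c -> MA x -> F (affscl c x) = affscl c (F x) := FZ c x.
have {}Fbr x y : MA x -> MA y -> F (affbr l x y) = affbr l (F x) (F y) := Fbr x y.
have {}phiM u : M u -> M (phi u) by apply: phiM.
have {}phiD u v : M u -> M v -> phi (u + v) = phi u + phi v := phiD u v.
have {}phiZ c u : inF isR c -> M u -> phi (c *: u) = c *: phi u := phiZ c u.
have {}phibr u v : M u -> M v -> phi (lpbr u v) = lpbr (phi u) (phi v) := phibr u v.
have [k [Fk' kn0 ec]] := F_cA gS sA FDer.
case ed : (F (dA g)) => [[W b] dl].
have [hW [Fb Fdl]] : MA (W, b, dl) by rewrite -ed; apply/FM/dA_MA.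
rewrite /aloop /acoef /dcoef /= in hW Fb Fdl.
have [W0 hW0 eW] := phi_surj W hW.
have e_uA u : M u -> F (uA u) = (phi u, acoef (F (uA u)), 0).
  by move=> hu; have [c _ e] := F_uA FDer hu; rewrite e.
have uAM u : M u -> MA (uA u) by move=> /(uA_MD)[].
have F0 := inF0 C isR.
have bd u : M u -> F (uA (derL l u)) = affbr l (W, b, dl) (phi u, acoef (F (uA u)), 0).
  move=> hu; rewrite -e_uA // -ed -Fbr; [|exact: dA_MA|exact: uAM].
  rewrite dAE !uAE affbrE; congr (F (_, _, _)).
    by rewrite lpbr0l oppr0 scale0r scale1r addr0 add0r.
  by rewrite derL0 formL0l.
have dloop u : M u -> phi (derL l u) = lpbr W (phi u) + dl *: derL l (phi u).
  move=> hu; have := bd u hu; rewrite e_uA; last exact: inL_der.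
  by rewrite affbrE oppr0 scale0r addr0 => -[].
(* Applying [F] to [d, u] = u' expresses phi u' through the image (W, b, dl) of d. Compared with
   [dphi], this makes a multiple of the derivative plus an inner derivation vanish. *)
have [dla W0w] : dl * a - 1 = 0 /\ W0 + dl *: w = 0.
  have MWw : M (W0 + dl *: w) by apply: inLD => //; apply: inLZ.
  apply: (derL_not_inner gS sA (inL_inLC MWw)) => u hu.
  have hdu := inL_der hu; have b1 := inL_br gS sA hW0 hu; have b2 := inL_br gS sA hw hu.
  have m1 : M (a *: derL l u + lpbr w u) by apply: inLD => //; apply: inLZ.
  have m2 : M (lpbr W0 u + dl *: (a *: derL l u + lpbr w u)) by apply: inLD => //; apply: inLZ.
  have e : phi (lpbr W0 u + dl *: (a *: derL l u + lpbr w u)) = phi (derL l u).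
    rewrite dloop // dphi // -eW -[lpbr (phi W0) _]phibr // -phiZ // -phiD //; exact: inLZ.
  have := phi_inj _ _ m2 hdu e => e'.
  have -> : lpbr (W0 + dl *: w) u = dl *: lpbr w u + lpbr W0 u.
    by rewrite addrC lpbr_linl //; exact: fin.
  rewrite scalerBl scale1r -[X in _ - X]e'.
  by loopring.
have dl_a : dl = a.
  move/eqP: dla; rewrite subr_eq0 => /eqP e.
  by rewrite -[dl]mulr1 -ak expr2 mulrA e mul1r.
subst dl.
have W_w : W = - (a *: phi w).
  rewrite -eW; move/eqP: W0w; rewrite addr_eq0 => /eqP ->.
  by rewrite -scaleNr phiZ ?scaleNr //; apply: inFN.
have muE u v : M u -> M v -> acoef (F (uA (lpbr u v))) + formL (derL l u) v * k =
    a * formL (derL l u) v + formL w (lpbr u v).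
  move=> hu hv; have hb := inL_br gS sA hu hv.
  have Ff : inF isR (formL (derL l u) v).
    by apply: (formL_inF gS (s := s) (l := l)) => //; apply: inL_der.
  have := Fbr (uA u) (uA v) (uAM _ hu) (uAM _ hv).
  rewrite !uAE affbr0E (F_decomp FDer) // ec (e_uA _ hb) -!uAE (e_uA _ hu) (e_uA _ hv).
  rewrite affbr0E affsclE affaddE => -[_ ->].
  rewrite dphi // fphi //; last by apply: inLD; [apply/inLZ/inL_der|apply: (inL_br gS sA)].
  rewrite formL_linl; [|exact: finsupp_der (fin hu)|by apply: finsupp_br; apply: fin].
  by rewrite (formL_inv gS (fin hw) (fin hu) (fin hv)).
(* Two pairs of loops with equal brackets but different cocycle values isolate the coefficient of
   the cocycle in [muE]. *)
have ka : k = a.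
  have [u1 [v1 [u2 [v2 [[h1 h2 h3 h4] [e12 n12]]]]]] := cocycle_nontriv gS sA.
  have e1 := muE _ _ h1 h2; have e2 := muE _ _ h3 h4; rewrite e12 in e1.
  have D0 : formL (derL l u1) v1 - formL (derL l u2) v2 != 0 by rewrite subr_eq0.
  move: D0 e1 e2; move: (acoef _) (formL w _) (formL _ v1) (formL _ v2) => m r p q D0 e1 e2.
  apply: (mulfI D0); have -> : (p - q) * k = (m + p * k) - (m + q * k) by ring.
  by rewrite e1 e2; ring.
subst k.
(* Once k = a, the cocycle terms in [muE] cancel: both sides agree on brackets and are additive, so
   perfectness of the real form suffices. *)
have mu u : M u -> acoef (F (uA u)) = formL w u.
  move=> hu; elim/(perfect_inL gS sA): u / hu => [|u v hu hv eu ev|u v hu hv].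
  - have := FZ 0 (uA 0) F0 (uAM _ (inL0 isR s l)); rewrite {1}uAE affsclE scale0r mul0r => ->.
    by rewrite /acoef /= mul0r formL0r //; exact: fin.
  - have := FD (uA u) (uA v) (uAM _ hu) (uAM _ hv).
    rewrite {1 2}uAE affaddE !addr0 => e; have {e} := congr1 (@acoef C g) e.
    rewrite [RHS](_ : _ = acoef (F (uA u)) + acoef (F (uA v))) // eu ev => ->.
    by rewrite -[u in RHS]scale1r formL_linr ?mul1r //; exact: fin.
  by have := muE u v hu hv; rewrite [_ * a]mulrC addrC => /addrI.
exists a, b, phi, w; split=> //; split=> // u c d [hu [Fc Fd]].
have hDu : MD (u, c, 0) by apply/inDerE.
have -> : (u, c, d) = affadd (u, c, 0) (affscl d (dA g)).
  by rewrite dAE affsclE affaddE scaler0 mulr0 mulr1 !addr0 add0r.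
have := FD (u, c, 0) (affscl d (dA g)) hDu.1 (MA_scl Fd dA_MA) => ->.
rewrite (FZ d (dA g) Fd dA_MA).
rewrite (F_decomp FDer) // ec ed (e_uA _ hu) mu // /affadd /affscl /aloop /acoef /dcoef /= !lpE W_w.
congr (_, _, _); last by rewrite mulr0 !add0r mulrC.
  by rewrite scaler0 addr0 scalerN scalerA.
by ring.
Qed.

End AffineAut.

(** * Translations of d and the defect of the natural form *)

Section AffineAut.
Variables (C : numClosedFieldType) (isR : bool) (g : lie_data C).
Variables (s : 'M[C]_(ldim g)) (l : nat).
Hypotheses (gS : tau_simple isR g) (sA : fin_aut isR s l).
Local Notation M := (inL isR s l).
Local Notation MA := (inAff isR s l).
Local Notation MD := (inDer isR s l).
Local Notation Aff := (Aff isR s l).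
Local Notation Der := (Der isR s l).
Implicit Types (u v w : loopT g) (x y : affT g) (F G : affT g -> affT g).
Let fin u : M u -> finsupp u. Proof. exact: inL_fin. Qed.

Definition dshift (nu : C) (x : affT g) : affT g := (aloop x, acoef x + nu * dcoef x, dcoef x).

Lemma dshiftD nu mu x : dshift (nu + mu) x = dshift nu (dshift mu x).
Proof. by rewrite /dshift /= mulrDl [nu * _ + _]addrC addrA. Qed.

Lemma dshift0 x : dshift 0 x = x.
Proof. by move: x => [[u c] d]; rewrite /dshift mul0r addr0. Qed.

Lemma dshiftK nu : cancel (dshift nu) (dshift (- nu)).
Proof. by move=> x; rewrite -dshiftD addNr dshift0. Qed.

Lemma dshift_aut nu : inF isR nu -> @is_aut C isR Aff (dshift nu).
Proof.
move=> Fn.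
have DM mu x : inF isR mu -> MA x -> MA (dshift mu x).
  by move=> Fm [hu [Fc Fd]]; split=> //; split=> //; apply: inFD => //; apply: inFM.
split; first by move=> x; apply: DM.
split.
  move=> [[u c] d] [[v c'] d'] _ _; rewrite /= /dshift affaddE /aloop /acoef /dcoef /=.
  by rewrite affaddE; congr (_, _, _); ring.
split.
  move=> a [[u c] d] _ _; rewrite /= /dshift affsclE /aloop /acoef /dcoef /=.
  by rewrite affsclE; congr (_, _, _); ring.
split.
  move=> [[u c] d] [[v c'] d'] _ _; rewrite /= /dshift !affbrE /aloop /acoef /dcoef /=.
  by rewrite mulr0 addr0.
split; first by move=> x y _ _; apply: (can_inj (dshiftK nu)).
move=> y hy; exists (dshift (- nu) y); first by apply: DM => //; apply: inFN.
by have := dshiftK (- nu) y; rewrite opprK.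
Qed.

Lemma dshift_der nu : @eqOn C Der (dshift nu) id.
Proof. by move=> x /inDerP[u [c [_ _ ->]]]; rewrite /dshift /= mulr0 addr0. Qed.

Lemma dshift_inj nu mu : @eqOn C Aff (dshift nu) (dshift mu) -> nu = mu.
Proof.
move=> /(_ _ (dA_MA isR s l)); rewrite dAE /dshift /= => -[].
by rewrite !mulr1 !add0r.
Qed.

Lemma aff_decomp u c d : (u, c, d) = affadd (u, c, 0) (affscl d (dA g)) :> affT g.
Proof. by rewrite dAE affsclE affaddE scaler0 mulr0 mulr1 !addr0 add0r. Qed.

(** [F] fixes u and u', so F d also acts on loops as the derivative, up to central terms.
    [derL_not_inner] then leaves freedom only in the c-component. *)
Lemma der_fixing_dA F : @is_aut C isR Aff F -> @eqOn C Der F id ->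
  exists2 nu, inF isR nu & F (dA g) = (0, nu, 1).
Proof.
move=> [FM [_ [_ [Fbr _]]]] Fid; have hd := dA_MA isR s l.
case ed : (F (dA g)) => [[W b] dl].
have [hW [Fb Fdl]] : MA (W, b, dl) by rewrite -ed; apply: FM.
rewrite /aloop /acoef /dcoef /= in hW Fb Fdl.
have [d1 W0] : dl - 1 = 0 /\ W = 0.
  apply: (derL_not_inner gS sA (inL_inLC hW)) => u hu.
  have := Fbr (dA g) (uA u) hd (uA_MD hu).1; rewrite /= ed (Fid _ (uA_MD hu)) /=.
  have e : affbr l (dA g) (uA u) = uA (derL l u).
    rewrite dAE !uAE affbrE lpbr0l oppr0 scale0r scale1r addr0 add0r derL0 formL0l //.
  rewrite e (Fid _ (uA_MD (inL_der hu))) /= !uAE affbrE oppr0 scale0r addr0 => -[e1 _].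
  by rewrite scalerBl scale1r addrAC [_ + lpbr _ _]addrC -e1 subrr.
exists b => //; rewrite W0; congr (_, _, _).
by move/eqP: d1; rewrite subr_eq0 => /eqP.
Qed.

Lemma der_fixing_dshift F nu : @is_aut C isR Aff F -> @eqOn C Der F id ->
  F (dA g) = (0, nu, 1) -> @eqOn C Aff F (dshift nu).
Proof.
move=> [_ [FD [FZ _]]] Fid ed [[u c] d] [/= hu [Fc Fd]].
have hD : MD (u, c, 0) by apply/inDerE.
rewrite {1}aff_decomp.
have := FD (u, c, 0) (affscl d (dA g)) hD.1 (MA_scl Fd (dA_MA isR s l)) => /= ->.
have := FZ d (dA g) Fd (dA_MA isR s l) => /= ->.
rewrite ed (Fid _ hD) /= affsclE affaddE /dshift scaler0 addr0 add0r mulr1.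
by rewrite [nu * _]mulrC.
Qed.

Lemma formA_dshift nu x y :
  formA (dshift nu x) (dshift nu y) = formA x y + 2 * nu * (dcoef x * dcoef y).
Proof. by rewrite /formA /dshift /aloop /acoef /dcoef /=; ring. Qed.

(** In the explicit form of [F], the cross terms with phi w cancel against (w, u) c, so the form can
    change only through the norm of F d. Both c and the d-coefficient are scaled by the same [a],
    hence [F] commutes with every [dshift]. *)
Lemma aff_aut_form F : @is_aut C isR Aff F -> exists a : C, [/\ a ^+ 2 = 1,
  forall x y, MA x -> MA y ->
    formA (F x) (F y) = formA x y + dcoef x * dcoef y * formA (F (dA g)) (F (dA g)),
  forall x, MA x -> dcoef (F x) = a * dcoef x &
  forall nu x, inF isR nu -> MA x -> F (dshift nu x) = dshift nu (F x)].
Proof.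
move=> FA; have [a [b [phi [w [[a2 Fa Fb hw phiM] [ec fphi FE]]]]]] := aff_aut_formula gS sA FA.
have hd := dA_MA isR s l; exists a; split=> //.
- have formE u c d v c' d' : MA (u, c, d) -> MA (v, c', d') ->
      formA (F (u, c, d)) (F (v, c', d')) =
      formA (u, c, d) (v, c', d') + d * d' * (formL w w + 2 * a * b).
    move=> hx hy; rewrite !FE //; move: hx hy => [/= hu _] [/= hv _].
    rewrite /formA /aloop /acoef /dcoef /=.
    have [fu [fv fw]] := (fin hu, (fin hv, fin hw)).
    have [pu [pv pw]] := (fin (phiM _ hu), (fin (phiM _ hv), fin (phiM _ hw))).
    rewrite ![_ - _ *: phi w]addrC -!scaleNr formL_linl // !formL_linr // !fphi //.
    rewrite [formL u w]formLC // mulrA.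
    have e : a * a = 1 by rewrite -expr2.
    ring: e.
  move=> [[u c] d] [[v c'] d'] hx hy; rewrite formE // /dcoef /=; congr (_ + _ * _).
  by rewrite dAE formE // /formA /aloop /acoef /dcoef /= formL0l; ring.
- by move=> [[u c] d] hx; rewrite FE.
- move=> nu [[u c] d] Fn hx; have [hu [Fc Fd]] := hx; rewrite /dshift /= !FE //.
    by rewrite /aloop /acoef /dcoef /=; congr (_, _, _); ring.
  by split=> //; split=> //; apply: inFD => //; apply: inFM.
Qed.

End AffineAut.

Lemma is_iso_comp (C : numClosedFieldType) (isR : bool) (A B D : LieAlg C)
    (f : car A -> car B) (f' : car B -> car D) :
  is_iso isR f -> is_iso isR f' -> is_iso isR (f' \o f).
Proof.
move=> [fM [fD [fZ [fbr [finj fsurj]]]]] [gM [gD [gZ [gbr [ginj gsurj]]]]].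
split; first by move=> x /fM/gM.
split; first by move=> x y mx my /=; rewrite fD // gD //; apply: fM.
split; first by move=> a x Fa mx /=; rewrite fZ // gZ //; apply: fM.
split; first by move=> x y mx my /=; rewrite fbr // gbr //; apply: fM.
split; first by move=> x y mx my /= /ginj e; apply: finj => //; apply: e; apply: fM.
move=> z /gsurj[y my <-]; have [x mx <-] := fsurj y my; by exists x.
Qed.

Theorem theorem8p8
  (C : numClosedFieldType) (isR : bool)
  (g h : lie_data C) (s : 'M[C]_(ldim g)) (sh : 'M[C]_(ldim h)) (l lh : nat)
  (Hg : is_simple isR g) (Hh : is_simple isR h)
  (Hs : is_gaut isR s) (Hsh : is_gaut isR sh)
  (Hl : (0 < l)%N) (Hsl : s ^+ l = 1)
  (Hlh : (0 < lh)%N) (Hshl : sh ^+ lh = 1) :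
  (* (i) *)
  (forall phi : loopT g -> loopT h,
     @is_iso C isR (Loop isR s l) (Loop isR sh lh) phi ->
     exists2 phih : affT g -> affT h,
       @is_iso C isR (Aff isR s l) (Aff isR sh lh) phih &
       forall u, inL isR s l u -> induced phih u = phi u) /\
  (* (ii) *)
  ((forall F, @is_aut C isR (Der isR s l) F ->
       @is_aut C isR (Loop isR s l) (induced F)) /\
   (forall F G, @is_aut C isR (Der isR s l) F -> @is_aut C isR (Der isR s l) G ->
       @eqOn C (Loop isR s l) (induced (F \o G)) (induced F \o induced G)) /\
   (forall F G, @is_aut C isR (Der isR s l) F -> @is_aut C isR (Der isR s l) G ->
       @eqOn C (Loop isR s l) (induced F) (induced G) ->
       @eqOn C (Der isR s l) F G) /\
   (forall phi, @is_aut C isR (Loop isR s l) phi ->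
       exists2 F, @is_aut C isR (Der isR s l) F &
                  @eqOn C (Loop isR s l) (induced F) phi)) /\
  (* (iii) *)
  ((forall F, @is_aut C isR (Aff isR s l) F ->
      (@eqOn C (Der isR s l) F id <->
       exists2 nu, inF isR nu &
         [/\ F (cA g) = cA g, F (dA g) = affadd (dA g) (affscl nu (cA g)) &
             forall u, inL isR s l u -> F (uA u) = uA u])) /\
   exists Th : C -> affT g -> affT g,
     (forall nu, inF isR nu ->
        @is_aut C isR (Aff isR s l) (Th nu) /\ @eqOn C (Der isR s l) (Th nu) id) /\
     (forall nu mu, inF isR nu -> inF isR mu ->
        @eqOn C (Aff isR s l) (Th (nu + mu)) (Th nu \o Th mu)) /\
     (forall nu mu, inF isR nu -> inF isR mu ->
        @eqOn C (Aff isR s l) (Th nu) (Th mu) -> nu = mu) /\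
     (forall F, @is_aut C isR (Aff isR s l) F -> @eqOn C (Der isR s l) F id ->
        exists2 nu, inF isR nu & @eqOn C (Aff isR s l) F (Th nu))) /\
  (* (iv) *)
  (exists Psi : (affT g -> affT g) -> (affT g -> affT g) * C,
     (forall F, @is_aut C isR (Aff isR s l) F ->
        is_aut_form isR s l (Psi F).1 /\ inF isR (Psi F).2) /\
     (forall F G, @is_aut C isR (Aff isR s l) F -> @is_aut C isR (Aff isR s l) G ->
        @eqOn C (Aff isR s l) F G ->
        @eqOn C (Aff isR s l) (Psi F).1 (Psi G).1 /\ (Psi F).2 = (Psi G).2) /\
     (forall F G, @is_aut C isR (Aff isR s l) F -> @is_aut C isR (Aff isR s l) G ->
        @eqOn C (Aff isR s l) (Psi (F \o G)).1 ((Psi F).1 \o (Psi G).1) /\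
        (Psi (F \o G)).2 = (Psi F).2 + (Psi G).2) /\
     (forall F G, @is_aut C isR (Aff isR s l) F -> @is_aut C isR (Aff isR s l) G ->
        @eqOn C (Aff isR s l) (Psi F).1 (Psi G).1 -> (Psi F).2 = (Psi G).2 ->
        @eqOn C (Aff isR s l) F G) /\
     (forall a nu, is_aut_form isR s l a -> inF isR nu ->
        exists2 F, @is_aut C isR (Aff isR s l) F &
          @eqOn C (Aff isR s l) (Psi F).1 a /\ (Psi F).2 = nu)).
Proof.
have gS := tau_simpleP Hg; have hS := tau_simpleP Hh.
have sA := fin_autP Hs Hl Hsl; have shA := fin_autP Hsh Hlh Hshl.
have nz (a k : C) : (a * k) ^+ 2 = 1 -> a * k != 0.
  by apply: contra_eq_neq => ->; rewrite expr0n eq_sym oner_neq0.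
split.
  move=> phi phiI.
  have [a [kap [w [[Fa Fk /nz ak _ _] [hw dphi fphi]]]]] := loop_iso_deriv_form gS hS sA shA phiI.
  exists (lift phi a kap w).
    exact: (lift_iso gS hS sA phiI Fa Fk ak hw dphi fphi).
  by move=> u hu; apply: (induced_lift phi a kap w hu).
split.
  split; first by move=> F FA; apply: (induced_aut gS sA FA).
  split; first by move=> F G FA GA; apply: (induced_comp gS sA FA GA).
  split; first by move=> F G FA GA; apply: (induced_eq gS sA FA GA).
  move=> phi phiA.
  have [a [kap [w [[Fa Fk /nz ak _ _] [hw dphi fphi]]]]] := loop_iso_deriv_form gS gS sA sA phiA.
  exists (lift phi a kap w).
    exact: (lift_iso_der gS gS sA phiA Fa Fk ak hw dphi fphi).
  by move=> u hu; apply: (induced_lift phi a kap w hu).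
split.
  split.
    move=> F FA; split=> [Fid|[nu Fn [Fc Fd Fu]] x].
      have [nu Fn ed] := der_fixing_dA gS sA FA Fid; exists nu => //; split.
      - exact/Fid/cA_MD.
      - by rewrite ed dAE cAE affsclE affaddE scaler0 addr0 add0r mulr1 mulr0 addr0.
      - by move=> u hu; apply/Fid/uA_MD.
    move=> /inDerP[u [c [hu Fc' ->]]].
    by rewrite (F_decomp (aff_aut_der gS sA FA)) // Fc Fu // uAE cAE affsclE affaddE scaler0 mulr1 mulr0 !addr0 add0r.
  exists (@dshift C g); split; first by move=> nu Fn; split; [exact: dshift_aut|exact: dshift_der].
  split; first by move=> nu mu _ _ x _; apply: dshiftD.
  split; first by move=> nu mu _ _; apply: dshift_inj.
  move=> F FA Fid; have [nu Fn ed] := der_fixing_dA gS sA FA Fid.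
  by exists nu => //; apply: (der_fixing_dshift FA Fid ed).
(* As (d, d) = 0 and (d + nu c, d + nu c) = 2 nu, half the norm of F d recovers nu; by
   [aff_aut_form] it is 0 exactly when [F] preserves the form. *)
pose defect (F : affT g -> affT g) := 2^-1 * formA (F (dA g)) (F (dA g)).
have two0 : 2 != 0 :> C by rewrite pnatr_eq0.
have hd := dA_MA isR s l.
have Fdef F : @is_aut C isR (Aff isR s l) F -> inF isR (defect F).
  move=> [FM _]; have [hu [Fc Fd]] := FM _ hd; apply: inFM.
    by apply/inFV/conj_inF => _; rewrite rmorph_nat.
  by apply: inFD; [apply: inFD; [exact: (formL_inF gS (s := s) (l := l))|]|]; apply: inFM.
have formA_d F : formA (F (dA g)) (F (dA g)) = 2 * defect F.
  by rewrite /defect mulrA divff // mul1r.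
(* Translating by minus the defect restores the form. This is multiplicative because translations
   are central and the defect is additive: the d-coefficient is scaled by +1 or -1, which the square
   in the defect of a composite does not see. *)
exists (fun F => (dshift (- defect F) \o F, defect F)); split=> /=.
  move=> F FA; have FnD := inFN (Fdef F FA); split; last exact: Fdef.
  split; first exact: (is_iso_comp FA (dshift_aut s l FnD)).
  have [a [a2 formF dF _]] := aff_aut_form gS sA FA.
  move=> x y hx hy /=; rewrite formA_dshift formF // !dF // formA_d.
  have e : a * a = 1 by rewrite -expr2.
  ring: e.
split.
  move=> F G FA GA e; have ed : defect F = defect G by rewrite /defect e.
  by split=> // x hx; rewrite /= ed e.
have defD F G : @is_aut C isR (Aff isR s l) F -> @is_aut C isR (Aff isR s l) G ->
    defect (F \o G) = defect F + defect G.
  move=> FA GA; have [aF [_ formF _ _]] := aff_aut_form gS sA FA.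
  have [aG [aG2 _ dG _]] := aff_aut_form gS sA GA.
  have hGd : inAff isR s l (G (dA g)) by case: GA => GM _; apply: GM.
  apply: (mulfI two0); rewrite mulrDr -!formA_d /= formF // dG // dAE {1 2}/dcoef /= !mulr1.
  by rewrite -expr2 aG2 mul1r -dAE addrC.
split.
  move=> F G FA GA; split; last exact: defD.
  move=> x hx /=; have [aF [_ _ _ Fs]] := aff_aut_form gS sA FA.
  have hGx : inAff isR s l (G x) by case: GA => GM _; apply: GM.
  by rewrite Fs ?inFN ?Fdef // -dshiftD defD // opprD.
split.
  move=> F G FA GA e ed x hx; have := e x hx; rewrite /= ed.
  by apply: (can_inj (dshiftK _)).
move=> A nu [AA formA_A] Fn; exists (dshift nu \o A).
  exact: (is_iso_comp AA (dshift_aut s l Fn)).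
have dnu : defect (dshift nu \o A) = nu.
  have [a [a2 _ dF _]] := aff_aut_form gS sA AA.
  rewrite /defect /= formA_dshift formA_A // dF // dAE /formA /aloop /acoef /dcoef /=.
  have e : a * a = 1 by rewrite -expr2.
  rewrite formL0l; apply: (mulfI two0); rewrite mulVKf //.
  ring: e.
by split=> // x hx; rewrite /= dnu dshiftK.
Qed.
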